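(* Let $k$ be a commutative ring, $d\ge0$ an integer and $(\mathcal K,\mathcal P,\mathcal I)$ a $d$-precluster tilting triple. The connective exact dg category $\tau_{\le0}\mathcal B^{(d+1)}_{\mathcal K,\mathcal P,\mathcal I}$ is concentrated in degree zero if and only if the following conditions hold: (a) The dg category $\mathcal K$ is concentrated in non-negative degrees (in particular, $\mathcal P$ is concentrated in degree zero). (b) For every complex in $H^0(\mathcal K)$ $$0\to K_{d+1}\to P_d\to P_{d-1}\to\cdots\to P_1\to P_0$$ with $K_{d+1}\in H^0(\mathcal K)$ and $P_i\in H^0(\mathcal P)$ for $0\le i\le d$: if the induced complex of Hom spaces in $H^0(\mathcal K)$ $$(P_0,I)\to(P_1,I)\to\cdots\to(P_{d-1},I)\to(P_d,I)\to(K_{d+1},I)\to0$$ is exact for each $I\in\mathcal I$, then the complex of Hom spaces in $H^0(\mathcal K)$ $$0\to(P,K_{d+1})\to(P,P_d)\to(P,P_{d-1})\to\cdots\to(P,P_1)\to(P,P_0)$$ is exact for each $P\in\mathcal P$.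
   Context: All dg categories are small dg $k$-categories. $\tau_{\le 0}\mathcal A$ has the same objects as $\mathcal A$ and morphism complexes $\tau_{\le 0}\mathcal A(X,Y)$. A dg category $\mathcal A$ is additive if $H^0(\mathcal A)$ is additive; connective if $H^i\mathcal A(X,Y)=0$ for all $i>0$; concentrated in degree zero (resp. in non-negative degrees) if $H^i\mathcal A(X,Y)=0$ for $i\ne0$ (resp. $i<0$), for all objects $X,Y$. Additive subcategories are closed under direct summands; a full dg subcategory $\mathcal P\subseteq\mathcal K$ is additive if $H^0(\mathcal P)$ is an additive subcategory of $H^0(\mathcal K)$. $\mathrm{pretr}(\mathcal K)$ is the pretriangulated hull and $\mathrm{tr}(\mathcal K)=H^0(\mathrm{pretr}(\mathcal K))$ the triangulated hull, with suspension $\Sigma$; $\mathrm{Ext}^i(X,Y)=\mathrm{Hom}_{\mathrm{tr}(\mathcal K)}(X,\Sigma^iY)$. For full dg subcategories $\mathcal X,\mathcal Y$ of $\mathrm{pretr}(\mathcal K)$, $\mathcal X\ast\mathcal Y$ is the full dg subcategory of objects $Z$ admitting a triangle $X\to Z\to Y\to\Sigma X$ in $\mathrm{tr}(\mathcal K)$ with $X\in\mathcal X$, $Y\in\mathcal Y$; $\mathcal X$ is extension-closed if $\mathcal X\ast\mathcal X\subseteq\mathcal X$ (up to isomorphism). A subcategory $\mathcal Y\subseteq\mathcal C$ is covariantly finite if every $X\in\mathcal C$ has a morphism $X\to Y$ with $Y\in\mathcal Y$ through which every morphism from $X$ to an object of $\mathcal Y$ factors. For an additive dg category $\mathcal K$,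 connective additive full dg subcategories $\mathcal I\subseteq\mathcal P\subseteq\mathcal K$ and $n\ge0$, $\mathcal B^{(n)}_{\mathcal K,\mathcal P,\mathcal I}$ is the full dg subcategory of $\mathrm{pretr}(\mathcal K)$ on the objects $X\in\mathcal K\ast\Sigma\mathcal K\ast\cdots\ast\Sigma^n\mathcal K$ with $\mathrm{Ext}^i(X,I)=0$ for all $i\ge1$, $I\in\mathcal I$. For $\mathcal K$ additive and $\mathcal I\subseteq\mathcal P\subseteq\mathcal K$ full additive dg subcategories, $(\mathcal K,\mathcal P,\mathcal I)$ is a $d$-precluster tilting triple if: (1) $\mathcal P$ is connective; (2) $H^0(\mathcal I)$ is covariantly finite in $H^0(\mathcal B^{(d)}_{\mathcal K,\mathcal P,\mathcal I})$; (3) $\mathcal K$ is extension-closed in $\mathrm{tr}(\mathcal K)$; (4) $\mathrm{Hom}_{\mathrm{tr}(\mathcal K)}(P,\Sigma^iK)=0=\mathrm{Hom}_{\mathrm{tr}(\mathcal K)}(K,\Sigma^iP)$ for all $i\ge1$, $P\in\mathcal P$, $K\in\mathcal K$; (5) for each $K\in\mathcal K$ there is a triangle $K'\to P\to K\to\Sigma K'$ in $\mathrm{tr}(\mathcal K)$ with $P\in\mathcal P$, $K'\in\mathcal K$. For such a triple, $\mathcal B^{(d+1)}_{\mathcal K,\mathcal P,\mathcal I}$ is extension-closed in $\mathrm{pretr}(\mathcal K)$ and inherits an exact dg structure (its conflations are given by the triangles of $\mathrm{tr}(\mathcal K)$ with all three terms in it), as does its $\tau_{\le0}$-truncation. *)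

(* Defs.v *)
From HB Require Import structures.
From mathcomp Require Import all_boot all_order all_algebra.
From mathcomp Require Import zify.
From mathcomp Require Import boolp.

Set Implicit Arguments.
Unset Strict Implicit.
Unset Printing Implicit Defensive.

Import GRing.Theory.
Local Open Scope ring_scope.
Local Open Scope quotient_scope.

Record submodule (k : comPzRingType) (V : lmodType k) := Submodule {
  smP :> V -> Prop;
  smP0 : smP 0;
  smPL : forall (a : k) (u v : V), smP u -> smP v -> smP (a *: u + v) }.

Section SubQuot.
Variables (k : comPzRingType) (V : lmodType k) (S : submodule V).

Definition smem : pred V := fun v => `[< S v >].

Lemma smem_closed : GRing.subsemimod_closed smem.
Proof.
split; first split.
- exact/asboolP/smP0.
- move=> u v /asboolP Su /asboolP Sv; apply/asboolP.
  by rewrite -[u]scale1r; exact: smPL.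
- move=> a u /asboolP Su; apply/asboolP.
  by rewrite -[a *: u]addr0; apply: smPL => //; exact: smP0.
Qed.

HB.instance Definition _ := GRing.isSubmodClosed.Build k V smem smem_closed.

Record submod := Submod { smval :> V; smvalP : smval \in smem }.
HB.instance Definition _ := [isSub for smval].
HB.instance Definition _ := [Choice of submod by <:].
HB.instance Definition _ := [SubChoice_isSubLmodule of submod by <:].

Definition mksub (v : V) (Sv : S v) : submod :=
  Submod (introT (asboolP (S v)) Sv).

Lemma submodP (v : submod) : S (smval v).
Proof. exact/asboolP/(smvalP v). Qed.

Definition smemZ : zmodClosed V := GRing.ZmodClosed.clone V smem _.
Definition quotmod := Quotient.quot smemZ.
HB.instance Definition _ := Choice.on quotmod.
HB.instance Definition _ := GRing.Zmodule.on quotmod.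

Definition cls (v : V) : quotmod := \pi_(Quotient.quot smemZ) v.

Lemma clsP (u v : V) : cls u = cls v <-> S (u - v).
Proof.
split.
- by move=> /eqP; rewrite -Quotient.idealrBE => /asboolP.
- by move=> Suv; apply/eqP; rewrite -Quotient.idealrBE; apply/asboolP.
Qed.

Lemma cls_surj (x : quotmod) : exists v, cls v = x.
Proof. by exists (repr x); exact: reprK. Qed.

Lemma clsB : {morph cls : u v / u - v}.
Proof. by move=> u v; rewrite /cls (rmorphB, raddfB). Qed.

Lemma clsD : {morph cls : u v / u + v}.
Proof. by move=> u v; rewrite /cls raddfD. Qed.

Definition qscale (a : k) (x : quotmod) : quotmod :=
  cls (a *: repr (x : Quotient.quot smemZ)).

Lemma cls_repr (x : quotmod) : cls (repr (x : Quotient.quot smemZ)) = x.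
Proof. exact: reprK. Qed.

Lemma smPZ (a : k) (u : V) : S u -> S (a *: u).
Proof. by move=> Su; rewrite -[_ *: _]addr0; apply: smPL => //; exact: smP0. Qed.

Lemma qscaleE (a : k) (v : V) : qscale a (cls v) = cls (a *: v).
Proof.
apply/clsP; rewrite -scalerBr; apply: smPZ.
by apply/clsP; rewrite cls_repr.
Qed.

Fact qscaleA (a b : k) (x : quotmod) : qscale a (qscale b x) = qscale (a * b) x.
Proof. by rewrite -[x]cls_repr !qscaleE scalerA. Qed.
Fact qscale1 : left_id 1 qscale.
Proof. by move=> x; rewrite -[x]cls_repr !qscaleE scale1r. Qed.
Fact qscaleDr : right_distributive qscale +%R.
Proof.
by move=> a x y; rewrite -[x]cls_repr -[y]cls_repr -clsD !qscaleE scalerDr clsD.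
Qed.
Fact qscaleDl (x : quotmod) : {morph qscale^~ x : a b / a + b}.
Proof. by move=> a b; rewrite -[x]cls_repr !qscaleE scalerDl clsD. Qed.

HB.instance Definition _ :=
  GRing.Zmodule_isLmodule.Build k quotmod qscaleA qscale1 qscaleDr qscaleDl.

Lemma clsL (a : k) (u v : V) : cls (a *: u + v) = a *: cls u + cls v.
Proof. by rewrite clsD -qscaleE. Qed.

End SubQuot.

Section PiMod.
Variables (k : comPzRingType) (I : Type) (V : I -> lmodType k).

Definition pimod := forall i, V i.
HB.instance Definition _ := gen_eqMixin pimod.
HB.instance Definition _ := gen_choiceMixin pimod.

Definition piadd (f g : pimod) : pimod := fun i => f i + g i.
Definition piopp (f : pimod) : pimod := fun i => - f i.
Definition pizero : pimod := fun=> 0.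
Definition piscale (a : k) (f : pimod) : pimod := fun i => a *: f i.

Lemma pimodP (f g : pimod) : (forall i, f i = g i) -> f = g.
Proof. exact: functional_extensionality_dep. Qed.

Fact piaddA : associative piadd.
Proof. by move=> f g h; apply: pimodP => i; exact: addrA. Qed.
Fact piaddC : commutative piadd.
Proof. by move=> f g; apply: pimodP => i; exact: addrC. Qed.
Fact piadd0 : left_id pizero piadd.
Proof. by move=> f; apply: pimodP => i; exact: add0r. Qed.
Fact piaddN : left_inverse pizero piopp piadd.
Proof. by move=> f; apply: pimodP => i; exact: addNr. Qed.
HB.instance Definition _ :=
  GRing.isZmodule.Build pimod piaddA piaddC piadd0 piaddN.

Fact piscaleA (a b : k) (f : pimod) : piscale a (piscale b f) = piscale (a * b) f.
Proof. by apply: pimodP => i; exact: scalerA. Qed.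
Fact piscale1 : left_id 1 piscale.
Proof. by move=> f; apply: pimodP => i; exact: scale1r. Qed.
Fact piscaleDr : right_distributive piscale +%R.
Proof. by move=> a f g; apply: pimodP => i; exact: scalerDr. Qed.
Fact piscaleDl (f : pimod) : {morph piscale^~ f : a b / a + b}.
Proof. by move=> a b; apply: pimodP => i; exact: scalerDl. Qed.
HB.instance Definition _ :=
  GRing.Zmodule_isLmodule.Build k pimod piscaleA piscale1 piscaleDr piscaleDl.

Lemma piDE (f g : pimod) i : (f + g) i = f i + g i. Proof. by []. Qed.
Lemma piNE (f : pimod) i : (- f) i = - f i. Proof. by []. Qed.
Lemma piZE a (f : pimod) i : (a *: f) i = a *: f i. Proof. by []. Qed.
Lemma pi0E i : (0 : pimod) i = 0. Proof. by []. Qed.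

End PiMod.

Section Sign.
Variable k : comPzRingType.
Definition sgn (n : int) : k := (-1) ^+ `|n|%N.
Lemma sgnD m n : sgn (m + n) = sgn m * sgn n.
Proof.
rewrite /sgn -exprD -signr_odd -[RHS]signr_odd; congr (_ ^+ (nat_of_bool _)).
lia.
Qed.
Lemma sgn1 : sgn 1 = -1. Proof. by rewrite /sgn expr1. Qed.
Lemma sgn0 : sgn 0 = 1. Proof. by []. Qed.
Lemma sgnK n : sgn n * sgn n = 1.
Proof. by rewrite /sgn -exprD addnn -signr_odd odd_double. Qed.
End Sign.

Definition linear_fun (k : comPzRingType) (U V : lmodType k) (f : U -> V) :=
  forall (a : k) (u v : U), f (a *: u + v) = a *: f u + f v.

Section LinearFunOps.
Variables (k : comPzRingType) (U V : lmodType k).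
Implicit Types f g : U -> V.
Lemma linear_funD f g :
  linear_fun f -> linear_fun g -> linear_fun (fun x => f x + g x).
Proof. by move=> lf lg a u v; rewrite lf lg scalerDr addrACA. Qed.
Lemma linear_funZ c f : linear_fun f -> linear_fun (fun x => c *: f x).
Proof. by move=> lf a u v; rewrite lf scalerDr !scalerA mulrC. Qed.
Lemma linear_funB f g :
  linear_fun f -> linear_fun g -> linear_fun (fun x => f x - g x).
Proof.
by move=> lf lg a u v; rewrite lf lg scalerBr opprD addrACA.
Qed.
End LinearFunOps.

Section LinearFun.
Variables (k : comPzRingType) (U V : lmodType k) (f : U -> V).
Hypothesis lf : linear_fun f.
Lemma lin0 : f 0 = 0.
Proof.
have := lf 1 0 0; rewrite scaler0 addr0 scale1r => /eqP.
by rewrite -subr_eq subrr => /eqP <-.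
Qed.
Lemma linD u v : f (u + v) = f u + f v.
Proof. by have := lf 1 u v; rewrite !scale1r. Qed.
Lemma linZ a u : f (a *: u) = a *: f u.
Proof. by rewrite -[_ *: u]addr0 lf lin0 addr0. Qed.
Lemma linN u : f (- u) = - f u.
Proof. by rewrite -scaleN1r linZ scaleN1r. Qed.
Lemma linB u v : f (u - v) = f u - f v.
Proof. by rewrite linD linN. Qed.
Lemma lin_sum (I : Type) (r : seq I) (F : I -> U) :
  f (\sum_(i <- r) F i) = \sum_(i <- r) f (F i).
Proof.
by elim: r => [|i r IH]; rewrite ?big_nil ?lin0 // !big_cons linD IH.
Qed.
End LinearFun.

Record lincat (k : comPzRingType) := LinCat {
  lob : Type;
  lhom : lob -> lob -> lmodType k;
  lid : forall X, lhom X X;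
  lcomp : forall X Y Z, lhom Y Z -> lhom X Y -> lhom X Z;
  lcompA : forall W X Y Z (h : lhom Y Z) (g : lhom X Y) (f : lhom W X),
    lcomp h (lcomp g f) = lcomp (lcomp h g) f;
  lcomp1f : forall X Y (f : lhom X Y), lcomp (lid Y) f = f;
  lcompf1 : forall X Y (f : lhom X Y), lcomp f (lid X) = f;
  lcomp_linl : forall X Y Z (f : lhom X Y), linear_fun (fun g : lhom Y Z => lcomp g f);
  lcomp_linr : forall X Y Z (g : lhom Y Z), linear_fun (fun f : lhom X Y => lcomp g f) }.
Arguments lid {k l} X.
Notation "g ∘ f" := (lcomp g f) (at level 40, left associativity).

Section LinCatNotions.
Variables (k : comPzRingType) (C : lincat k).
Implicit Types (X Y Z : lob C) (S T : lob C -> Prop).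

Definition is_iso X Y (f : lhom X Y) :=
  exists g : lhom Y X, g ∘ f = lid X /\ f ∘ g = lid Y.

Definition isomorphic X Y := exists f : lhom X Y, is_iso f.

Definition summand X Y :=
  exists (i : lhom X Y) (p : lhom Y X), p ∘ i = lid X.

Definition zero_object X :=
  (forall Y (f : lhom X Y), f = 0) /\ (forall Y (f : lhom Y X), f = 0).

Definition biproduct X Y Z :=
  exists (i1 : lhom X Z) (i2 : lhom Y Z) (p1 : lhom Z X) (p2 : lhom Z Y),
    [/\ p1 ∘ i1 = lid X, p2 ∘ i2 = lid Y, p1 ∘ i2 = 0, p2 ∘ i1 = 0
      & i1 ∘ p1 + i2 ∘ p2 = lid Z].

Definition additive_category :=
  (exists X, zero_object X) /\ (forall X Y, exists Z, biproduct X Y Z).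

Definition additive_subcategory S :=
  [/\ exists2 X, S X & zero_object X,
      forall X Y Z, S X -> S Y -> biproduct X Y Z -> S Z
    & forall X Y, S Y -> summand X Y -> S X].

Definition covariantly_finite S T :=
  (forall Y, S Y -> T Y) /\
  forall X, T X -> exists Y, S Y /\ exists f : lhom X Y,
    forall Y' (g : lhom X Y'), S Y' -> exists h : lhom Y Y', g = h ∘ f.

End LinCatNotions.

(* dg k-categories, with cohomological grading (d of degree +1) and
   d(gf) = d(g)f + (-1)^|g| g d(f). Graded pieces are indexed by int, and every
   operation takes a proof of the equation between the degrees involved, so that
   no transport along m + (n + p) = (m + n) + p is needed. *)
Record dgcat (k : comPzRingType) := DGCat {
  dob : Type;
  dhom : dob -> dob -> int -> lmodType k;
  dd : forall X Y (m n : int), m + 1 = n -> dhom X Y m -> dhom X Y n;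
  did : forall X, dhom X X 0;
  dcomp : forall X Y Z (m n p : int), m + n = p ->
    dhom Y Z m -> dhom X Y n -> dhom X Z p;
  dd_lin : forall X Y m n (e : m + 1 = n), linear_fun (@dd X Y m n e);
  dcomp_linl : forall X Y Z m n p (e : m + n = p) (f : dhom X Y n),
    linear_fun (fun g : dhom Y Z m => dcomp e g f);
  dcomp_linr : forall X Y Z m n p (e : m + n = p) (g : dhom Y Z m),
    linear_fun (fun f : dhom X Y n => dcomp e g f);
  dcompA : forall W X Y Z m n p mn np q (e1 : n + p = np) (e2 : m + np = q)
    (e3 : m + n = mn) (e4 : mn + p = q)
    (h : dhom Y Z m) (g : dhom X Y n) (f : dhom W X p),
    dcomp e2 h (dcomp e1 g f) = dcomp e4 (dcomp e3 h g) f;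
  dcomp1f : forall X Y n (e : 0 + n = n) (f : dhom X Y n), dcomp e (did Y) f = f;
  dcompf1 : forall X Y n (e : n + 0 = n) (f : dhom X Y n), dcomp e f (did X) = f;
  ddd : forall X Y m n p (e1 : m + 1 = n) (e2 : n + 1 = p) (f : dhom X Y m),
    dd e2 (dd e1 f) = 0;
  leibniz : forall X Y Z m n p m' n' p' (e : m + n = p) (ep : p + 1 = p')
    (em : m + 1 = m') (en : n + 1 = n') (e1 : m' + n = p') (e2 : m + n' = p')
    (g : dhom Y Z m) (f : dhom X Y n),
    dd ep (dcomp e g f) = dcomp e1 (dd em g) f + sgn k m *: dcomp e2 g (dd en f) }.
Arguments did {k d} X.

Section DGBasics.
Variables (k : comPzRingType) (A : dgcat k).
Implicit Types X Y Z : dob A.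

Definition hcast X Y m n (e : m = n) (f : dhom X Y m) : dhom X Y n :=
  ecast i (dhom X Y i) e f.

Lemma hcast_id X Y m (e : m = m) (f : dhom X Y m) : hcast e f = f.
Proof. by rewrite (eq_irrelevance e erefl). Qed.

Lemma hcastK X Y m n p (e1 : m = n) (e2 : n = p) (e3 : m = p) (f : dhom X Y m) :
  hcast e2 (hcast e1 f) = hcast e3 f.
Proof. by case: p / e2 e3 => e3; case: n / e1 e3 => e3; rewrite !hcast_id. Qed.

Lemma hcast_lin X Y m n (e : m = n) : linear_fun (@hcast X Y m n e).
Proof. by case: n / e => a u v. Qed.

Lemma dcomp_cast X Y Z m n p m' n' p' (em : m = m') (en : n = n') (ep : p = p')
    (e : m + n = p) (e' : m' + n' = p') (g : dhom Y Z m) (f : dhom X Y n) :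
  dcomp e' (hcast em g) (hcast en f) = hcast ep (dcomp e g f).
Proof.
case: m' / em e' => e'; case: n' / en e' => e'; case: p' / ep e' => e' /=.
by rewrite (eq_irrelevance e e').
Qed.

Lemma dd_cast X Y m n m' n' (em : m = m') (en : n = n') (e : m + 1 = n)
   (e' : m' + 1 = n') (f : dhom X Y m) :
  dd e' (hcast em f) = hcast en (dd e f).
Proof.
case: m' / em e' => e'; case: n' / en e' => e' /=.
by rewrite (eq_irrelevance e e').
Qed.

Lemma dd_id X n (e : 0 + 1 = n) : dd e (did X) = 0.
Proof.
have H := leibniz (addr0 0) e e e (etrans (addr0 _) (erefl n)) (etrans (add0r _) (erefl n))
  (did X) (did X).
have E : forall e' : (n + 0 = n :> int), dcomp e' (dd e (did X)) (did X) = dd e (did X).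
  by move=> e'; rewrite dcompf1.
move: H; rewrite dcompf1 E dcomp1f sgn0 scale1r => /eqP.
by rewrite -subr_eq subrr => /eqP <-.
Qed.

Definition is_cocycle X Y n (f : dhom X Y n) :=
  forall m (e : n + 1 = m), dd e f = 0.

Definition is_coboundary X Y n (f : dhom X Y n) :=
  exists m (e : m + 1 = n) (h : dhom X Y m), dd e h = f.

Lemma is_cocycleE X Y n m (e : n + 1 = m) (f : dhom X Y n) :
  dd e f = 0 -> is_cocycle f.
Proof. by move=> H m' e'; case: m / e H => H; case: m' / e'. Qed.

Fact cocycle0 X Y n : @is_cocycle X Y n 0.
Proof. by move=> m e; exact/lin0/dd_lin. Qed.
Fact cocycleL X Y n (a : k) (u v : dhom X Y n) :
  is_cocycle u -> is_cocycle v -> is_cocycle (a *: u + v).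
Proof. by move=> Zu Zv m e; rewrite dd_lin Zu Zv scaler0 addr0. Qed.

Definition Zsub X Y n : submodule (dhom X Y n) :=
  Submodule (@cocycle0 X Y n) (@cocycleL X Y n).

Definition cocycles X Y n : lmodType k := submod (Zsub X Y n).

Fact cobd0 X Y n : is_coboundary (smval (0 : cocycles X Y n)).
Proof. by exists (n - 1), (subrK _ _), 0; exact/lin0/dd_lin. Qed.
Fact cobdL X Y n (a : k) (u v : cocycles X Y n) :
  is_coboundary (smval u) -> is_coboundary (smval v) ->
  is_coboundary (smval (a *: u + v)).
Proof.
move=> [m [e [h hu]]] [m' [e' [h' hv]]].
have em : m' = m by lia.
case: m / em e h hu => e h hu; exists m', e, (a *: h + h').
by rewrite dd_lin hu (eq_irrelevance e e') hv.
Qed.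

Definition Bsub X Y n : submodule (cocycles X Y n) :=
  @Submodule k (cocycles X Y n) (fun u => is_coboundary (smval u))
    (@cobd0 X Y n) (@cobdL X Y n).

(* H^n A(X,Y) *)
Definition cohom X Y n : lmodType k := quotmod (Bsub X Y n).

Definition coh_class X Y n (f : dhom X Y n) (Zf : is_cocycle f) : cohom X Y n :=
  cls (Bsub X Y n) (mksub (S := Zsub X Y n) Zf).

Lemma cocycle_id X : is_cocycle (did X).
Proof. by move=> m e; exact: dd_id. Qed.

Lemma cocycle_comp X Y Z m n p (e : m + n = p) (g : dhom Y Z m) (f : dhom X Y n) :
  is_cocycle g -> is_cocycle f -> is_cocycle (dcomp e g f).
Proof.
move=> Zg Zf p' ep.
have e1 : m + 1 + n = p' by lia.
have e2 : m + (n + 1) = p' by lia.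
rewrite (leibniz e ep erefl erefl e1 e2) Zg Zf.
rewrite (lin0 (@dcomp_linl _ _ _ _ _ _ _ _ _ _)).
by rewrite (lin0 (@dcomp_linr _ _ _ _ _ _ _ _ _ _)) scaler0 addr0.
Qed.

Lemma coh_classP X Y n (f g : dhom X Y n) (Zf : is_cocycle f) (Zg : is_cocycle g) :
  coh_class Zf = coh_class Zg <-> is_coboundary (f - g).
Proof. exact: clsP. Qed.

Lemma coh_class_surj X Y n (x : cohom X Y n) :
  exists (f : dhom X Y n) (Zf : is_cocycle f), x = coh_class Zf.
Proof.
have [v <-] := cls_surj x; exists (smval v), (submodP v).
by congr cls; apply: val_inj.
Qed.

Lemma coh_classL X Y n a (f g h : dhom X Y n)
   (Zf : is_cocycle f) (Zg : is_cocycle g) (Zh : is_cocycle h) :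
  h = a *: f + g -> coh_class Zh = a *: coh_class Zf + coh_class Zg.
Proof. by move=> E; rewrite -clsL; congr cls; apply: val_inj. Qed.

End DGBasics.

Section H0.
Variables (k : comPzRingType) (A : dgcat k).
Implicit Types W X Y Z : dob A.

Lemma cobd_compl X Y Z (g : dhom Y Z 0) (f : dhom X Y 0) (e : 0 + 0 = 0 :> int) :
  is_coboundary g -> is_cocycle f -> is_coboundary (dcomp e g f).
Proof.
move=> [m [em [h <-]]] Zf; have e1 : m + 0 = m by lia.
have e2 : m + (0 + 1) = 0 by lia.
exists m, em, (dcomp e1 h f).
rewrite (leibniz e1 em em erefl e e2) Zf.
by rewrite (lin0 (@dcomp_linr _ _ _ _ _ _ _ _ _ _)) scaler0 addr0.
Qed.

Lemma cobd_compr X Y Z (g : dhom Y Z 0) (f : dhom X Y 0) (e : 0 + 0 = 0 :> int) :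
  is_cocycle g -> is_coboundary f -> is_coboundary (dcomp e g f).
Proof.
move=> Zg [m [em [h <-]]]; have e1 : 0 + m = m by lia.
have e2 : 0 + 1 + m = 0 by lia.
exists m, em, (dcomp e1 g h).
rewrite (leibniz e1 em erefl em e2 e) Zg.
by rewrite (lin0 (@dcomp_linl _ _ _ _ _ _ _ _ _ _)) add0r sgn0 scale1r.
Qed.

Lemma cobdD X Y n (f g : dhom X Y n) :
  is_coboundary f -> is_coboundary g -> is_coboundary (f + g).
Proof.
move=> [m [e [h <-]]] [m' [e' [h' <-]]].
have em : m' = m by lia.
case: m / em e h => e h; exists m', e', (h + h').
by rewrite (linD (@dd_lin _ _ _ _ _ _ _)) (eq_irrelevance e e').
Qed.

Definition coh_repr X Y n (x : cohom X Y n) : cocycles X Y n :=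
  repr (x : Quotient.quot (smemZ (Bsub X Y n))).

Lemma coh_reprP X Y n (x : cohom X Y n) : is_cocycle (smval (coh_repr x)).
Proof. exact: (submodP (coh_repr x)). Qed.

Lemma coh_reprK X Y n (x : cohom X Y n) : coh_class (coh_reprP x) = x.
Proof.
by rewrite -[RHS]cls_repr; congr cls; apply: val_inj.
Qed.

Definition H0comp X Y Z (g : cohom Y Z 0) (f : cohom X Y 0) : cohom X Z 0 :=
  coh_class (cocycle_comp (addr0 0) (coh_reprP g) (coh_reprP f)).

Lemma H0compE X Y Z (g : dhom Y Z 0) (f : dhom X Y 0)
    (Zg : is_cocycle g) (Zf : is_cocycle f) :
  H0comp (coh_class Zg) (coh_class Zf) = coh_class (cocycle_comp (addr0 0) Zg Zf).
Proof.
apply/coh_classP.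
have /coh_classP Eg := coh_reprK (coh_class Zg).
have /coh_classP Ef := coh_reprK (coh_class Zf).
set g' := smval _ in Eg *; set f' := smval _ in Ef *.
have Zf' : is_cocycle f' := coh_reprP _.
have -> : dcomp (addr0 0) g' f' - dcomp (addr0 0) g f =
  dcomp (addr0 0) (g' - g) f' + dcomp (addr0 0) g (f' - f).
  rewrite (linD (@dcomp_linl _ _ _ _ _ _ _ _ _ _)).
  rewrite (linN (@dcomp_linl _ _ _ _ _ _ _ _ _ _)).
  rewrite (linD (@dcomp_linr _ _ _ _ _ _ _ _ _ _)).
  by rewrite (linN (@dcomp_linr _ _ _ _ _ _ _ _ _ _)) addrA subrK.
by apply: cobdD; [exact: cobd_compl | exact: cobd_compr].
Qed.

Lemma coh_class_eq X Y n (f g : dhom X Y n) (Zf : is_cocycle f) (Zg : is_cocycle g) :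
  f = g -> coh_class Zf = coh_class Zg.
Proof. by move=> E; congr cls; apply: val_inj. Qed.

Fact H0compA W X Y Z (h : cohom Y Z 0) (g : cohom X Y 0) (f : cohom W X 0) :
  H0comp h (H0comp g f) = H0comp (H0comp h g) f.
Proof.
have [h' [Zh ->]] := coh_class_surj h; have [g' [Zg ->]] := coh_class_surj g.
have [f' [Zf ->]] := coh_class_surj f; rewrite !H0compE.
exact/coh_class_eq/dcompA.
Qed.

Definition H0id X : cohom X X 0 := coh_class (cocycle_id X).

Fact H0comp1f X Y (f : cohom X Y 0) : H0comp (H0id Y) f = f.
Proof.
have [f' [Zf ->]] := coh_class_surj f; rewrite H0compE.
exact/coh_class_eq/dcomp1f.
Qed.
Fact H0compf1 X Y (f : cohom X Y 0) : H0comp f (H0id X) = f.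
Proof.
have [f' [Zf ->]] := coh_class_surj f; rewrite H0compE.
exact/coh_class_eq/dcompf1.
Qed.
Fact H0comp_linl X Y Z (f : cohom X Y 0) :
  linear_fun (fun g : cohom Y Z 0 => H0comp g f).
Proof.
move=> a u v; have [f' [Zf ->]] := coh_class_surj f.
have [u' [Zu ->]] := coh_class_surj u; have [v' [Zv ->]] := coh_class_surj v.
rewrite -(coh_classL Zu Zv (cocycleL a Zu Zv) erefl) !H0compE.
by apply: coh_classL; exact: dcomp_linl.
Qed.
Fact H0comp_linr X Y Z (g : cohom Y Z 0) :
  linear_fun (fun f : cohom X Y 0 => H0comp g f).
Proof.
move=> a u v; have [g' [Zg ->]] := coh_class_surj g.
have [u' [Zu ->]] := coh_class_surj u; have [v' [Zv ->]] := coh_class_surj v.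
rewrite -(coh_classL Zu Zv (cocycleL a Zu Zv) erefl) !H0compE.
by apply: coh_classL; exact: dcomp_linr.
Qed.

Definition H0 : lincat k :=
  LinCat H0compA H0comp1f H0compf1 H0comp_linl H0comp_linr.

Definition H0mor X Y (f : dhom X Y 0) (Zf : is_cocycle f) : @lhom k H0 X Y :=
  coh_class Zf.

End H0.

Section FullSub.
Variables (k : comPzRingType) (A : dgcat k) (S : dob A -> Prop).

Definition fullsub : dgcat k :=
  @DGCat k {X : dob A | S X} (fun X Y n => dhom (sval X) (sval Y) n)
    (fun X Y => @dd k A (sval X) (sval Y)) (fun X => did (sval X))
    (fun X Y Z => @dcomp k A (sval X) (sval Y) (sval Z))
    (fun X Y => @dd_lin k A (sval X) (sval Y))
    (fun X Y Z => @dcomp_linl k A (sval X) (sval Y) (sval Z))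
    (fun X Y Z => @dcomp_linr k A (sval X) (sval Y) (sval Z))
    (fun W X Y Z => @dcompA k A (sval W) (sval X) (sval Y) (sval Z))
    (fun X Y => @dcomp1f k A (sval X) (sval Y))
    (fun X Y => @dcompf1 k A (sval X) (sval Y))
    (fun X Y => @ddd k A (sval X) (sval Y))
    (fun X Y Z => @leibniz k A (sval X) (sval Y) (sval Z)).

End FullSub.

Section Truncation.
Variables (k : comPzRingType) (A : dgcat k).
Implicit Types W X Y Z : dob A.

(* tau_{<=0} V is V^n for n < 0, the cocycles for n = 0, and 0 for n > 0; it is
   described as a subcomplex of V. *)
Definition in_trunc X Y n (f : dhom X Y n) :=
  (0 < n -> f = 0) /\ (n = 0 -> is_cocycle f).

Fact trunc0 X Y n : @in_trunc X Y n 0.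
Proof. by split=> // _; exact: cocycle0. Qed.
Fact truncL X Y n (a : k) (u v : dhom X Y n) :
  in_trunc u -> in_trunc v -> in_trunc (a *: u + v).
Proof.
move=> [u1 u2] [v1 v2]; split=> n0; last by apply: cocycleL; auto.
by rewrite u1 // v1 // scaler0 addr0.
Qed.

Definition truncsub X Y n : submodule (dhom X Y n) :=
  Submodule (@trunc0 X Y n) (@truncL X Y n).

Fact trunc_dd X Y m n (e : m + 1 = n) (f : dhom X Y m) :
  in_trunc f -> in_trunc (dd e f).
Proof.
move=> [f1 f2]; split=> n0; last by move=> p e'; exact: ddd.
have [m0|m0] : m = 0 \/ 0 < m by lia.
  exact: f2.
by rewrite f1 //; exact/lin0/dd_lin.
Qed.

Fact trunc_id X : in_trunc (did X).
Proof. by split=> // _; exact: cocycle_id. Qed.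

Fact trunc_comp X Y Z m n p (e : m + n = p) (g : dhom Y Z m) (f : dhom X Y n) :
  in_trunc g -> in_trunc f -> in_trunc (dcomp e g f).
Proof.
move=> [g1 g2] [f1 f2].
have [m0|m0] : 0 < m \/ m <= 0 by lia.
  rewrite g1 // (lin0 (@dcomp_linl _ _ _ _ _ _ _ _ _ _)); exact: trunc0.
have [n0|n0] : 0 < n \/ n <= 0 by lia.
  rewrite f1 // (lin0 (@dcomp_linr _ _ _ _ _ _ _ _ _ _)); exact: trunc0.
split=> p0; first by lia.
by apply: cocycle_comp; [apply: g2|apply: f2]; lia.
Qed.

Definition thom X Y n : lmodType k := submod (truncsub X Y n).
Definition tdd X Y m n (e : m + 1 = n) (f : thom X Y m) : thom X Y n :=
  mksub (S := truncsub X Y n) (trunc_dd e (submodP f)).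
Definition tid X : thom X X 0 := mksub (S := truncsub X X 0) (trunc_id X).
Definition tcomp X Y Z m n p (e : m + n = p) (g : thom Y Z m) (f : thom X Y n) :
    thom X Z p :=
  mksub (S := truncsub X Z p) (trunc_comp e (submodP g) (submodP f)).

Definition tau_le0 : dgcat k.
Proof.
apply: (@DGCat k (dob A) thom tdd tid tcomp).
- by move=> X Y m n e a u v; apply: val_inj; exact: dd_lin.
- by move=> X Y Z m n p e f a u v; apply: val_inj; exact: dcomp_linl.
- by move=> X Y Z m n p e f a u v; apply: val_inj; exact: dcomp_linr.
- by move=> *; apply: val_inj; exact: dcompA.
- by move=> *; apply: val_inj; exact: dcomp1f.
- by move=> *; apply: val_inj; exact: dcompf1.
- by move=> *; apply: val_inj; exact: ddd.
- by move=> *; apply: val_inj; exact: leibniz.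
Defined.

End Truncation.

(* Pretriangulated hull, by one-sided twisted complexes (Bondal-Kapranov,
   Drinfeld), in three steps: formal shifts (X, r) = Sigma^r X, finite formal
   direct sums, and Maurer-Cartan twists. *)

(* A degree n map Sigma^r X -> Sigma^s Y is sigma^s f sigma^-r with f in
   A(X,Y)^(n+s-r) and sigma of degree -1; hence composition is that of A and the
   differential is (-1)^s d. *)
Section ShiftCat.
Variables (k : comPzRingType) (A : dgcat k).

Definition sob := (dob A * int)%type.
Implicit Types W X Y Z : sob.

Definition shom X Y (n : int) : lmodType k := dhom X.1 Y.1 (n + Y.2 - X.2).

Fact sdd_deg (m n r s : int) : m + 1 = n -> m + s - r + 1 = n + s - r.
Proof. lia. Qed.
Fact sid_deg (r : int) : 0 = 0 + r - r.
Proof. lia. Qed.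
Fact scomp_deg (m n p r s t : int) :
  m + n = p -> (m + t - s) + (n + s - r) = p + t - r.
Proof. lia. Qed.

Definition sdd X Y m n (e : m + 1 = n) (f : shom X Y m) : shom X Y n :=
  sgn k Y.2 *: dd (sdd_deg X.2 Y.2 e) f.
Definition sid X : shom X X 0 := hcast (sid_deg X.2) (did X.1).
Definition scomp X Y Z m n p (e : m + n = p) (g : shom Y Z m) (f : shom X Y n) :
    shom X Z p :=
  dcomp (scomp_deg X.2 Y.2 Z.2 e) g f.

Fact sdd_lin X Y m n (e : m + 1 = n) : linear_fun (@sdd X Y m n e).
Proof. by move=> a u v; rewrite /sdd dd_lin scalerDr !scalerA mulrC. Qed.

Fact scomp1f X Y n (e : 0 + n = n) (f : shom X Y n) : scomp e (sid Y) f = f.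
Proof.
have e' : 0 + (n + Y.2 - X.2) = n + Y.2 - X.2 by lia.
rewrite /scomp /sid -{1}(hcast_id erefl f).
by rewrite (dcomp_cast _ _ erefl e') dcomp1f.
Qed.

Fact scompf1 X Y n (e : n + 0 = n) (f : shom X Y n) : scomp e f (sid X) = f.
Proof.
have e' : (n + Y.2 - X.2) + 0 = n + Y.2 - X.2 by lia.
rewrite /scomp /sid -{1}(hcast_id erefl f).
by rewrite (dcomp_cast _ _ erefl e') dcompf1.
Qed.

Fact sleibniz X Y Z m n p m' n' p' (e : m + n = p) (ep : p + 1 = p')
    (em : m + 1 = m') (en : n + 1 = n') (e1 : m' + n = p') (e2 : m + n' = p')
    (g : shom Y Z m) (f : shom X Y n) :
  sdd ep (scomp e g f) =
    scomp e1 (sdd em g) f + sgn k m *: scomp e2 g (sdd en f).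
Proof.
rewrite /sdd /scomp (leibniz _ _ (sdd_deg Y.2 Z.2 em) (sdd_deg X.2 Y.2 en)
  (scomp_deg X.2 Y.2 Z.2 e1) (scomp_deg X.2 Y.2 Z.2 e2)).
rewrite (linZ (@dcomp_linl _ _ _ _ _ _ _ _ _ _)).
rewrite (linZ (@dcomp_linr _ _ _ _ _ _ _ _ _ _)) scalerDr !scalerA.
congr (_ + _ *: _); rewrite -!sgnD /sgn.
rewrite -signr_odd -[RHS]signr_odd; congr (_ ^+ (nat_of_bool _)); lia.
Qed.

Definition shiftcat : dgcat k.
Proof.
apply: (@DGCat k sob shom sdd sid scomp).
- exact: sdd_lin.
- by move=> X Y Z m n p e f; exact: dcomp_linl.
- by move=> X Y Z m n p e g; exact: dcomp_linr.
- by move=> *; exact: dcompA.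
- exact: scomp1f.
- exact: scompf1.
- move=> X Y m n p e1 e2 f.
  by rewrite /sdd (linZ (@dd_lin _ _ _ _ _ _ _)) ddd !scaler0.
- exact: sleibniz.
Defined.

End ShiftCat.

Section SumCat.
Variables (k : comPzRingType) (A : dgcat k).

Record fob := Fob { fidx : finType; ffam : fidx -> dob A }.
Implicit Types W X Y Z : fob.

Definition fhom X Y n : lmodType k :=
  pimod (fun i : fidx Y => pimod (fun j : fidx X => dhom (ffam j) (ffam i) n)).

Lemma fhomP X Y n (f g : fhom X Y n) : (forall i j, f i j = g i j) -> f = g.
Proof. by move=> E; apply: pimodP => i; apply: pimodP => j; exact: E. Qed.

Definition fdd X Y m n (e : m + 1 = n) (f : fhom X Y m) : fhom X Y n :=
  fun i j => dd e (f i j).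

Definition fid X : fhom X X 0 := fun i j =>
  match j =P i with
  | ReflectT e => ecast l (dhom (ffam j) (ffam l) 0) e (did (ffam j))
  | ReflectF _ => 0
  end.

Definition fcomp X Y Z m n p (e : m + n = p) (g : fhom Y Z m) (f : fhom X Y n) :
    fhom X Z p :=
  fun i j => \sum_l dcomp e (g i l) (f l j).


Arguments fid : clear implicits.

Lemma fid_diag X i : fid X i i = did (ffam i).
Proof.
by rewrite /fid; case: eqP => // e; rewrite (eq_irrelevance e erefl).
Qed.

Lemma fid_off X i j : i != j -> fid X i j = 0.
Proof. by rewrite /fid eq_sym; case: eqP. Qed.

Fact fdd_lin X Y m n (e : m + 1 = n) : linear_fun (@fdd X Y m n e).
Proof. by move=> a u v; apply: fhomP => i j; exact: dd_lin. Qed.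
Fact fcomp_linl X Y Z m n p (e : m + n = p) (f : fhom X Y n) :
  linear_fun (fun g : fhom Y Z m => fcomp e g f).
Proof.
move=> a u v; apply: fhomP => i j.
rewrite [RHS](_ : _ = a *: fcomp e u f i j + fcomp e v f i j) // /fcomp.
rewrite scaler_sumr -big_split; apply: eq_bigr => l _; exact: dcomp_linl.
Qed.
Fact fcomp_linr X Y Z m n p (e : m + n = p) (g : fhom Y Z m) :
  linear_fun (fun f : fhom X Y n => fcomp e g f).
Proof.
move=> a u v; apply: fhomP => i j.
rewrite [RHS](_ : _ = a *: fcomp e g u i j + fcomp e g v i j) // /fcomp.
rewrite scaler_sumr -big_split; apply: eq_bigr => l _; exact: dcomp_linr.
Qed.

Fact fcompA W X Y Z m n p mn np q (e1 : n + p = np) (e2 : m + np = q)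
    (e3 : m + n = mn) (e4 : mn + p = q)
    (h : fhom Y Z m) (g : fhom X Y n) (f : fhom W X p) :
  fcomp e2 h (fcomp e1 g f) = fcomp e4 (fcomp e3 h g) f.
Proof.
apply: fhomP => i j; rewrite /fcomp.
under eq_bigr => l _ do rewrite (lin_sum (@dcomp_linr _ _ _ _ _ _ _ _ _ _)).
under [RHS]eq_bigr => l _ do rewrite (lin_sum (@dcomp_linl _ _ _ _ _ _ _ _ _ _)).
rewrite exchange_big; apply: eq_bigr => l _; apply: eq_bigr => l' _.
exact: dcompA.
Qed.

Fact fcomp1f X Y n (e : 0 + n = n) (f : fhom X Y n) : fcomp e (fid Y) f = f.
Proof.
apply: fhomP => i j; rewrite /fcomp (bigD1 i) //= fid_diag dcomp1f big1 ?addr0 //.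
move=> l li; rewrite fid_off 1?eq_sym //.
exact: (lin0 (@dcomp_linl _ _ _ _ _ _ _ _ _ _)).
Qed.
Fact fcompf1 X Y n (e : n + 0 = n) (f : fhom X Y n) : fcomp e f (fid X) = f.
Proof.
apply: fhomP => i j; rewrite /fcomp (bigD1 j) //= fid_diag dcompf1 big1 ?addr0 //.
move=> l li; rewrite fid_off //.
exact: (lin0 (@dcomp_linr _ _ _ _ _ _ _ _ _ _)).
Qed.

Fact fleibniz X Y Z m n p m' n' p' (e : m + n = p) (ep : p + 1 = p')
    (em : m + 1 = m') (en : n + 1 = n') (e1 : m' + n = p') (e2 : m + n' = p')
    (g : fhom Y Z m) (f : fhom X Y n) :
  fdd ep (fcomp e g f) =
    fcomp e1 (fdd em g) f + sgn k m *: fcomp e2 g (fdd en f).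
Proof.
apply: fhomP => i j; rewrite /fdd /fcomp (lin_sum (@dd_lin _ _ _ _ _ _ _)).
rewrite [RHS](_ : _ = \sum_l dcomp e1 (dd em (g i l)) (f l j)
  + sgn k m *: \sum_l dcomp e2 (g i l) (dd en (f l j))) //.
rewrite scaler_sumr -big_split; apply: eq_bigr => l _; exact: leibniz.
Qed.

Definition sumcat : dgcat k.
Proof.
apply: (@DGCat k fob fhom fdd fid fcomp).
- exact: fdd_lin.
- exact: fcomp_linl.
- exact: fcomp_linr.
- exact: fcompA.
- exact: fcomp1f.
- exact: fcompf1.
- by move=> X Y m n p e1 e2 f; apply: fhomP => i j; exact: ddd.
- exact: fleibniz.
Defined.

End SumCat.

Section MCCat.
Variables (k : comPzRingType) (A : dgcat k).

(* Objects (X, q) with q of degree 1 and dq + q^2 = 0; the differential of a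
   degree m map f : (X, q) -> (Y, q') is df + q'f - (-1)^m fq. *)
Definition maurer_cartan (X : dob A) (q : dhom X X 1) :=
  forall (n : int) (e : 1 + 1 = n), dd e q + dcomp e q q = 0.

Record mob := Mob { mund : dob A; mtw : dhom mund mund 1; mtwP : maurer_cartan mtw }.
Implicit Types W X Y Z : mob.

Definition mhom X Y n : lmodType k := dhom (mund X) (mund Y) n.

Fact mdd_deg (m n : int) : m + 1 = n -> 1 + m = n.
Proof. lia. Qed.

Definition mdd X Y m n (e : m + 1 = n) (f : mhom X Y m) : mhom X Y n :=
  dd e f + dcomp (mdd_deg e) (mtw Y) f - sgn k m *: dcomp e f (mtw X).

Fact mdd_lin X Y m n (e : m + 1 = n) : linear_fun (@mdd X Y m n e).
Proof.
apply: linear_funB; last by apply: linear_funZ; exact: dcomp_linl.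
by apply: linear_funD; [exact: dd_lin | exact: dcomp_linr].
Qed.

Lemma mddd_aux (V : lmodType k) (s : k) (a b c d e f g : V) :
  s * s = 1 -> a + e = 0 -> d + g = 0 ->
  a + -1 *: b - s *: (c + s *: d) + (b + e - s *: f) - (- s) *: (c + f - s *: g) = 0.
Proof.
move=> ss /eqP; rewrite addr_eq0 => /eqP -> /eqP; rewrite addr_eq0 => /eqP ->.
rewrite scaleN1r scaleNr opprK !scalerN.
have -> : c + f - s *: g = (c - s *: g) + f by rewrite addrAC.
set x := c - _; rewrite (scalerDr s x f) -opprD (addrC b e) [X in X + _]addrACA addNr add0r.
by rewrite -opprD addNr.
Qed.

Fact mddd X Y m n p (e1 : m + 1 = n) (e2 : n + 1 = p) (f : mhom X Y m) :
  mdd e2 (mdd e1 f) = 0.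
Proof.
have e3 : 1 + 1 + m = p by lia.
have e4 : m + (1 + 1) = p by lia.
have qX := mtwP X erefl; have qY := mtwP Y erefl.
rewrite /mdd !(linB (@dd_lin _ _ _ _ _ _ _)) !(linD (@dd_lin _ _ _ _ _ _ _)).
rewrite (linZ (@dd_lin _ _ _ _ _ _ _)) ddd add0r.
rewrite (leibniz (mdd_deg e1) e2 erefl e1 e3 (mdd_deg e2)).
rewrite (leibniz e1 e2 e1 erefl e2 e4).
rewrite !(linB (@dcomp_linr _ _ _ _ _ _ _ _ _ _)) !(linD (@dcomp_linr _ _ _ _ _ _ _ _ _ _)).
rewrite !(linB (@dcomp_linl _ _ _ _ _ _ _ _ _ _)) !(linD (@dcomp_linl _ _ _ _ _ _ _ _ _ _)).
rewrite !(linZ (@dcomp_linr _ _ _ _ _ _ _ _ _ _)) !(linZ (@dcomp_linl _ _ _ _ _ _ _ _ _ _)).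
rewrite sgn1 (_ : sgn k n = - sgn k m); last first.
  by rewrite -e1 sgnD sgn1 mulrN1.
rewrite (dcompA (mdd_deg e1) (mdd_deg e2) erefl e3).
rewrite -(dcompA e1 (mdd_deg e2) (mdd_deg e1) e2).
rewrite -(dcompA erefl e4 e1 e2).
apply: mddd_aux; first exact: sgnK.
- by rewrite -(linD (@dcomp_linl _ _ _ _ _ _ _ _ _ _)) qY;
     exact: (lin0 (@dcomp_linl _ _ _ _ _ _ _ _ _ _)).
- by rewrite -(linD (@dcomp_linr _ _ _ _ _ _ _ _ _ _)) qX;
     exact: (lin0 (@dcomp_linr _ _ _ _ _ _ _ _ _ _)).
Qed.

Lemma mleibniz_aux (V : lmodType k) (s t : k) (a b c e h : V) :
  a + s *: b + c - (s * t) *: e = a + c - s *: h + s *: (b + h - t *: e).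
Proof.
rewrite scalerBr (scalerDr s b h) scalerA addrA; congr (_ - _).
by rewrite [s *: b + _]addrC [RHS]addrA subrK addrAC.
Qed.

Fact mleibniz X Y Z m n p m' n' p' (e : m + n = p) (ep : p + 1 = p')
    (em : m + 1 = m') (en : n + 1 = n') (e1 : m' + n = p') (e2 : m + n' = p')
    (g : mhom Y Z m) (f : mhom X Y n) :
  mdd ep (dcomp e g f) =
    dcomp e1 (mdd em g) f + sgn k m *: dcomp e2 g (mdd en f).
Proof.
rewrite /mdd (leibniz e ep em en e1 e2).
rewrite !(linB (@dcomp_linr _ _ _ _ _ _ _ _ _ _)) !(linD (@dcomp_linr _ _ _ _ _ _ _ _ _ _)).
rewrite !(linB (@dcomp_linl _ _ _ _ _ _ _ _ _ _)) !(linD (@dcomp_linl _ _ _ _ _ _ _ _ _ _)).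
rewrite !(linZ (@dcomp_linr _ _ _ _ _ _ _ _ _ _)) !(linZ (@dcomp_linl _ _ _ _ _ _ _ _ _ _)).
rewrite (dcompA e (mdd_deg ep) (mdd_deg em) e1).
rewrite -(dcompA en e2 e ep).
rewrite (dcompA (mdd_deg en) e2 em e1).
rewrite -e sgnD; exact: mleibniz_aux.
Qed.

Definition mccat : dgcat k.
Proof.
apply: (@DGCat k mob mhom mdd (fun X => did (mund X))
  (fun X Y Z m n p e g f => dcomp e g f)).
- exact: mdd_lin.
- by move=> *; exact: dcomp_linl.
- by move=> *; exact: dcomp_linr.
- by move=> *; exact: dcompA.
- by move=> *; exact: dcomp1f.
- by move=> *; exact: dcompf1.
- exact: mddd.
- exact: mleibniz.
Defined.

End MCCat.

Arguments fid {k A} X.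

Section Pretr.
Variables (k : comPzRingType) (K : dgcat k).

Notation graded := (sumcat (shiftcat K)).
Notation fm X i := (@ffam k (shiftcat K) X i : sob K).

(* Sigma (X, q) = (Sigma X, - sigma q sigma^-1). *)
Definition sus_ob (X : fob (shiftcat K)) : fob (shiftcat K) :=
  @Fob k (shiftcat K) (fidx X)
    (fun i => ((fm X i).1, (fm X i).2 + 1)).

Fact sus_deg (n r s : int) : n + s - r = n + (s + 1) - (r + 1).
Proof. lia. Qed.
Fact desus_deg (m n r s : int) : m + 1 = n -> m + s - r = n + s - (r + 1).
Proof. lia. Qed.

Definition sus_hom (X Y : fob (shiftcat K)) n (f : @dhom k graded X Y n) :
    @dhom k graded (sus_ob X) (sus_ob Y) n :=
  fun i j => @hcast k K (fm X j).1 (fm Y i).1 _ _ (sus_deg n (fm X j).2 (fm Y i).2) (f i j).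

Definition desus_hom (X Y : fob (shiftcat K)) m n (e : m + 1 = n)
    (f : @dhom k graded X Y m) : @dhom k graded (sus_ob X) Y n :=
  fun i j => @hcast k K (fm X j).1 (fm Y i).1 _ _ (desus_deg (fm X j).2 (fm Y i).2 e) (f i j).

Lemma sus_lin (X Y : fob (shiftcat K)) n : linear_fun (@sus_hom X Y n).
Proof.
move=> a u v; apply: fhomP => i j.
exact: (@hcast_lin k K _ _ _ _ (sus_deg n (fm X j).2 (fm Y i).2) a (u i j) (v i j)).
Qed.
Lemma desus_lin (X Y : fob (shiftcat K)) m n (e : m + 1 = n) :
  linear_fun (@desus_hom X Y m n e).
Proof.
move=> a u v; apply: fhomP => i j.
exact: (@hcast_lin k K _ _ _ _ (desus_deg (fm X j).2 (fm Y i).2 e) a (u i j) (v i j)).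
Qed.

Lemma sus_comp (X Y Z : fob (shiftcat K)) m n p (e : m + n = p)
    (g : @dhom k graded Y Z m) (f : @dhom k graded X Y n) :
  dcomp e (sus_hom g) (sus_hom f) = sus_hom (dcomp e g f).
Proof.
apply: fhomP => i j; rewrite /sus_hom /= /fcomp (lin_sum (@hcast_lin _ _ _ _ _ _ _)).
by apply: eq_bigr => l _ /=; exact: dcomp_cast.
Qed.

Lemma desus_compl (X Y Z : fob (shiftcat K)) m n p n' p' (e : m + n = p)
    (en : n + 1 = n') (ep : p + 1 = p') (e' : m + n' = p')
    (g : @dhom k graded Y Z m) (f : @dhom k graded X Y n) :
  dcomp e' g (desus_hom en f) = desus_hom ep (dcomp e g f).
Proof.
apply: fhomP => i j; rewrite /desus_hom /= /fcomp.
rewrite (lin_sum (@hcast_lin _ _ _ _ _ _ _)).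
apply: eq_bigr => l _ /=.
exact: (@dcomp_cast k K _ _ _ _ _ _ _ _ _ erefl (desus_deg _ _ en)
  (desus_deg _ _ ep) (scomp_deg _ _ _ e) (scomp_deg _ _ _ e') (g i l) (f l j)).
Qed.

Lemma desus_compr (X Y Z : fob (shiftcat K)) m n p m' p' (e : m + n = p)
    (em : m + 1 = m') (ep : p + 1 = p') (e' : m' + n = p')
    (g : @dhom k graded Y Z m) (f : @dhom k graded X Y n) :
  dcomp e' (desus_hom em g) (sus_hom f) = desus_hom ep (dcomp e g f).
Proof.
apply: fhomP => i j; rewrite /desus_hom /sus_hom /= /fcomp.
rewrite (lin_sum (@hcast_lin _ _ _ _ _ _ _)).
by apply: eq_bigr => l _ /=; exact: dcomp_cast.
Qed.

Lemma sus_dd (X Y : fob (shiftcat K)) m n (e : m + 1 = n)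
    (f : @dhom k graded X Y m) :
  dd e (sus_hom f) = - sus_hom (dd e f).
Proof.
apply: fhomP => i j; rewrite !piNE /sus_hom /= /fdd /= /sdd /=.
rewrite (linZ (@hcast_lin _ _ _ _ _ _ _)) sgnD sgn1 mulrN1 scaleNr.
congr (- (_ *: _)); exact: dd_cast.
Qed.

Lemma desus_dd (X Y : fob (shiftcat K)) m n p (e : m + 1 = n) (e' : n + 1 = p)
    (f : @dhom k graded X Y m) :
  dd e' (desus_hom e f) = desus_hom e' (dd e f).
Proof.
apply: fhomP => i j; rewrite /desus_hom /= /fdd /= /sdd /=.
rewrite (linZ (@hcast_lin _ _ _ _ _ _ _)).
congr (_ *: _); exact: dd_cast.
Qed.

(* q i j is the component from the j-th to the i-th summand; one-sidedness says
   that q is strictly triangular for some filtration of the finite index set. *)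
Definition one_sided (X : mob graded) : Prop :=
  exists rk : fidx (mund X) -> nat,
    forall i j, (rk j <= rk i)%N -> (mtw X : fhom _ _ _) i j = 0.

Definition pretr : dgcat k := @fullsub k (mccat graded) one_sided.

Definition und (X : dob pretr) : mob graded := @proj1_sig _ one_sided X.

Lemma undP (X : dob pretr) : one_sided (und X).
Proof. exact: (@proj2_sig _ one_sided X). Qed.

Lemma pretr_ddE (X Y : dob pretr) m n (e : m + 1 = n) (f : @dhom k pretr X Y m) :
  @dd k pretr X Y m n e f = @mdd k graded (und X) (und Y) m n e f.
Proof. by []. Qed.

Definition yo_ob (X : dob K) : fob (shiftcat K) :=
  @Fob k (shiftcat K) unit (fun=> (X, 0)).

Fact yo_mc (X : dob K) : @maurer_cartan k graded (yo_ob X) 0.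
Proof.
move=> n e; rewrite (lin0 (@dd_lin _ _ _ _ _ _ _)) add0r.
exact: (lin0 (@dcomp_linl _ _ _ _ _ _ _ _ _ _)).
Qed.
Fact yo_one_sided (X : dob K) : one_sided (Mob (@yo_mc X)).
Proof. by exists (fun=> 0%N). Qed.
Definition yo (X : dob K) : dob pretr := exist one_sided _ (yo_one_sided X).

Fact sus_mc (X : mob graded) : @maurer_cartan k graded (sus_ob (mund X)) (- sus_hom (mtw X)).
Proof.
move=> n e; rewrite (linN (@dd_lin _ _ _ _ _ _ _)) sus_dd opprK.
rewrite (linN (@dcomp_linl _ _ _ _ _ _ _ _ _ _)).
rewrite (linN (@dcomp_linr _ _ _ _ _ _ _ _ _ _)) opprK sus_comp.
by rewrite -(linD (@sus_lin _ _ _)) (mtwP X) (lin0 (@sus_lin _ _ _)).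
Qed.
Fact sus_one_sided (X : mob graded) : one_sided X -> one_sided (Mob (sus_mc X)).
Proof.
move=> [rk Hrk]; exists rk => i j ij /=; rewrite piNE piNE /sus_hom Hrk //.
by rewrite (lin0 (@hcast_lin _ _ _ _ _ _ _)) oppr0.
Qed.
Definition sus (X : dob pretr) : dob pretr :=
  exist one_sided _ (sus_one_sided (undP X)).

Lemma sus_mdd (X Y : mob graded) m n (e : m + 1 = n) (f : mhom X Y m) :
  mdd e (sus_hom f : mhom (Mob (sus_mc X)) (Mob (sus_mc Y)) m) = - sus_hom (mdd e f).
Proof.
rewrite [LHS](_ : _ = dd e (sus_hom f)
  + dcomp (mdd_deg e) (- sus_hom (mtw Y)) (sus_hom f)
  - sgn k m *: dcomp e (sus_hom f) (- sus_hom (mtw X))) //.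
rewrite /mdd sus_dd (linN (@dcomp_linl _ _ _ _ _ _ _ _ _ _)).
rewrite (linN (@dcomp_linr _ _ _ _ _ _ _ _ _ _)) !sus_comp.
rewrite (linB (@sus_lin _ _ _)) (linD (@sus_lin _ _ _)) (linZ (@sus_lin _ _ _)).
by rewrite scalerN !opprD.
Qed.

Fact sus_cocycle (X Y : dob pretr) (f : @dhom k pretr X Y 0) :
  is_cocycle f ->
  @is_cocycle k pretr (sus X) (sus Y) 0
    (sus_hom (f : @dhom k graded (mund (und X)) (mund (und Y)) 0)).
Proof.
move=> Zf n e; rewrite pretr_ddE [LHS](@sus_mdd (und X) (und Y)) -pretr_ddE Zf.
by rewrite (lin0 (@sus_lin _ _ _)) oppr0.
Qed.

Definition sum_ob (X Y : fob (shiftcat K)) : fob (shiftcat K) :=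
  @Fob k (shiftcat K) (fidx X + fidx Y)%type
    (fun i => match i with inl i => fm X i | inr i => fm Y i end).

Definition utri (X Y : fob (shiftcat K)) n (a : @dhom k graded X X n)
    (b : @dhom k graded Y X n) (c : @dhom k graded Y Y n) :
    @dhom k graded (sum_ob X Y) (sum_ob X Y) n :=
  fun i j =>
    match i, j return shom (fm (sum_ob X Y) j) (fm (sum_ob X Y) i) n with
    | inl i, inl j => a i j
    | inl i, inr j => b i j
    | inr _, inl _ => 0
    | inr i, inr j => c i j
    end.

Definition inl_hom (X Y : fob (shiftcat K)) : @dhom k graded X (sum_ob X Y) 0 :=
  fun i j => match i return shom (fm X j) (fm (sum_ob X Y) i) 0 with
    | inl i => fid X i j
    | inr _ => 0
    end.

Definition inr_proj (X Y : fob (shiftcat K)) : @dhom k graded (sum_ob X Y) Y 0 :=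
  fun i j => match j return shom (fm (sum_ob X Y) j) (fm Y i) 0 with
    | inl _ => 0
    | inr j => fid Y i j
    end.

Arguments inl_hom : clear implicits.
Arguments inr_proj : clear implicits.

Lemma utri_mc (X Y : fob (shiftcat K)) (a : @dhom k graded X X 1)
    (b : @dhom k graded Y X 1) (c : @dhom k graded Y Y 1) :
  maurer_cartan a -> maurer_cartan c ->
  (forall (n : int) (e : 1 + 1 = n), dd e b + dcomp e a b + dcomp e b c = 0) ->
  maurer_cartan (utri a b c).
Proof.
have d0l X' Y' Z' (m n p : int) (e : m + n = p) (f : @shom k K X' Y' n) :
    @scomp k K X' Y' Z' m n p e 0 f = 0.
  exact: (lin0 (@dcomp_linl _ _ _ _ _ _ _ _ _ _)).
have d0r X' Y' Z' (m n p : int) (e : m + n = p) (f : @shom k K Y' Z' m) :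
    @scomp k K X' Y' Z' m n p e f 0 = 0.
  exact: (lin0 (@dcomp_linr _ _ _ _ _ _ _ _ _ _)).
move=> Ma Mc Mb n e; apply: fhomP => i j.
rewrite piDE piDE /= /fdd /fcomp big_sumType /=.
case: i j => [i|i] [j|j] /=.
- rewrite [X in _ + (_ + X)]big1 ?addr0; last by move=> l _; exact: d0r.
  by have := congr1 (fun h : fhom _ _ _ => h i j) (Ma n e).
- have := congr1 (fun h : fhom _ _ _ => h i j) (Mb n e).
  by rewrite !piDE addrA.
- rewrite !big1 ?addr0; first exact: (lin0 (@sdd_lin _ _ _ _ _ _ _)).
  + by move=> l _; exact: d0r.
  + by move=> l _; exact: d0l.
- rewrite [X in _ + (X + _)]big1 ?add0r; last by move=> l _; exact: d0l.
  by have := congr1 (fun h : fhom _ _ _ => h i j) (Mc n e).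
Qed.

Lemma dd_inl (X Y : fob (shiftcat K)) n (e : 0 + 1 = n) : dd e (inl_hom X Y) = 0.
Proof.
apply: fhomP => [[i|i]] j.
- by have := congr1 (fun h : fhom _ _ _ => h i j) (dd_id (A := graded) X e).
- exact: (lin0 (@sdd_lin _ _ _ _ _ _ _)).
Qed.

Lemma dd_inr (X Y : fob (shiftcat K)) n (e : 0 + 1 = n) : dd e (inr_proj X Y) = 0.
Proof.
apply: fhomP => i [j|j].
- exact: (lin0 (@sdd_lin _ _ _ _ _ _ _)).
- by have := congr1 (fun h : fhom _ _ _ => h i j) (dd_id (A := graded) Y e).
Qed.

Lemma utri_inl (X Y : fob (shiftcat K)) m n (a : @dhom k graded X X m)
    (b : @dhom k graded Y X m) (c : @dhom k graded Y Y m)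
    (e : m + 0 = n) (e' : 0 + m = n) :
  dcomp e (utri a b c) (inl_hom X Y) = dcomp e' (inl_hom X Y) a.
Proof.
have en : m = n by lia.
case: n / en e e' => e e'; apply: fhomP => [[i|i]] j; rewrite /= /fcomp big_sumType /=.
- rewrite [X in _ + X]big1 ?addr0; last first.
    by move=> l _; exact: (lin0 (@dcomp_linr _ _ _ _ _ _ _ _ _ _)).
  rewrite [LHS](congr1 (fun h : fhom _ _ _ => h i j) (fcompf1 e a)).
  by rewrite [RHS](congr1 (fun h : fhom _ _ _ => h i j) (fcomp1f e' a)).
- rewrite !big1 ?addr0 // => l _.
  + exact: (lin0 (@dcomp_linl _ _ _ _ _ _ _ _ _ _)).
  + exact: (lin0 (@dcomp_linr _ _ _ _ _ _ _ _ _ _)).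
  + exact: (lin0 (@dcomp_linl _ _ _ _ _ _ _ _ _ _)).
Qed.

Lemma utri_inr (X Y : fob (shiftcat K)) m n (a : @dhom k graded X X m)
    (b : @dhom k graded Y X m) (c : @dhom k graded Y Y m)
    (e : m + 0 = n) (e' : 0 + m = n) :
  dcomp e' (inr_proj X Y) (utri a b c) = dcomp e c (inr_proj X Y).
Proof.
have en : m = n by lia.
case: n / en e e' => e e'; apply: fhomP => i [j|j]; rewrite /= /fcomp big_sumType /=.
- rewrite !big1 ?addr0 // => l _.
  + exact: (lin0 (@dcomp_linr _ _ _ _ _ _ _ _ _ _)).
  + exact: (lin0 (@dcomp_linr _ _ _ _ _ _ _ _ _ _)).
  + exact: (lin0 (@dcomp_linl _ _ _ _ _ _ _ _ _ _)).
- rewrite [X in X + _]big1 ?add0r; last first.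
    by move=> l _; exact: (lin0 (@dcomp_linl _ _ _ _ _ _ _ _ _ _)).
  rewrite [LHS](congr1 (fun h : fhom _ _ _ => h i j) (fcomp1f e' c)).
  by rewrite [RHS](congr1 (fun h : fhom _ _ _ => h i j) (fcompf1 e c)).
Qed.

Section Cone.
Variables (X Y : mob graded) (f : @dhom k graded (mund X) (mund Y) 0).
Hypothesis Zf : forall (n : int) (e : 0 + 1 = n),
  @mdd k graded X Y 0 n e f = 0.

(* cone(f) = (Y + Sigma X, [[q_Y, f sigma^-1], [0, q_{Sigma X}]]). *)
Definition cone_ob := sum_ob (mund Y) (sus_ob (mund X)).

Definition cone_tw : @dhom k graded cone_ob cone_ob 1 :=
  utri (mtw Y) (desus_hom (add0r 1) f) (- sus_hom (mtw X)).

Fact cone_mc : maurer_cartan cone_tw.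
Proof.
have e1 : 0 + 1 = 1 :> int := add0r 1.
have e2 : 1 + 0 = 1 :> int := addr0 1.
apply: utri_mc; [exact: mtwP | exact: (sus_mc X) |] => n e.
rewrite (desus_dd _ e) (desus_compl e2 (add0r 1) e e).
rewrite (linN (@dcomp_linr _ _ _ _ _ _ _ _ _ _)).
rewrite (desus_compr e1 (add0r 1) e e).
rewrite -(linD (desus_lin e)) -(linB (desus_lin e)).
have := Zf (add0r 1).
rewrite /mdd sgn0 scale1r (eq_irrelevance (mdd_deg _) e2).
rewrite (eq_irrelevance e1 (add0r 1)) => ->.
exact: (lin0 (desus_lin e)).
Qed.

Fact cone_one_sided : one_sided X -> one_sided Y -> one_sided (Mob cone_mc).
Proof.
case=> rX HX [rY HY].
pose N := (\max_i rY i).+1.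
exists (fun i => match i with inl i => rY i | inr i => N + rX i end)%N.
move=> [i|i] [j|j] //=.
- exact: HY.
- have H1 : (rY i < N)%N by rewrite ltnS; exact: leq_bigmax.
  by move=> H2; move: (leq_trans (leq_addr _ _) H2); rewrite leqNgt H1.
- rewrite leq_add2l => ij.
  by rewrite piNE piNE /sus_hom HX // (lin0 (@hcast_lin _ _ _ _ _ _ _)) oppr0.
Qed.

Fact cone_in_closed (n : int) (e : 0 + 1 = n) :
  @mdd k graded Y (Mob cone_mc) 0 n e (inl_hom _ _) = 0.
Proof.
rewrite /mdd sgn0 scale1r (utri_inl _ _ _ _ e) dd_inl add0r.
by rewrite subrr.
Qed.

Fact cone_out_closed (n : int) (e : 0 + 1 = n) :
  @mdd k graded (Mob cone_mc) (Mob (sus_mc X)) 0 n e (inr_proj _ _) = 0.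
Proof.
rewrite /mdd sgn0 scale1r (utri_inr _ _ _ (mdd_deg e)) dd_inr add0r.
by rewrite subrr.
Qed.

End Cone.

End Pretr.

Arguments inl_hom {k K} X Y.
Arguments inr_proj {k K} X Y.

Definition tr (k : comPzRingType) (K : dgcat k) : lincat k := H0 (pretr K).

Section Triangles.
Variables (k : comPzRingType) (K : dgcat k).
Notation T := (dob (pretr K)).
Notation graded := (sumcat (shiftcat K)).
Implicit Types X Y Z : T.

Fact mdd_cocycle X Y (f : @dhom k (pretr K) X Y 0) (Zf : is_cocycle f) (n : int)
    (e : 0 + 1 = n) :
  @mdd k graded (und X) (und Y) 0 n e f = 0.
Proof. by rewrite -pretr_ddE; exact: Zf. Qed.

Definition cone X Y (f : @dhom k (pretr K) X Y 0) (Zf : is_cocycle f) : T :=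
  exist (@one_sided k K) (Mob (cone_mc (mdd_cocycle Zf)))
    (cone_one_sided (mdd_cocycle Zf) (undP X) (undP Y)).

Definition cone_in X Y (f : @dhom k (pretr K) X Y 0) (Zf : is_cocycle f) :
    @lhom k (tr K) Y (cone Zf) :=
  @H0mor k (pretr K) Y (cone Zf) (inl_hom (mund (und Y)) (sus_ob (mund (und X))))
    (cone_in_closed (mdd_cocycle Zf)).

Definition cone_out X Y (f : @dhom k (pretr K) X Y 0) (Zf : is_cocycle f) :
    @lhom k (tr K) (cone Zf) (sus X) :=
  @H0mor k (pretr K) (cone Zf) (sus X) (inr_proj (mund (und Y)) (sus_ob (mund (und X))))
    (cone_out_closed (mdd_cocycle Zf)).

Definition sus_mor X Y (f : @lhom k (tr K) X Y) : @lhom k (tr K) (sus X) (sus Y) :=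
  @H0mor k (pretr K) (sus X) (sus Y) _ (sus_cocycle (coh_reprP f)).

Lemma sus_morE X Y (f : @dhom k (pretr K) X Y 0) (Zf : is_cocycle f) :
  sus_mor (H0mor Zf) = H0mor (sus_cocycle Zf).
Proof.
apply/coh_classP.
have /coh_classP [m [e [h Eh]]] := coh_reprK (coh_class Zf).
exists m, e, (- sus_hom (h : @dhom k graded (mund (und X)) (mund (und Y)) m)).
rewrite (linN (@dd_lin _ _ _ _ _ _ _)) pretr_ddE.
rewrite [X in - X](@sus_mdd k K (und X) (und Y) m 0 e h) opprK -pretr_ddE Eh.
exact: (linB (@sus_lin _ _ _ _ _)).
Qed.

(* Triangles isomorphic to X' -f-> Y' -> cone(f) -> Sigma X' for a closed degree 0
   map f. *)
Definition distinguished X Y Z (u : @lhom k (tr K) X Y) (v : @lhom k (tr K) Y Z)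
    (w : @lhom k (tr K) Z (sus X)) : Prop :=
  exists (X' Y' : T) (f : @dhom k (pretr K) X' Y' 0) (Zf : is_cocycle f)
    (a : @lhom k (tr K) X X') (b : @lhom k (tr K) Y Y') (c : @lhom k (tr K) Z (cone Zf)),
    [/\ is_iso a, is_iso b & is_iso c] /\
    [/\ H0mor Zf ∘ a = b ∘ u, cone_in Zf ∘ b = c ∘ v
      & cone_out Zf ∘ c = sus_mor a ∘ w].

End Triangles.

Section DGNotions.
Variables (k : comPzRingType) (A : dgcat k).

Definition coh_vanishes (X Y : dob A) (n : int) : Prop :=
  forall x : cohom X Y n, x = 0.

Definition connective : Prop :=
  forall (X Y : dob A) (n : int), 0 < n -> coh_vanishes X Y n.

Definition concentrated_in_degree_zero : Prop :=
  forall (X Y : dob A) (n : int), n != 0 -> coh_vanishes X Y n.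

Definition concentrated_in_nonneg_degrees : Prop :=
  forall (X Y : dob A) (n : int), n < 0 -> coh_vanishes X Y n.

End DGNotions.

Section PreclusterTilting.
Variables (k : comPzRingType) (K : dgcat k).
Implicit Types (S U : dob (pretr K) -> Prop) (P I : dob K -> Prop).

(* Full subcategories of tr(K) are taken up to isomorphism: [hull P] is the
   closure under isomorphism of the image of P. *)
Definition hull P : dob (pretr K) -> Prop :=
  fun X => exists2 Q, P Q & @isomorphic k (tr K) (yo Q) X.

Definition hullK : dob (pretr K) -> Prop := hull (fun=> True).

Definition star S U : dob (pretr K) -> Prop := fun Z =>
  exists X Y (u : @lhom k (tr K) X Z) (v : @lhom k (tr K) Z Y)
      (w : @lhom k (tr K) Y (sus X)),
    [/\ S X, U Y & distinguished u v w].

Definition sus_sub (n : nat) S : dob (pretr K) -> Prop :=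
  fun X => exists2 Y, S Y & X = iter n (@sus k K) Y.

(* K * Sigma K * ... * Sigma^n K *)
Fixpoint star_pow (n : nat) : dob (pretr K) -> Prop :=
  if n is m.+1 then star (star_pow m) (sus_sub m.+1 hullK) else hullK.

Definition extension_closed S : Prop := forall Z, star S S Z -> S Z.

Definition Ext (i : nat) (X Y : dob (pretr K)) : lmodType k :=
  @lhom k (tr K) X (iter i (@sus k K) Y).

Definition Ext_vanishes (i : nat) (X Y : dob (pretr K)) : Prop :=
  forall f : Ext i X Y, f = 0.

(* P does not enter the definition of B_{K,P,I}^(n). *)
Definition inB I (n : nat) : dob (pretr K) -> Prop := fun X =>
  star_pow n X /\
  forall (i : nat) (J : dob K), (1 <= i)%N -> I J -> Ext_vanishes i X (yo J).

Definition Bcat I (n : nat) : dgcat k := @fullsub k (pretr K) (inB I n).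

Record precluster_tilting_triple (d : nat) P I : Prop := {
  pct_additive : additive_category (H0 K);
  pct_P_additive : @additive_subcategory k (H0 K) P;
  pct_I_additive : @additive_subcategory k (H0 K) I;
  pct_I_sub_P : forall X, I X -> P X;
  pct_P_connective : connective (@fullsub k K P);
  pct_cov_finite : @covariantly_finite k (tr K) (hull I) (inB I d);
  pct_ext_closed : extension_closed hullK;
  pct_Ext : forall (i : nat) (Q X : dob K), (1 <= i)%N -> P Q ->
    Ext_vanishes i (yo Q) (yo X) /\ Ext_vanishes i (yo X) (yo Q);
  pct_resolution : forall X : dob K,
    exists (X' Q : dob K) (u : @lhom k (tr K) (yo X') (yo Q))
      (v : @lhom k (tr K) (yo Q) (yo X)) (w : @lhom k (tr K) (yo X) (sus (yo X'))),
      P Q /\ distinguished u v w }.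

End PreclusterTilting.

Definition exact_at (k : comPzRingType) (U V W : lmodType k)
    (f : U -> V) (g : V -> W) : Prop :=
  forall v, g v = 0 <-> exists u, f u = v.

(* X_{d+1} -> X_d -> ... -> X_1 -> X_0 in a k-linear category, with differentials
   del i : X_{i+1} -> X_i for i <= d. The families are indexed by all of nat;
   only the objects X_i with i <= d+1 and the maps del i with i <= d are used. *)
Section Sequences.
Variables (k : comPzRingType) (C : lincat k) (d : nat).
Variables (X : nat -> lob C) (del : forall i, lhom (X i.+1) (X i)).

Definition is_complex : Prop :=
  forall i, (i < d)%N -> del i ∘ del i.+1 = 0.

(* (X_0,J) -> (X_1,J) -> ... -> (X_d,J) -> (X_{d+1},J) -> 0; nothing is required
   at (X_0,J). *)
Definition contra_exact (J : lob C) : Prop :=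
  (forall i, (i < d)%N ->
     exact_at (fun v : lhom (X i) J => v ∘ del i)
              (fun v : lhom (X i.+1) J => v ∘ del i.+1)) /\
  (forall w : lhom (X d.+1) J, exists v : lhom (X d) J, v ∘ del d = w).

(* 0 -> (Q,X_{d+1}) -> (Q,X_d) -> ... -> (Q,X_1) -> (Q,X_0); nothing is required
   at (Q,X_0). *)
Definition co_exact (Q : lob C) : Prop :=
  (forall v : lhom Q (X d.+1), del d ∘ v = 0 -> v = 0) /\
  (forall i, (i < d)%N ->
     exact_at (fun v : lhom Q (X i.+2) => del i.+1 ∘ v)
              (fun v : lhom Q (X i.+1) => del i ∘ v)).

End Sequences.

(* Main.v *)
Require Import Defs.
From mathcomp Require Import all_boot all_order all_algebra.
From mathcomp Require Import zify.

(* An object of K * Sigma K * ... * Sigma^{d+1} K has a resolution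
   X_{d+1} -> ... -> X_0 by an iterated cone construction, with X_i in P for i <= d
   and X_{d+1} in K: since K lies in P * Sigma K and is closed under extensions,
   each K may be replaced by P from the left. If K has no negative cohomology, then
   conversely every complex of that shape resolves an object Z, because the
   obstructions to building the cones lie in negative Ext groups. The long exact
   sequences of the triangles Z_{i+1} -> X_i -> Z_i show that contravariant
   exactness of the complex into J in I is the vanishing of Ext^i(Z, J) for i > 0,
   that is Z in B^(d+1), and that covariant exactness from Q in P is the vanishing
   of Ext^i(Q, Z) for i < 0. As every object of K is resolved by P, the latter
   propagates from P to K, and from K to all of B^(d+1). *)

Set Implicit Arguments.
Unset Strict Implicit.
Unset Printing Implicit Defensive.

Import GRing.Theory.
Local Open Scope ring_scope.

(** * Linear identities in abelian groups *)

(** Triangles are handled at chain level. A triangle X -> E -> Y is represented by an extension that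
    splits once differentials are forgotten; it is governed by a closed class Y -> X of degree 1.
    The octahedral axiom then becomes the regrouping of a threefold graded sum, rotation becomes an
    explicit homotopy equivalence, and the long exact sequences become explicit choices of
    primitives. The suspension enters as an isomorphism X -> Sigma X of degree -1 rather than as a
    functor, so that composition in graded cohomology carries no signs and one statement serves all
    degrees.

    The passage from P to K is an induction on the degree: the triangle Q -> A -> Sigma A' trades
    degree m at A for degree m - 1 at A', again an object of K. It has to start at a degree below
    which everything vanishes, and the length d + 1 of the resolution provides one. *)

Inductive zexp := ZZero | ZAtom of nat | ZAdd of zexp & zexp | ZOpp of zexp.

Fixpoint zeval (V : zmodType) (env : seq V) (e : zexp) : V :=
  match e with
  | ZZero => 0
  | ZAtom n => nth 0 env n
  | ZAdd a b => zeval env a + zeval env b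
  | ZOpp a => - zeval env a
  end.

Fixpoint zcoef (e : zexp) (i : nat) : int :=
  match e with
  | ZZero => 0
  | ZAtom n => (n == i)%:Z
  | ZAdd a b => zcoef a i + zcoef b i
  | ZOpp a => - zcoef a i
  end.

Lemma zeval_sum (V : zmodType) (env : seq V) e :
  zeval env e = \sum_(i < size env) env`_i *~ zcoef e i.
Proof.
elim: e => [|n|a IHa b IHb|a IHa] /=.
- by rewrite big1 // => i _; rewrite mulr0z.
- have [ltn|gen] := ltnP n (size env).
    rewrite (bigD1 (Ordinal ltn)) //= eqxx mulr1z big1 ?addr0 // => i.
    by rewrite -val_eqE /= eq_sym => /negPf ->; rewrite mulr0z.
  rewrite nth_default // big1 // => i _.
  suff -> : (n == i) = false by rewrite mulr0z.
  by apply/eqP => E; move: gen; rewrite E leqNgt ltn_ord.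
- by rewrite IHa IHb -big_split; apply: eq_bigr => i _; rewrite mulrzDr.
- by rewrite IHa -sumrN; apply: eq_bigr => i _; rewrite mulrNz.
Qed.

(** The basis of [zmod]: both sides are integer combinations of the same atoms, so comparing
    finitely many computed coefficients suffices. *)
Lemma zevalP (V : zmodType) (env : seq V) e1 e2 :
  all (fun i => zcoef e1 i == zcoef e2 i) (iota 0 (size env)) ->
  zeval env e1 = zeval env e2.
Proof.
move=> /allP H; rewrite !zeval_sum; apply: eq_bigr => i _.
by have /eqP -> : zcoef e1 i == zcoef e2 i by apply: H; rewrite mem_iota /=.
Qed.

(** Unification gives one index to atoms that agree only up to conversion. *)
Ltac zsame x y := first [constr_eq x y | unify x y].

Ltac zatom_index env x n :=
  match env with
  | cons ?y ?l => let _ := match constr:(0%N) with _ => zsame x y end in n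
  | cons ?y ?l => zatom_index l x constr:(S n)
  end.

Ltac zmem env x :=
  match env with
  | cons ?y ?l => zsame x y
  | cons ?y ?l => zmem l x
  end.

Ltac zatoms env t :=
  lazymatch t with
  | @GRing.zero _ => env
  | @GRing.add _ ?a ?b => let env := zatoms env a in zatoms env b
  | @GRing.opp _ ?a => zatoms env a
  | _ => match constr:(0%N) with
         | _ => let _ := match constr:(0%N) with _ => zmem env t end in env
         | _ => constr:(cons t env)
         end
  end.

Ltac zreify env t :=
  lazymatch t with
  | @GRing.zero _ => constr:(ZZero)
  | @GRing.add _ ?a ?b =>
      let a := zreify env a in let b := zreify env b in constr:(ZAdd a b)
  | @GRing.opp _ ?a => let a := zreify env a in constr:(ZOpp a)
  | _ => let n := zatom_index env t constr:(0%N) in constr:(ZAtom n)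
  end.

Ltac zmod :=
  lazymatch goal with
  | |- @eq ?T ?a ?b =>
    let env := zatoms constr:(@nil T) a in
    let env := zatoms env b in
    let a' := zreify env a in
    let b' := zreify env b in
    refine (@zevalP _ env a' b' _); vm_compute; reflexivity
  end.

(* A map f acts by composition on the product, over all degrees, of the maps into
   its source. This is faithful, and composites of operators carry no degree
   proofs, so that identities of a dg category are checked on operators. *)
Section Operators.
Variables (k : comPzRingType) (A : dgcat k).
Implicit Types W X Y Z : dob A.

Definition elts W X : lmodType k := pimod (fun n : int => dhom W X n).

Fact op_deg (m n : int) : m + (n - m) = n. Proof. lia. Qed.

Definition op W X Y m (f : dhom X Y m) (x : elts W X) : elts W Y :=
  fun n => dcomp (op_deg m n) f (x (n - m)).
Definition bnd W X (x : elts W X) : elts W X := fun n => dd (subrK 1 n) (x (n - 1)).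

Lemma hcast_elt W X (x : elts W X) i j (e : i = j) : hcast e (x i) = x j.
Proof. by case: j / e. Qed.

Lemma op_comp W X Y Z m n p (e : m + n = p) (g : dhom Y Z m) (f : dhom X Y n)
  (x : elts W X) : op (dcomp e g f) x = op g (op f x).
Proof.
apply: pimodP => l; rewrite /op.
have E : l - m - n = l - p by lia.
move: (op_deg p l); rewrite -(hcast_elt x E); case: (l - p) / E => e4 /=.
by rewrite -(dcompA (op_deg _ _) (op_deg _ _) e).
Qed.

Lemma op_id W X (x : elts W X) : op (did X) x = x.
Proof.
apply: pimodP => l; rewrite /op.
have E : l = l - 0 by lia.
move: (op_deg 0 l); rewrite -(hcast_elt x E); case: (l - 0) / E => e /=.
exact: dcomp1f.
Qed.

Lemma op_hcast W X Y m n (e : m = n) (f : dhom X Y m) (x : elts W X) :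
  op (hcast e f) x = op f x.
Proof. by case: n / e. Qed.

Lemma op0l W X Y m (x : elts W X) : op (0 : dhom X Y m) x = 0.
Proof. by apply: pimodP => l; exact: (lin0 (@dcomp_linl _ _ _ _ _ _ _ _ _ _)). Qed.
Lemma opDl W X Y m (f g : dhom X Y m) (x : elts W X) : op (f + g) x = op f x + op g x.
Proof. by apply: pimodP => l; exact: (linD (@dcomp_linl _ _ _ _ _ _ _ _ _ _)). Qed.
Lemma opNl W X Y m (f : dhom X Y m) (x : elts W X) : op (- f) x = - op f x.
Proof. by apply: pimodP => l; exact: (linN (@dcomp_linl _ _ _ _ _ _ _ _ _ _)). Qed.
Lemma opZl W X Y m a (f : dhom X Y m) (x : elts W X) : op (a *: f) x = a *: op f x.
Proof. by apply: pimodP => l; exact: (linZ (@dcomp_linl _ _ _ _ _ _ _ _ _ _)). Qed.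
Lemma op0 W X Y m (f : dhom X Y m) : op f (0 : elts W X) = 0.
Proof. by apply: pimodP => l; exact: (lin0 (@dcomp_linr _ _ _ _ _ _ _ _ _ _)). Qed.
Lemma opD W X Y m (f : dhom X Y m) (x y : elts W X) : op f (x + y) = op f x + op f y.
Proof. by apply: pimodP => l; exact: (linD (@dcomp_linr _ _ _ _ _ _ _ _ _ _)). Qed.
Lemma opN W X Y m (f : dhom X Y m) (x : elts W X) : op f (- x) = - op f x.
Proof. by apply: pimodP => l; exact: (linN (@dcomp_linr _ _ _ _ _ _ _ _ _ _)). Qed.
Lemma opZ W X Y m a (f : dhom X Y m) (x : elts W X) : op f (a *: x) = a *: op f x.
Proof. by apply: pimodP => l; exact: (linZ (@dcomp_linr _ _ _ _ _ _ _ _ _ _)). Qed.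

Lemma bnd0 W X : bnd (0 : elts W X) = 0.
Proof. by apply: pimodP => l; exact: (lin0 (@dd_lin _ _ _ _ _ _ _)). Qed.
Lemma bndD W X (x y : elts W X) : bnd (x + y) = bnd x + bnd y.
Proof. by apply: pimodP => l; exact: (linD (@dd_lin _ _ _ _ _ _ _)). Qed.
Lemma bndN W X (x : elts W X) : bnd (- x) = - bnd x.
Proof. by apply: pimodP => l; exact: (linN (@dd_lin _ _ _ _ _ _ _)). Qed.
Lemma bndZ W X a (x : elts W X) : bnd (a *: x) = a *: bnd x.
Proof. by apply: pimodP => l; exact: (linZ (@dd_lin _ _ _ _ _ _ _)). Qed.

Lemma op_dd W X Y m n (e : m + 1 = n) (f : dhom X Y m) (x : elts W X) :
  op (dd e f) x = bnd (op f x) - sgn k m *: op f (bnd x).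
Proof.
apply: pimodP => l; apply/esym/eqP; rewrite subr_eq; apply/eqP.
rewrite [LHS](_ : _ = dd (subrK 1 l) (op f x (l - 1))) //.
rewrite [RHS](_ : _ = dcomp (op_deg n l) (dd e f) (x (l - n)) +
   sgn k m *: dcomp (op_deg m l) f (dd (subrK 1 (l - m)) (x (l - m - 1)))) //.
rewrite /op.
have E : l - n = l - 1 - m by lia.
rewrite -(hcast_elt x E).
have E' : l - n = l - m - 1 by lia.
rewrite -(hcast_elt x E').
move: (subrK 1 (l - m)) (op_deg n l) (op_deg m (l - 1)).
case: (l - 1 - m) / E; case: (l - m - 1) / E' => e1 e2 e3 /=.
exact: leibniz.
Qed.

Lemma op_inj X Y m (f g : dhom X Y m) :
  (forall W (x : elts W X), op f x = op g x) -> f = g.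
Proof.
(* The identity in degree 0 and zero elsewhere: as in the Yoneda lemma, evaluating an operator there
   in degree [m] returns the map. *)
pose x : elts X X := fun n =>
  match 0 =P n with ReflectT e => hcast e (did X) | ReflectF _ => 0 end.
have opx (h : dhom X Y m) : op h x m = h.
  rewrite /op /x; case: eqP => [e|]; last by lia.
  move: (op_deg m m); case: (m - m) / e => e /=; exact: dcompf1.
by move=> /(_ X x) E; rewrite -(opx f) E opx.
Qed.
End Operators.

(* The unification in zmod must not unfold operators. *)
Global Opaque op bnd.

Section Cocycles.
Variables (k : comPzRingType) (A : dgcat k).
Implicit Types W X Y Z : dob A.

Lemma bnd_bnd W X (x : elts W X) : bnd (bnd x) = 0.
Proof. by apply: pimodP => l; exact: ddd. Qed.

Lemma op_cocycle W X Y m (f : dhom X Y m) (x : elts W X) :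
  is_cocycle f -> bnd (op f x) = sgn k m *: op f (bnd x).
Proof. by move=> Zf; apply/eqP; rewrite -subr_eq0 -(op_dd erefl) Zf op0l. Qed.

Lemma op_cocycle0 W X Y (f : dhom X Y 0) (x : elts W X) :
  is_cocycle f -> bnd (op f x) = op f (bnd x).
Proof. by move=> /op_cocycle ->; rewrite sgn0 scale1r. Qed.

Lemma cocycle_op X Y m (f : dhom X Y m) :
  (forall W (x : elts W X), bnd (op f x) = sgn k m *: op f (bnd x)) -> is_cocycle f.
Proof.
move=> E n e; apply: op_inj => W x; rewrite op_dd E op0l; exact: subrr.
Qed.

Lemma cocycle_op0 X Y (f : dhom X Y 0) :
  (forall W (x : elts W X), bnd (op f x) = op f (bnd x)) -> is_cocycle f.
Proof. by move=> E; apply: cocycle_op => W x; rewrite sgn0 scale1r. Qed.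

Lemma sgnN1 : sgn k (-1) = -1. Proof. by rewrite /sgn expr1. Qed.

Definition opE := (op_hcast, op_comp, op_id, opDl, opNl, op0l, opD, opN, op0,
  bndD, bndN, bnd0, bnd_bnd).

End Cocycles.

(* An extension E of Y by X that is split as an extension of graded objects. Its
   class is a closed map Y -> X of degree 1, and E is the cone of the
   corresponding map Sigma^-1 Y -> X. *)
Section SplitExtensions.
Variables (k : comPzRingType) (A : dgcat k).
Implicit Types W X Y Z E : dob A.

Record split_ext X E Y := SplitExt {
  se_i : dhom X E 0; se_r : dhom E X 0; se_s : dhom Y E 0; se_p : dhom E Y 0;
  se_ri : forall W (x : elts W X), op se_r (op se_i x) = x;
  se_ps : forall W (x : elts W Y), op se_p (op se_s x) = x;
  se_pi : forall W (x : elts W X), op se_p (op se_i x) = 0;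
  se_rs : forall W (x : elts W Y), op se_r (op se_s x) = 0;
  se_id : forall W (x : elts W E), op se_i (op se_r x) + op se_s (op se_p x) = x;
  se_Zi : is_cocycle se_i;
  se_Zp : is_cocycle se_p }.

Fact se_class_key : unit. Proof. exact: tt. Qed.
(** The composite [r ds] measures the failure of the section [s] to be closed. The lock keeps it an
    atom for rewriting and for [zmod]. *)
Definition se_class X E Y (S : split_ext X E Y) : dhom Y X 1 :=
  locked_with se_class_key (dcomp (add0r 1) (se_r S) (dd (add0r 1) (se_s S))).
Canonical se_class_unlockable X E Y (S : split_ext X E Y) :=
  [unlockable of se_class S].

Section Rules.
Variables (X E Y : dob A) (S : split_ext X E Y).
Local Notation i := (se_i S).
Local Notation r := (se_r S).
Local Notation s := (se_s S).
Local Notation p := (se_p S).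
Local Notation b := (se_class S).

Lemma se_sp W (x : elts W E) : op s (op p x) = x - op i (op r x).
Proof. by rewrite -{2}(se_id S x); zmod. Qed.

Lemma se_bnd_i W (x : elts W X) : bnd (op i x) = op i (bnd x).
Proof. exact/op_cocycle0/se_Zi. Qed.

Lemma se_bnd_p W (x : elts W E) : bnd (op p x) = op p (bnd x).
Proof. exact/op_cocycle0/se_Zp. Qed.

(** The closed map [p] kills [bnd (op s x) - op s (bnd x)]. An element killed by [p] is [i r] of
    itself, and [r] of this one is the class. *)
Lemma se_bnd_s W (x : elts W Y) : bnd (op s x) = op s (bnd x) + op i (op b x).
Proof.
rewrite unlock op_comp (op_dd (add0r 1)) sgn0 scale1r.
have := se_sp (bnd (op s x) - op s (bnd x)).
rewrite opD opN -se_bnd_p !(se_ps S) subrr op0 => /esym/eqP.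
by rewrite subr_eq0 => /eqP <-; zmod.
Qed.

Lemma se_bnd_r W (x : elts W E) : bnd (op r x) = op r (bnd x) - op b (op p x).
Proof.
rewrite -{2}(se_id S x) bndD se_bnd_i se_bnd_s !opD.
by rewrite !(se_ri S) (se_rs S); zmod.
Qed.

(** The [r]-component of [bnd (bnd (op s x)) = 0]. *)
Lemma se_bnd_b W (x : elts W Y) : bnd (op b x) = - op b (bnd x).
Proof.
have := congr1 (fun y => op r y) (bnd_bnd (op s x)).
rewrite /= se_bnd_s bndD se_bnd_s se_bnd_i !opD bnd_bnd !op0 !(se_ri S) add0r => /eqP.
by rewrite addrC addr_eq0 => /eqP.
Qed.

Lemma se_class_cocycle : is_cocycle b.
Proof. by apply: cocycle_op => W x; rewrite se_bnd_b sgn1 scaleN1r. Qed.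

(** Together with [opE] these rules push [bnd] inwards and replace [s p] by [1 - i r]; what remains
    of an identity is linear and is left to [zmod]. *)
Definition seE := (se_ri S, se_ps S, se_pi S, se_rs S, se_sp, se_bnd_i, se_bnd_p,
  se_bnd_s, se_bnd_r, se_bnd_b).

End Rules.

End SplitExtensions.

(** * The graded homotopy category *)

Section GradedCohomology.
Variables (k : comPzRingType) (A : dgcat k).
Implicit Types W X Y Z E : dob A.

Definition hc X Y Z m n p (e : m + n = p) (g : cohom Y Z m) (f : cohom X Y n) :
    cohom X Z p :=
  coh_class (cocycle_comp e (coh_reprP g) (coh_reprP f)).

Lemma hc_H0 X Y Z (g : @lhom k (H0 A) Y Z) (f : @lhom k (H0 A) X Y) :
  g ∘ f = hc (addr0 0) g f.
Proof. by []. Qed.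

Lemma cobd_comp_l X Y Z m n p (e : m + n = p) (g : dhom Y Z m) (f : dhom X Y n) :
  is_coboundary g -> is_cocycle f -> is_coboundary (dcomp e g f).
Proof.
move=> [m' [em [h <-]]] Zf.
have e1 : m' + n = p - 1 by lia.
have ep : p - 1 + 1 = p by lia.
exists (p - 1), ep, (dcomp e1 h f); apply: op_inj => W x.
rewrite !(opE, op_dd) (op_cocycle x Zf) opZ scalerA -sgnD.
by rewrite (_ : p - 1 = m' + n); last lia.
Qed.

Lemma cobd_comp_r X Y Z m n p (e : m + n = p) (g : dhom Y Z m) (f : dhom X Y n) :
  is_cocycle g -> is_coboundary f -> is_coboundary (dcomp e g f).
Proof.
move=> Zg [n' [en [h <-]]].
have e1 : m + n' = p - 1 by lia.
have ep : p - 1 + 1 = p by lia.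
exists (p - 1), ep, (sgn k m *: dcomp e1 g h); apply: op_inj => W x.
rewrite !(opE, op_dd) opZl opE bndZ (op_cocycle _ Zg) !opZ scalerA sgnK scale1r.
rewrite opZl op_comp (_ : p - 1 = m + n'); last lia.
by rewrite sgnD scalerA mulrAC sgnK mul1r.
Qed.

Lemma hcE X Y Z m n p (e : m + n = p) (g : dhom Y Z m) (f : dhom X Y n)
    (Zg : is_cocycle g) (Zf : is_cocycle f) :
  hc e (coh_class Zg) (coh_class Zf) = coh_class (cocycle_comp e Zg Zf).
Proof.
apply/coh_classP.
have /coh_classP Eg := coh_reprK (coh_class Zg).
have /coh_classP Ef := coh_reprK (coh_class Zf).
set g' := smval _ in Eg *; set f' := smval _ in Ef *.
have Zf' : is_cocycle f' := coh_reprP _.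
have -> : dcomp e g' f' - dcomp e g f = dcomp e (g' - g) f' + dcomp e g (f' - f).
  by apply: op_inj => W x; rewrite !opE; zmod.
by apply: cobdD; [exact: cobd_comp_l | exact: cobd_comp_r].
Qed.

Lemma hcA W X Y Z m n p mn np q (e1 : n + p = np) (e2 : m + np = q)
    (e3 : m + n = mn) (e4 : mn + p = q)
    (h : cohom Y Z m) (g : cohom X Y n) (f : cohom W X p) :
  hc e2 h (hc e1 g f) = hc e4 (hc e3 h g) f.
Proof.
have [h' [Zh ->]] := coh_class_surj h; have [g' [Zg ->]] := coh_class_surj g.
have [f' [Zf ->]] := coh_class_surj f; rewrite !hcE.
exact/coh_class_eq/dcompA.
Qed.

Lemma hc1f X Y n (e : 0 + n = n) (f : cohom X Y n) : hc e (H0id Y) f = f.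
Proof.
have [f' [Zf ->]] := coh_class_surj f; rewrite hcE.
exact/coh_class_eq/dcomp1f.
Qed.

Lemma hcf1 X Y n (e : n + 0 = n) (f : cohom X Y n) : hc e f (H0id X) = f.
Proof.
have [f' [Zf ->]] := coh_class_surj f; rewrite hcE.
exact/coh_class_eq/dcompf1.
Qed.

Lemma hc_linl X Y Z m n p (e : m + n = p) (f : cohom X Y n) :
  linear_fun (fun g : cohom Y Z m => hc e g f).
Proof.
move=> a u v; have [f' [Zf ->]] := coh_class_surj f.
have [u' [Zu ->]] := coh_class_surj u; have [v' [Zv ->]] := coh_class_surj v.
rewrite -(coh_classL Zu Zv (cocycleL a Zu Zv) erefl) !hcE.
by apply: coh_classL; exact: dcomp_linl.
Qed.

Lemma hc_linr X Y Z m n p (e : m + n = p) (g : cohom Y Z m) :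
  linear_fun (fun f : cohom X Y n => hc e g f).
Proof.
move=> a u v; have [g' [Zg ->]] := coh_class_surj g.
have [u' [Zu ->]] := coh_class_surj u; have [v' [Zv ->]] := coh_class_surj v.
rewrite -(coh_classL Zu Zv (cocycleL a Zu Zv) erefl) !hcE.
by apply: coh_classL; exact: dcomp_linr.
Qed.

Lemma hc0l X Y Z m n p (e : m + n = p) (f : cohom X Y n) :
  hc e (0 : cohom Y Z m) f = 0.
Proof. exact: (lin0 (hc_linl e f)). Qed.
Lemma hc0r X Y Z m n p (e : m + n = p) (g : cohom Y Z m) :
  hc e g (0 : cohom X Y n) = 0.
Proof. exact: (lin0 (hc_linr e g)). Qed.
Lemma hcBl X Y Z m n p (e : m + n = p) (g g' : cohom Y Z m) (f : cohom X Y n) :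
  hc e (g - g') f = hc e g f - hc e g' f.
Proof. exact: (linB (hc_linl e f)). Qed.
End GradedCohomology.

(** * Long exact sequences of a graded-split extension *)

Section ExactPairs.
Variables (k : comPzRingType) (A : dgcat k).
Implicit Types W X Y Z E : dob A.

Lemma coh_class0 X Y n (f : dhom X Y n) (Zf : is_cocycle f) :
  coh_class Zf = 0 <-> is_coboundary f.
Proof.
have -> : (0 : cohom X Y n) = coh_class (@cocycle0 k A X Y n).
  by rewrite -(lin0 (@clsL _ _ (Bsub X Y n))); congr cls; exact: val_inj.
by rewrite coh_classP subr0.
Qed.

(* A -u-> B -v-> C, of any degrees, is exact at B under all graded functors
   H^*(W, -) and H^*(-, W). *)
Definition exact_pair X Y Z a b (u : cohom X Y a) (v : cohom Y Z b) : Prop :=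
  [/\ forall c (e : b + a = c), hc e v u = 0,
      forall W n n' (e : b + n = n') (x : cohom W Y n), hc e v x = 0 ->
        forall m (e' : a + m = n), exists y, hc e' u y = x
    & forall W n n' (e : n + a = n') (x : cohom Y W n), hc e x u = 0 ->
        forall m (e' : m + b = n), exists y, hc e' y v = x].

Definition exact_triangle X Y Z a b c (u : cohom X Y a) (v : cohom Y Z b)
    (w : cohom Z X c) : Prop :=
  [/\ exact_pair u v, exact_pair v w & exact_pair w u].

Section SplitTriangle.
Variables (X E Y : dob A) (S : split_ext X E Y).
Local Notation i := (se_i S).
Local Notation r := (se_r S).
Local Notation s := (se_s S).
Local Notation p := (se_p S).
Local Notation b := (se_class S).

Lemma exact_pair_ip : exact_pair (coh_class (se_Zi S)) (coh_class (se_Zp S)).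
Proof.
split.
- move=> c e; rewrite hcE; apply/coh_class0; exists (c - 1), (subrK _ _), 0.
  by apply: op_inj => W x; rewrite op_dd !(opE, seE S) scaler0; zmod.
- move=> W n n' e x; have [f [Zf ->]] := coh_class_surj x.
  rewrite hcE => /coh_class0 [l [el [h hE]]] m e'.
  have {}hE V (z : elts V W) : bnd (op h z) = op p (op f z) + sgn k l *: op h (bnd z).
    by rewrite -(op_comp e) -hE op_dd subrK.
  have sm : sgn k m = - sgn k l by rewrite -mulrN1 -sgn1 -sgnD; congr (sgn k _); lia.
  have sn : sgn k n = sgn k m by congr (sgn k _); lia.
  have e0 : 0 + n = m by lia.
  have e1 : 1 + l = m by lia.
  (* Here [p f = dh] and [d(s h) = s dh + i b h], so [f - d(s h) = i (r f - b h)]. *)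
  pose y := dcomp e0 r f - dcomp e1 b h.
  have Zy : is_cocycle y.
    apply: cocycle_op => V z; rewrite !(opE, seE S) (op_cocycle _ Zf) hE.
    by rewrite sn sm !(opE, opZ) scalerDr scalerN !scaleNr; zmod.
  exists (coh_class Zy); rewrite hcE; apply/coh_classP.
  have e2 : 0 + l = l by lia.
  have e3 : l + 1 = n by lia.
  exists l, e3, (- dcomp e2 s h); apply: op_inj => V z.
  rewrite op_dd !(opE, seE S) hE !opE !opZ !scalerN !(seE S).
  by zmod.
- move=> W n n' e x; have [f [Zf ->]] := coh_class_surj x.
  rewrite hcE => /coh_class0 [l [el [h hE]]] m e'.
  have {}hE V (z : elts V X) : bnd (op h z) = op f (op i z) + sgn k l *: op h (bnd z).
    by rewrite -(op_comp e) -hE op_dd subrK.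
  have sm : sgn k m = - sgn k l by rewrite -mulrN1 -sgn1 -sgnD; congr (sgn k _); lia.
  have sn : sgn k n = sgn k m by congr (sgn k _); lia.
  have e0 : n + 0 = m by lia.
  have e1 : l + 1 = m by lia.
  (* Dually, [f i = dh] and [dr = - b p] give [f - d(h r) = (f s + (-1)^l h b) p]. *)
  pose y := dcomp e0 f s + sgn k l *: dcomp e1 h b.
  have Zy : is_cocycle y.
    apply: cocycle_op => V z; rewrite !(opE, opZl, bndZ, seE S) (op_cocycle _ Zf) hE.
    rewrite sn sm !(opE, opZ, seE S) !(scalerDr, scalerN, scalerA) sgnK scale1r !scaleNr.
    by rewrite !(scalerN, scalerA, mulNr) sgnK !scaleNr scale1r; zmod.
  exists (coh_class Zy); rewrite hcE; apply/coh_classP.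
  have e2 : l + 0 = l by lia.
  have e3 : l + 1 = n by lia.
  exists l, e3, (- dcomp e2 h r); apply: op_inj => V z.
  rewrite op_dd !(opE, opZl, opZ, seE S) hE !(opE, opZ, seE S) !(scalerDr, scalerN).
  by zmod.
Qed.

Lemma exact_pair_pb : exact_pair (coh_class (se_Zp S)) (coh_class (se_class_cocycle S)).
Proof.
split.
- move=> c e; rewrite hcE; apply/coh_class0.
  have e1 : 0 + 1 = c by lia.
  exists 0, e1, (- r); apply: op_inj => W x.
  by rewrite op_dd sgn0 scale1r !(opE, seE S); zmod.
- move=> W n n' e x; have [f [Zf ->]] := coh_class_surj x.
  rewrite hcE => /coh_class0 [l [el [h hE]]] m e'.
  have {}hE V (z : elts V W) : bnd (op h z) = op b (op f z) + sgn k l *: op h (bnd z).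
    by rewrite -(op_comp e) -hE op_dd subrK.
  have sm : sgn k m = sgn k l by congr (sgn k _); lia.
  have sn : sgn k n = sgn k l by congr (sgn k _); lia.
  have e0 : 0 + n = m by lia.
  have e1 : 0 + l = m by lia.
  (* The differential of [s f] is [i b f = i dh], which [i h] cancels; [p y = f] holds on the
     nose. *)
  pose y := dcomp e0 s f - dcomp e1 i h.
  have Zy : is_cocycle y.
    apply: cocycle_op => V z; rewrite !(opE, seE S) (op_cocycle _ Zf) hE.
    by rewrite sn sm !opE !opZ scalerDr scalerN; zmod.
  exists (coh_class Zy); rewrite hcE; apply: coh_class_eq.
  by apply: op_inj => V z; rewrite !(opE, seE S); zmod.
- move=> W n n' e x; have [f [Zf ->]] := coh_class_surj x.
  rewrite hcE => /coh_class0 [l [el [h hE]]] m e'.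
  have {}hE V (z : elts V E) : bnd (op h z) = op f (op p z) + sgn k l *: op h (bnd z).
    by rewrite -(op_comp e) -hE op_dd subrK.
  have sm : sgn k m = sgn k l by congr (sgn k _); lia.
  have e0 : l + 0 = m by lia.
  have e1 : l + 0 = l by lia.
  have e2 : l + 1 = n by lia.
  (* Since [f p = dh] and [p i = 0], the map [h i] is closed, and [d(h s) = f - y b]. *)
  pose y := - (sgn k l *: dcomp e0 h i).
  have Zy : is_cocycle y.
    apply: cocycle_op => V z; rewrite !(opE, opZl, bndZ, seE S) hE sm.
    by rewrite !(opE, opZ, seE S) !(scalerDr, scalerN, scaler0, add0r).
  exists (coh_class Zy); rewrite hcE; apply/coh_classP.
  exists l, e2, (- dcomp e1 h s); apply: op_inj => V z.
  rewrite op_dd !(opE, opZl, opZ, seE S) hE.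
  by rewrite !(opE, opZ, seE S) !(scalerDr, scalerN); zmod.
Qed.

Lemma exact_pair_bi : exact_pair (coh_class (se_class_cocycle S)) (coh_class (se_Zi S)).
Proof.
split.
- move=> c e; rewrite hcE; apply/coh_class0.
  have e1 : 0 + 1 = c by lia.
  exists 0, e1, s; apply: op_inj => W x.
  by rewrite op_dd sgn0 scale1r !(opE, seE S); zmod.
- move=> W n n' e x; have [f [Zf ->]] := coh_class_surj x.
  rewrite hcE => /coh_class0 [l [el [h hE]]] m e'.
  have {}hE V (z : elts V W) : bnd (op h z) = op i (op f z) + sgn k l *: op h (bnd z).
    by rewrite -(op_comp e) -hE op_dd subrK.
  have sm : sgn k m = sgn k l by congr (sgn k _); lia.
  have e0 : 0 + l = m by lia.
  have e1 : 0 + l = l by lia.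
  have e2 : l + 1 = n by lia.
  (* Since [i f = dh], the map [p h] is closed, and [d(r h) = f - b p h]. *)
  pose y := dcomp e0 p h.
  have Zy : is_cocycle y.
    apply: cocycle_op => V z; rewrite !(opE, seE S) hE sm.
    by rewrite !(opE, opZ, seE S); zmod.
  exists (coh_class Zy); rewrite hcE; apply/coh_classP.
  exists l, e2, (- dcomp e1 r h); apply: op_inj => V z.
  rewrite op_dd !(opE, opZ, seE S) hE.
  by rewrite !(opE, opZ, seE S) !(scalerDr, scalerN); zmod.
- move=> W n n' e x; have [f [Zf ->]] := coh_class_surj x.
  rewrite hcE => /coh_class0 [l [el [h hE]]] m e'.
  have {}hE V (z : elts V Y) : bnd (op h z) = op f (op b z) + sgn k l *: op h (bnd z).
    by rewrite -(op_comp e) -hE op_dd subrK.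
  have sm : sgn k m = sgn k l by congr (sgn k _); lia.
  have sn : sgn k n = sgn k l by congr (sgn k _); lia.
  have e0 : n + 0 = m by lia.
  have e1 : l + 0 = m by lia.
  (* The differential [- (-1)^n f b p] of [f r] is cancelled by that of [(-1)^l h p], because
     [f b = dh] and [n = l]. *)
  pose y := dcomp e0 f r + sgn k l *: dcomp e1 h p.
  have Zy : is_cocycle y.
    apply: cocycle_op => V z; rewrite !(opE, opZl, bndZ, seE S) (op_cocycle _ Zf) hE.
    by rewrite sn sm !(opE, opZ, seE S) !(scalerDr, scalerN); zmod.
  exists (coh_class Zy); rewrite hcE; apply: coh_class_eq.
  by apply: op_inj => V z; rewrite !(opE, opZl, seE S) scaler0; zmod.
Qed.

Lemma split_triangle :
  exact_triangle (coh_class (se_Zi S)) (coh_class (se_Zp S))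
    (coh_class (se_class_cocycle S)).
Proof.
by split; [exact: exact_pair_ip | exact: exact_pair_pb | exact: exact_pair_bi].
Qed.

End SplitTriangle.

(** The equations are asked for every proof about the degrees, so they are void unless [t + t' = 0];
    where the degrees are variables, that equation is assumed beside them. *)
Definition graded_inverse X Y t t' (f : cohom X Y t) (g : cohom Y X t') : Prop :=
  (forall e : t' + t = 0, hc e g f = H0id X) /\ (forall e : t + t' = 0, hc e f g = H0id Y).

Lemma graded_inverse_sym X Y t t' (f : cohom X Y t) (g : cohom Y X t') :
  graded_inverse f g -> graded_inverse g f.
Proof. by case. Qed.

(** Exactness survives the replacement of any of the three objects by one isomorphic to it in some
    degree. This lets [Sigma Y] be exchanged for [Y] at the price of a change of degrees. *)
Lemma exact_pair_mid X Y Y' Z a b t t' a' b' (u : cohom X Y a) (v : cohom Y Z b)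
    (f : cohom Y Y' t) (g : cohom Y' Y t') (ea : t + a = a') (eb : b + t' = b') :
  t + t' = 0 -> graded_inverse f g -> exact_pair u v -> exact_pair (hc ea f u) (hc eb v g).
Proof.
move=> t0 [gf fg] [E0 E1 E2].
have tt' : t' + t = 0 by lia.
have cancl W n m (e1 : t + n = m) (e2 : t' + m = n) (x : cohom W Y n) :
  hc e2 g (hc e1 f x) = x.
  by rewrite (hcA _ _ tt' (add0r _)) gf hc1f.
have cancr W n m (e1 : t' + n = m) (e2 : t + m = n) (x : cohom W Y' n) :
  hc e2 f (hc e1 g x) = x.
  by rewrite (hcA _ _ t0 (add0r _)) fg hc1f.
split.
- move=> c e; have e1 : t' + a' = a by lia.
  have e2 : b + a = c by lia.
  by rewrite -(hcA e1 e2) cancl.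
- move=> W n n' e x; have e1 : t' + n = n - t by lia.
  have e2 : b + (n - t) = n' by lia.
  rewrite -(hcA e1 e2) => /E1 H m e'.
  have e3 : a + m = n - t by lia.
  have [y hy] := H m e3.
  have e4 : t + (n - t) = n by lia.
  by exists y; rewrite -(hcA e3 e4) hy cancr.
- move=> W n n' e x; have e1 : n + t = n + t by [].
  have e2 : n + t + a = n' by lia.
  rewrite (hcA _ _ e1 e2) => /E2 H m e'.
  have e3 : m + b = n + t by lia.
  have [y hy] := H m e3; exists y.
  have e4 : (n + t) + t' = n by lia.
  have e5 : n + 0 = n by lia.
  by rewrite (hcA _ _ e3 e4) hy -(hcA t0 e5) fg hcf1.
Qed.

Lemma exact_pair_left X X' Y Z a b t t' a' (u : cohom X Y a) (v : cohom Y Z b)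
    (f : cohom X X' t) (g : cohom X' X t') (ea : a + t' = a') :
  t + t' = 0 -> graded_inverse f g -> exact_pair u v -> exact_pair (hc ea u g) v.
Proof.
move=> t0 [gf fg] [E0 E1 E2].
have tt' : t' + t = 0 by lia.
split.
- move=> c e; have e1 : b + a = b + a by [].
  have e2 : b + a + t' = c by lia.
  by rewrite (hcA _ _ e1 e2) E0 hc0l.
- move=> W n n' e x /E1 H m e'.
  have e1 : a + (m - t) = n by lia.
  have [y hy] := H _ e1.
  have e2 : t + (m - t) = m by lia.
  exists (hc e2 f y).
  have e3 : t' + m = m - t by lia.
  by rewrite -(hcA e3 e1) (hcA _ _ tt' (add0r _)) gf hc1f.
- move=> W n n' e x.
  have e1 : n + a = n' - t' by lia.
  have e2 : n' - t' + t' = n' by lia.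
  rewrite (hcA _ _ e1 e2) => E3.
  apply: (E2 _ _ _ e1).
  have e3 : n' + t = n' - t' by lia.
  have e4 : n' - t' + 0 = n' - t' by lia.
  by rewrite -(hcf1 e4 (hc e1 x u)) -(gf tt') (hcA _ _ e2 e3) E3 hc0l.
Qed.

Lemma exact_pair_right X Y Z Z' a b t t' b' (u : cohom X Y a) (v : cohom Y Z b)
    (f : cohom Z Z' t) (g : cohom Z' Z t') (eb : t + b = b') :
  t + t' = 0 -> graded_inverse f g -> exact_pair u v -> exact_pair u (hc eb f v).
Proof.
move=> t0 [gf fg] [E0 E1 E2].
have tt' : t' + t = 0 by lia.
split.
- move=> c e; have e1 : b + a = b + a by [].
  have e2 : t + (b + a) = c by lia.
  by rewrite -(hcA e1 e2) E0 hc0r.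
- move=> W n n' e x.
  have e1 : b + n = n' - t by lia.
  have e2 : t + (n' - t) = n' by lia.
  rewrite -(hcA e1 e2) => E3.
  apply: (E1 _ _ _ e1).
  have e3 : t' + n' = n' - t by lia.
  have e4 : 0 + (n' - t) = n' - t by lia.
  by rewrite -(hc1f e4 (hc e1 v x)) -(gf tt') -(hcA e2 e3) E3 hc0r.
- move=> W n n' e x /E2 H m e'.
  have e1 : m + t + b = n by lia.
  have [y hy] := H _ e1.
  have e2 : m + t + t' = m by lia.
  exists (hc e2 y g).
  have e3 : m + t = m + t by [].
  have e4 : m + t + 0 = m + t by lia.
  by rewrite (hcA _ _ e3 e1) -(hcA tt' e4) gf hcf1.
Qed.

End ExactPairs.

(** * Isomorphisms of arbitrary degree and gluing of extensions *)

Section GradedIso.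
Variables (k : comPzRingType) (A : dgcat k).
Implicit Types W X Y Z E : dob A.

(** It expresses that Y is isomorphic to [Sigma^-t X]; the model for [t = -1] is X -> Sigma X. *)
Definition graded_iso t X Y : Prop :=
  exists t' (f : cohom X Y t) (g : cohom Y X t'), t + t' = 0 /\ graded_inverse f g.

Lemma graded_iso_refl X : graded_iso 0 X X.
Proof.
exists 0, (H0id X), (H0id X); split=> //.
by split=> e; rewrite hc1f.
Qed.

Lemma graded_iso_sym t t' X Y : t + t' = 0 -> graded_iso t X Y -> graded_iso t' Y X.
Proof.
move=> e [u [f [g [e' fg]]]]; have ? : u = t' by lia.
subst u; exists t, g, f; split; first by lia.
exact: graded_inverse_sym.
Qed.

Lemma graded_iso_trans t u v X Y Z :
  t + u = v -> graded_iso t X Y -> graded_iso u Y Z -> graded_iso v X Z.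
Proof.
move=> e [t' [f [f' [et [f'f ff']]]]] [u' [g [g' [eu [g'g gg']]]]].
have e1 : u + t = v by lia.
exists (t' + u'), (hc e1 g f), (hc erefl f' g'); split; first by lia.
have e2 : t' + t = 0 by lia.
have e3 : u' + u = 0 by lia.
have e4 : u' + v = t by lia.
have e5 : t + (t' + u') = u' by lia.
split=> e0.
- by rewrite -(hcA e4 e2) (hcA _ _ e3 (add0r _)) g'g hc1f f'f.
- by rewrite -(hcA e5 eu) (hcA _ _ et (add0r _)) ff' hc1f gg'.
Qed.

Lemma isomorphicP X Y : @isomorphic k (H0 A) X Y <-> graded_iso 0 X Y.
Proof.
split=> [[f [g [gf fg]]]|[t' [f [g [e [gf fg]]]]]].
- exists 0, f, g; split=> //; split=> e; rewrite (eq_irrelevance e (addr0 0));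
  [exact: gf | exact: fg].
- have ? : t' = 0 by lia.
  by subst t'; exists f, (g : cohom Y X 0); split; [exact: gf | exact: fg].
Qed.

(* f is an isomorphism of graded objects that commutes with the differentials. *)
Definition strict_shift t X Y (f : dhom X Y t) (g : dhom Y X (- t)) : Prop :=
  [/\ is_cocycle f, is_cocycle g, forall W (x : elts W X), op g (op f x) = x
    & forall W (x : elts W Y), op f (op g x) = x].

Lemma strict_shift_iso t X Y (f : dhom X Y t) (g : dhom Y X (- t)) :
  strict_shift f g -> graded_iso t X Y.
Proof.
case=> Zf Zg gf fg; exists (- t), (coh_class Zf), (coh_class Zg).
split; first by rewrite subrr.
by split=> e; rewrite hcE; apply: coh_class_eq; apply: op_inj => W x; rewrite !opE.
Qed.

Lemma graded_iso_rep X Y : graded_iso 0 X Y ->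
  exists (f : dhom X Y 0) (g : dhom Y X 0) (h1 : dhom X X (-1)) (h2 : dhom Y Y (-1)),
    [/\ is_cocycle f, is_cocycle g,
      forall W (x : elts W X), op g (op f x) = x - (bnd (op h1 x) + op h1 (bnd x))
    & forall W (x : elts W Y), op f (op g x) = x - (bnd (op h2 x) + op h2 (bnd x))].
Proof.
move=> [t' [f [g [e [gf fg]]]]]; have ? : t' = 0 by lia.
subst t'; move: (gf (addr0 0)) (fg (addr0 0)).
have [f' [Zf ->]] := coh_class_surj f; have [g' [Zg ->]] := coh_class_surj g.
rewrite !hcE => /esym/coh_classP[m1 [e1 [h1 E1]]] /esym/coh_classP[m2 [e2 [h2 E2]]].
have ? : m1 = -1 by lia.
have ? : m2 = -1 by lia.
subst m1 m2; exists f', g', h1, h2; split=> // W x.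
- have := congr1 (fun z => op z x) E1; rewrite op_dd !opE sgnN1 scaleN1r => E.
  by rewrite -[op g' _](subKr x) -E; zmod.
- have := congr1 (fun z => op z x) E2; rewrite op_dd !opE sgnN1 scaleN1r => E.
  by rewrite -[op f' _](subKr x) -E; zmod.
Qed.

(** The matrix [[[f, t], [0, 1]]] in the graded splittings. For closed [f] it is closed as soon as
    [dt = f b - b'], with [b] and [b'] the two classes. *)
Definition glue X X' E E' Y (S : split_ext X E Y) (S' : split_ext X' E' Y)
    (f : dhom X X' 0) (t : dhom Y X' 0) : dhom E E' 0 :=
  dcomp (addr0 0) (se_i S') (dcomp (addr0 0) f (se_r S)) +
  dcomp (addr0 0) (se_s S') (se_p S) +
  dcomp (addr0 0) (se_i S') (dcomp (addr0 0) t (se_p S)).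

Lemma glue_cocycle X X' E E' Y (S : split_ext X E Y) (S' : split_ext X' E' Y)
    (f : dhom X X' 0) (t : dhom Y X' 0) :
  is_cocycle f ->
  (forall W (x : elts W Y), bnd (op t x) - op t (bnd x) =
     op f (op (se_class S) x) - op (se_class S') x) ->
  is_cocycle (glue S S' f t).
Proof.
move=> Zf Et; apply: cocycle_op0 => W x.
have /eqP := Et _ (op (se_p S) x); rewrite subr_eq => /eqP {}Et.
by rewrite !(opE, seE S, seE S', op_cocycle0 _ Zf, Et); zmod.
Qed.

(** The product of the two matrices is [[[g f, g t + u], [0, 1]]]. The choice of [u] makes its
    corner [- h b], and then [i h r] is a homotopy to the identity. *)
Lemma glue_left_inverse X X' E E' Y (S : split_ext X E Y) (S' : split_ext X' E' Y)
    (f : dhom X X' 0) (g : dhom X' X 0) (h : dhom X X (-1)) (t : dhom Y X' 0) :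
  is_cocycle f -> is_cocycle g ->
  (forall W (x : elts W X), op g (op f x) = x - (bnd (op h x) + op h (bnd x))) ->
  (forall W (x : elts W Y), bnd (op t x) - op t (bnd x) =
     op f (op (se_class S) x) - op (se_class S') x) ->
  exists2 u : dhom Y X 0,
    forall W (x : elts W Y), bnd (op u x) - op u (bnd x) =
      op g (op (se_class S') x) - op (se_class S) x
  & is_coboundary (did E - dcomp (addr0 0) (glue S' S g u) (glue S S' f t)).
Proof.
move=> Zf Zg gf Et.
have e : -1 + 1 = 0 :> int by lia.
exists (- dcomp e h (se_class S) - dcomp (addr0 0) g t) => [W x|].
  have /eqP := Et _ x; rewrite subr_eq => /eqP {}Et.
  by rewrite !(opE, seE S, op_cocycle0 _ Zg) Et !(opE, gf, seE S); zmod.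
have e1 : 0 + (-1) = -1 :> int by lia.
have e2 : -1 + 0 = -1 :> int by lia.
exists (-1), e, (dcomp e1 (se_i S) (dcomp e2 h (se_r S))).
apply: op_inj => W x.
by rewrite op_dd sgnN1 scaleN1r !(opE, seE S, seE S', gf); zmod.
Qed.

(* The left inverse of a glued map is itself glued, so that it has a left inverse too. *)
Lemma glue_iso X X' E E' Y (S : split_ext X E Y) (S' : split_ext X' E' Y)
    (f : dhom X X' 0) (g : dhom X' X 0) (h1 : dhom X X (-1)) (h2 : dhom X' X' (-1))
    (t : dhom Y X' 0) :
  is_cocycle f -> is_cocycle g ->
  (forall W (x : elts W X), op g (op f x) = x - (bnd (op h1 x) + op h1 (bnd x))) ->
  (forall W (x : elts W X'), op f (op g x) = x - (bnd (op h2 x) + op h2 (bnd x))) ->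
  (forall W (x : elts W Y), bnd (op t x) - op t (bnd x) =
     op f (op (se_class S) x) - op (se_class S') x) ->
  graded_iso 0 E E'.
Proof.
move=> Zf Zg gf fg Et.
have [u Eu Hu] := glue_left_inverse Zf Zg gf Et.
have [v Ev Hv] := glue_left_inverse Zg Zf fg Eu.
have Zt := glue_cocycle Zf Et; have Zu := glue_cocycle Zg Eu.
have Zv := glue_cocycle Zf Ev.
have E1 : hc (addr0 0) (coh_class Zu) (coh_class Zt) = H0id E.
  by rewrite hcE; apply/esym/coh_classP.
have E2 : hc (addr0 0) (coh_class Zv) (coh_class Zu) = H0id E'.
  by rewrite hcE; apply/esym/coh_classP.
exists 0, (coh_class Zt), (coh_class Zu); split=> //.
split=> e; rewrite (eq_irrelevance e (addr0 0)) // -E2; congr hc.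
rewrite -[LHS](hc1f (addr0 0)) (eq_irrelevance (addr0 0 : 0 + 0 = 0) e).
by rewrite (eq_irrelevance e (addr0 0)) -E2 -(hcA (addr0 0) (addr0 0)) E1 hcf1.
Qed.

(** With [has_shift], the closure property on which the calculus of [estar] rests: every closed map
    of degree 1 is the class of an extension. *)
Definition has_ext : Prop := forall X Y (b : dhom Y X 1), is_cocycle b ->
  exists E (S : split_ext X E Y), se_class S = b.

Definition has_shift : Prop := forall Y t,
  exists X (f : dhom X Y t) (g : dhom Y X (- t)), strict_shift f g.

(** * Products of subcategories: associativity and shifts *)

Section Star.
Hypotheses (HE : has_ext) (HS : has_shift).
Implicit Types S U V : dob A -> Prop.

Definition replete S : Prop := forall X Y, S X -> graded_iso 0 X Y -> S Y.

(** The product of S and U through graded-split extensions in place of triangles, which makes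
    associativity a matter of regrouping summands. *)
Definition estar S U : dob A -> Prop := fun Z => exists X Y E,
  [/\ S X, U Y, inhabited (split_ext X E Y) & graded_iso 0 E Z].

(** For [t = -n] this is [Sigma^n S], closed under isomorphism. *)
Definition shifted t S : dob A -> Prop := fun Z => exists2 Y, S Y & graded_iso t Y Z.

Lemma replete_estar S U : replete (estar S U).
Proof.
move=> Z Z' [X [Y [E [SX UY SE EZ]]]] ZZ'; exists X, Y, E; split=> //.
exact: graded_iso_trans (addr0 0) EZ ZZ'.
Qed.

Lemma replete_shifted t S : replete (shifted t S).
Proof.
move=> Z Z' [Y SY YZ] ZZ'; exists Y => //; exact: graded_iso_trans (addr0 t) YZ ZZ'.
Qed.

Lemma estar_sub S S' U U' Z : (forall X, S X -> S' X) -> (forall X, U X -> U' X) ->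
  estar S U Z -> estar S' U' Z.
Proof. by move=> sS sU [X [Y [E [/sS SX /sU UY SE EZ]]]]; exists X, Y, E. Qed.

Lemma shifted_sub t S S' Z : (forall X, S X -> S' X) -> shifted t S Z -> shifted t S' Z.
Proof. by move=> sS [Y /sS SY YZ]; exists Y. Qed.

Lemma shiftedD t u v S Z : t + u = v -> shifted u (shifted t S) Z <-> shifted v S Z.
Proof.
move=> e; split=> [[Y [X SX XY] YZ]|[X SX XZ]].
  by exists X => //; exact: graded_iso_trans e XY YZ.
have [Y [f [g /strict_shift_iso fg]]] := HS Z u.
exists Y => //; exists X => //.
apply: (graded_iso_trans (u := - u) _ XZ); first by lia.
by apply: graded_iso_sym fg; rewrite subrr.
Qed.

(** The new class is the old one followed by X -> X'. The classes then match exactly, and the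
    isomorphism glues with [t = 0]. *)
Lemma ext_replace X X' E Y : split_ext X E Y -> graded_iso 0 X X' ->
  exists2 E', inhabited (split_ext X' E' Y) & graded_iso 0 E E'.
Proof.
move=> S /graded_iso_rep[f [g [h1 [h2 [Zf Zg gf fg]]]]].
have Zfb := cocycle_comp (add0r 1) Zf (se_class_cocycle S).
have [E' [S' cS']] := HE Zfb; exists E'; first by exists.
apply: (@glue_iso _ _ _ _ _ S S' f g h1 h2 0) => // W x.
by rewrite cS' !opE; zmod.
Qed.

(** E is the quotient Z/X, and its class is that of Z pushed along D -> Y. All objects are partial
    sums of the graded object X + Y + C. *)
Lemma split_assoc X D Z Y C : split_ext X D Y -> split_ext D Z C ->
  exists2 E, inhabited (split_ext Y E C) & inhabited (split_ext X Z E).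
Proof.
move=> S1 S2.
have [E [S3 cS3]] := HE (cocycle_comp (add0r 1) (se_Zp S1) (se_class_cocycle S2)).
exists E; first by exists.
have cE W (x : elts W C) : op (se_class S3) x = op (se_p S1) (op (se_class S2) x).
  by rewrite cS3 op_comp.
constructor; apply: (@SplitExt k A X Z E (dcomp (addr0 0) (se_i S2) (se_i S1))
  (dcomp (addr0 0) (se_r S1) (se_r S2))
  (dcomp (addr0 0) (se_i S2) (dcomp (addr0 0) (se_s S1) (se_r S3)) +
   dcomp (addr0 0) (se_s S2) (se_p S3))
  (dcomp (addr0 0) (se_i S3) (dcomp (addr0 0) (se_p S1) (se_r S2)) +
   dcomp (addr0 0) (se_s S3) (se_p S2))).
1-5: by move=> W x; rewrite !(opE, seE S1, seE S2, seE S3); zmod.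
all: apply: cocycle_op0 => W x.
all: by rewrite !(opE, seE S1, seE S2, seE S3) ?cE ?(opE, seE S1, seE S2, seE S3); zmod.
Qed.

(** D is the preimage of Y in Z, and its class is that of Z restricted along Y -> E. *)
Lemma split_assoc_rev X Z E Y C : split_ext X Z E -> split_ext Y E C ->
  exists2 D, inhabited (split_ext X D Y) & inhabited (split_ext D Z C).
Proof.
move=> S1 S2.
have [D [S3 cS3]] := HE (cocycle_comp (addr0 1) (se_class_cocycle S1) (se_Zi S2)).
exists D; first by exists.
have cE W (x : elts W Y) : op (se_class S3) x = op (se_class S1) (op (se_i S2) x).
  by rewrite cS3 op_comp.
constructor; apply: (@SplitExt k A D Z C
  (dcomp (addr0 0) (se_i S1) (se_r S3) +
   dcomp (addr0 0) (se_s S1) (dcomp (addr0 0) (se_i S2) (se_p S3)))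
  (dcomp (addr0 0) (se_i S3) (se_r S1) +
   dcomp (addr0 0) (se_s S3) (dcomp (addr0 0) (se_r S2) (se_p S1)))
  (dcomp (addr0 0) (se_s S1) (se_s S2))
  (dcomp (addr0 0) (se_p S2) (se_p S1))).
1-5: by move=> W x; rewrite !(opE, seE S1, seE S2, seE S3); zmod.
all: apply: cocycle_op0 => W x.
all: by rewrite !(opE, seE S1, seE S2, seE S3) ?cE ?(opE, seE S1, seE S2, seE S3); zmod.
Qed.

Lemma estar_assoc S U V Z : estar (estar S U) V Z -> estar S (estar U V) Z.
Proof.
move=> [D [C [Z' [[X [Y [D' [SX UY [S1] D'D]]]] VC [S2] Z'Z]]]].
have DD' : graded_iso 0 D D' by apply: graded_iso_sym D'D.
have [Z'' [S3] Z'Z''] := ext_replace S2 DD'.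
have [E S4 S5] := split_assoc S1 S3.
exists X, E, Z''; split=> //.
  by exists Y, C, E; split=> //; exact: graded_iso_refl.
apply: (graded_iso_trans (addr0 0) _ Z'Z); exact: graded_iso_sym Z'Z''.
Qed.

(** Each structure map is conjugated by closed maps of degrees t and -t, whose signs cancel. *)
Lemma split_shift t X E Y X' E' Y' (fX : dhom X' X t) gX (fE : dhom E' E t) gE
    (fY : dhom Y' Y t) gY :
  strict_shift fX gX -> strict_shift fE gE -> strict_shift fY gY ->
  split_ext X E Y -> split_ext X' E' Y'.
Proof.
move=> [ZfX ZgX gfX fgX] [ZfE ZgE gfE fgE] [ZfY ZgY gfY fgY] S.
have e1 : 0 + t = t by lia.
have e2 : - t + t = 0 by lia.
have gf := (gfX, fgX, gfE, fgE, gfY, fgY).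
have nt : sgn k (- t) = sgn k t by rewrite /sgn; congr (_ ^+ _); lia.
apply: (@SplitExt k A X' E' Y' (dcomp e2 gE (dcomp e1 (se_i S) fX))
  (dcomp e2 gX (dcomp e1 (se_r S) fE)) (dcomp e2 gE (dcomp e1 (se_s S) fY))
  (dcomp e2 gY (dcomp e1 (se_p S) fE))).
1-5: by move=> W x; rewrite !(opE, gf, seE S); zmod.
- apply: cocycle_op0 => W x.
  rewrite !(opE, op_cocycle _ ZgE, op_cocycle _ ZfX, seE S, opZ).
  by rewrite scalerA nt sgnK scale1r.
- apply: cocycle_op0 => W x.
  rewrite !(opE, op_cocycle _ ZgY, op_cocycle _ ZfE, seE S, opZ).
  by rewrite scalerA nt sgnK scale1r.
Qed.

Lemma estar_shifted t S U Z : replete S -> replete U ->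
  estar (shifted t S) (shifted t U) Z -> shifted t (estar S U) Z.
Proof.
move=> rS rU [X [Y [E [[X0 SX0 X0X] [Y0 UY0 Y0Y] [SE] EZ]]]].
have [X' [fX [gX HX]]] := HS X t; have [Y' [fY [gY HY]]] := HS Y t.
have [E' [fE [gE HE']]] := HS E t.
exists E'; last exact: graded_iso_trans (addr0 t) (strict_shift_iso HE') EZ.
exists X', Y', E'; split; last exact: graded_iso_refl.
- apply: (rS _ _ SX0); apply: (graded_iso_trans (subrr t) X0X).
  by apply: graded_iso_sym (strict_shift_iso HX); rewrite subrr.
- apply: (rU _ _ UY0); apply: (graded_iso_trans (subrr t) Y0Y).
  by apply: graded_iso_sym (strict_shift_iso HY); rewrite subrr.
- by constructor; exact: split_shift HX HE' HY SE.
Qed.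

End Star.
End GradedIso.

(** * The pretriangulated hull *)

Section Matrices.
Variables (k : comPzRingType) (K : dgcat k).
Notation graded := (sumcat (shiftcat K)).
Notation fm X i := (@ffam k (shiftcat K) X i : sob K).
Implicit Types X Y : fob (shiftcat K).

Definition inl_proj X Y : @dhom k graded (sum_ob X Y) X 0 :=
  fun i j => match j return shom (fm (sum_ob X Y) j) (fm X i) 0 with
    | inl j => fid X i j
    | inr _ => 0
    end.

Definition inr_hom X Y : @dhom k graded Y (sum_ob X Y) 0 :=
  fun i j => match i return shom (fm Y j) (fm (sum_ob X Y) i) 0 with
    | inl _ => 0
    | inr i => fid Y i j
    end.

Arguments inl_proj : clear implicits.
Arguments inr_hom : clear implicits.

Lemma scomp0l (X Y Z : sob K) (m n p : int) (e : m + n = p) (f : shom X Y n) :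
  scomp (Z := Z) e (0 : shom Y Z m) f = 0.
Proof. exact: (lin0 (@dcomp_linl _ _ _ _ _ _ _ _ _ _)). Qed.

Lemma scomp0r (X Y Z : sob K) (m n p : int) (e : m + n = p) (f : shom Y Z m) :
  scomp e f (0 : shom X Y n) = 0.
Proof. exact: (lin0 (@dcomp_linr _ _ _ _ _ _ _ _ _ _)). Qed.

Lemma fid_sum_ll X Y i j : fid (sum_ob X Y) (inl i) (inl j) = fid X i j.
Proof.
have [->|ij] := eqVneq i j; first by rewrite !fid_diag.
by rewrite !fid_off.
Qed.

Lemma fid_sum_rr X Y i j : fid (sum_ob X Y) (inr i) (inr j) = fid Y i j.
Proof.
have [->|ij] := eqVneq i j; first by rewrite !fid_diag.
by rewrite !fid_off.
Qed.

Lemma fid_fid X i j : \sum_l scomp (addr0 0) (fid X i l) (fid X l j) = fid X i j.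
Proof. by have := congr1 (fun h : fhom _ _ _ => h i j) (fcomp1f (addr0 0) (fid X)). Qed.

Lemma inl_projK X Y :
  @dcomp k graded _ _ _ _ _ _ (addr0 0) (inl_proj X Y) (inl_hom X Y) = fid X.
Proof.
apply: fhomP => i j; rewrite /= /fcomp big_sumType /=.
rewrite [X in _ + X]big1 ?addr0; last by move=> l _; exact: scomp0l.
exact: fid_fid.
Qed.

Lemma inr_projK X Y :
  @dcomp k graded _ _ _ _ _ _ (addr0 0) (inr_proj X Y) (inr_hom X Y) = fid Y.
Proof.
apply: fhomP => i j; rewrite /= /fcomp big_sumType /=.
rewrite [X in X + _]big1 ?add0r; last by move=> l _; exact: scomp0l.
exact: fid_fid.
Qed.

Lemma inr_proj_inl X Y :
  @dcomp k graded _ _ _ _ _ _ (addr0 0) (inr_proj X Y) (inl_hom X Y) = 0.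
Proof.
apply: fhomP => i j; rewrite /= /fcomp big_sumType /=.
by rewrite !big1 ?addr0 // => l _; [exact: scomp0r | exact: scomp0l].
Qed.

Lemma inl_proj_inr X Y :
  @dcomp k graded _ _ _ _ _ _ (addr0 0) (inl_proj X Y) (inr_hom X Y) = 0.
Proof.
apply: fhomP => i j; rewrite /= /fcomp big_sumType /=.
by rewrite !big1 ?addr0 // => l _; [exact: scomp0l | exact: scomp0r].
Qed.

Lemma sum_id X Y :
  @dcomp k graded _ _ _ _ _ _ (addr0 0) (inl_hom X Y) (inl_proj X Y) +
  @dcomp k graded _ _ _ _ _ _ (addr0 0) (inr_hom X Y) (inr_proj X Y) =
  fid (sum_ob X Y).
Proof.
apply: fhomP => i j; rewrite piDE piDE /= /fcomp.
case: i j => [i|i] [j|j] /=.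
- rewrite [X in _ + X]big1 ?addr0; last by move=> l _; exact: scomp0l.
  by rewrite fid_sum_ll; exact: fid_fid.
- rewrite fid_off // !big1 ?addr0 // => l _; [exact: scomp0l | exact: scomp0r].
- rewrite fid_off // !big1 ?addr0 // => l _; [exact: scomp0r | exact: scomp0l].
- rewrite [X in X + _]big1 ?add0r; last by move=> l _; exact: scomp0l.
  by rewrite fid_sum_rr; exact: fid_fid.
Qed.

Lemma dd_inr_hom X Y n (e : 0 + 1 = n) : @dd k graded _ _ _ _ e (inr_hom X Y) = 0.
Proof.
apply: fhomP => [[i|i]] j.
- exact: (lin0 (@sdd_lin _ _ _ _ _ _ _)).
- by have := congr1 (fun h : fhom _ _ _ => h i j) (dd_id (A := graded) Y e).
Qed.

Lemma utri_inr_hom X Y m n (a : @dhom k graded X X m)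
    (b : @dhom k graded Y X m) (c : @dhom k graded Y Y m)
    (e : m + 0 = n) (e' : 0 + m = n) :
  dcomp e (utri a b c) (inr_hom X Y) = dcomp e' (inl_hom X Y) b + dcomp e' (inr_hom X Y) c.
Proof.
have en : m = n by lia.
case: n / en e e' => e e'; apply: fhomP => [[i|i]] j; rewrite !piDE /= /fcomp big_sumType /=.
- rewrite [X in X + _ = _]big1 ?add0r; last by move=> l _; exact: scomp0r.
  rewrite [X in _ = _ + X]big1 ?addr0; last by move=> l _; exact: scomp0l.
  rewrite [LHS](congr1 (fun h : fhom _ _ _ => h i j) (fcompf1 e b)).
  by rewrite [RHS](congr1 (fun h : fhom _ _ _ => h i j) (fcomp1f e' b)).
- rewrite [X in X + _ = _]big1 ?add0r; last by move=> l _; exact: scomp0r.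
  rewrite [X in _ = X + _]big1 ?add0r; last by move=> l _; exact: scomp0l.
  rewrite [LHS](congr1 (fun h : fhom _ _ _ => h i j) (fcompf1 e c)).
  by rewrite [RHS](congr1 (fun h : fhom _ _ _ => h i j) (fcomp1f e' c)).
Qed.

Definition shift_ob (t : int) X : fob (shiftcat K) :=
  @Fob k (shiftcat K) (fidx X) (fun i => ((fm X i).1, (fm X i).2 + t)).

Fact shift_in_deg (t r s : int) : 0 + s - r = - t + (s + t) - r. Proof. lia. Qed.
Fact shift_out_deg (t r s : int) : 0 + s - r = t + s - (r + t). Proof. lia. Qed.
Fact shift_id_deg (t r s : int) : 0 + s - r = 0 + (s + t) - (r + t). Proof. lia. Qed.

Definition shift_in t X : @dhom k graded X (shift_ob t X) (- t) :=
  fun i j => @hcast k K (fm X j).1 (fm X i).1 _ _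
    (shift_in_deg t (fm X j).2 (fm X i).2) (fid X i j).

Definition shift_out t X : @dhom k graded (shift_ob t X) X t :=
  fun i j => @hcast k K (fm X j).1 (fm X i).1 _ _
    (shift_out_deg t (fm X j).2 (fm X i).2) (fid X i j).

Arguments shift_in : clear implicits.
Arguments shift_out : clear implicits.

Lemma fid_shift t X i j : fid (shift_ob t X) i j =
  @hcast k K (fm X j).1 (fm X i).1 _ _ (shift_id_deg t (fm X j).2 (fm X i).2) (fid X i j).
Proof.
have [->|ij] := eqVneq i j; last first.
  by rewrite !fid_off // (lin0 (@hcast_lin _ _ _ _ _ _ _)).
rewrite !fid_diag; symmetry.
by rewrite [LHS](hcastK (sid_deg (fm X j).2) _ (sid_deg ((fm X j).2 + t))).
Qed.

Lemma shift_in_out t X (e : - t + t = 0) :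
  dcomp e (shift_in t X) (shift_out t X) = fid (shift_ob t X).
Proof.
apply: fhomP => i j; rewrite /= /fcomp fid_shift -fid_fid.
rewrite (lin_sum (@hcast_lin _ _ _ _ _ _ _)); apply: eq_bigr => l _.
exact: dcomp_cast.
Qed.

Lemma shift_out_in t X (e : t - t = 0) :
  dcomp e (shift_out t X) (shift_in t X) = fid X.
Proof.
apply: fhomP => i j; rewrite /= /fcomp -fid_fid; apply: eq_bigr => l _.
by rewrite [LHS](dcomp_cast _ _ erefl (scomp_deg _ _ _ (addr0 0))).
Qed.

Lemma dd_shift_in t X n (e : - t + 1 = n) : dd e (shift_in t X) = 0.
Proof.
apply: fhomP => i j; rewrite /= /fdd /= /sdd /=.
have E : sdd (add0r 1) (fid X i j) = 0.
  exact: (congr1 (fun h : fhom X X 1 => h i j) (dd_id (A := graded) X (add0r 1))).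
have E2 : 1 + (fm X i).2 - (fm X j).2 = n + ((fm X i).2 + t) - (fm X j).2 by lia.
rewrite sgnD mulrC -scalerA [X in _ *: (_ *: X)](dd_cast _ E2 (sdd_deg _ _ (add0r 1))).
rewrite -(linZ (@hcast_lin _ _ _ _ _ _ _)).
move: E; rewrite /sdd => ->.
by rewrite (lin0 (@hcast_lin _ _ _ _ _ _ _)) scaler0.
Qed.

Lemma dd_shift_out t X n (e : t + 1 = n) : dd e (shift_out t X) = 0.
Proof.
apply: fhomP => i j; rewrite /= /fdd /= /sdd /=.
have E : sdd (add0r 1) (fid X i j) = 0.
  exact: (congr1 (fun h : fhom X X 1 => h i j) (dd_id (A := graded) X (add0r 1))).
have E2 : 1 + (fm X i).2 - (fm X j).2 = n + (fm X i).2 - ((fm X j).2 + t) by lia.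
rewrite [X in _ *: X](dd_cast _ E2 (sdd_deg _ _ (add0r 1))).
rewrite -(linZ (@hcast_lin _ _ _ _ _ _ _)).
move: E; rewrite /sdd => ->.
by rewrite (lin0 (@hcast_lin _ _ _ _ _ _ _)).
Qed.

End Matrices.

Arguments inl_proj {k K} X Y.
Arguments inr_hom {k K} X Y.
Arguments shift_in {k K} t X.
Arguments shift_out {k K} t X.

(** * Extensions and shifts of twisted objects *)

Section TwistedObjects.
Variables (k : comPzRingType) (G : dgcat k) (S : mob G -> Prop).
Let B : dgcat k := @fullsub k (mccat G) S.
Implicit Types X Y E : dob B.

Notation tw X := (@mtw k G (sval X)).
Notation ob X := (@mund k G (sval X)).

Section Split.
Variables (X E Y : dob B).
Variables (i : @dhom k G (ob X) (ob E) 0) (r : @dhom k G (ob E) (ob X) 0).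
Variables (s : @dhom k G (ob Y) (ob E) 0) (p : @dhom k G (ob E) (ob Y) 0).
Variable b : @dhom k G (ob Y) (ob X) 1.
Hypotheses (ri : dcomp (addr0 0) r i = did (ob X)).
Hypotheses (ps : dcomp (addr0 0) p s = did (ob Y)).
Hypotheses (pi : dcomp (addr0 0) p i = 0) (rs : dcomp (addr0 0) r s = 0).
Hypothesis irsp : dcomp (addr0 0) i r + dcomp (addr0 0) s p = did (ob E).
Hypotheses (di : dd (add0r 1) i = 0) (ds : dd (add0r 1) s = 0) (dp : dd (add0r 1) p = 0).
Hypothesis twi : dcomp (addr0 1) (tw E) i = dcomp (add0r 1) i (tw X).
Hypothesis tws :
  dcomp (addr0 1) (tw E) s = dcomp (add0r 1) i b + dcomp (add0r 1) s (tw Y).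
Hypothesis twp : dcomp (add0r 1) p (tw E) = dcomp (addr0 1) (tw Y) p.

Let bnd_s : @dd k B Y E 0 1 (add0r 1) s = dcomp (add0r 1) i b.
Proof.
rewrite [LHS](_ : _ = dd (add0r 1) s + dcomp (mdd_deg (add0r 1)) (tw E) s -
  sgn k 0 *: dcomp (add0r 1) s (tw Y)) //.
by rewrite ds add0r sgn0 scale1r (eq_irrelevance (mdd_deg _) (addr0 1)) tws addrK.
Qed.

(** The hypotheses express that the twist of E is the matrix [[[q_X, b], [0, q_Y]]]; the corner [b]
    is then the class. *)
Definition twisted_split : split_ext X E Y.
Proof.
apply: (@SplitExt k B X E Y i r s p).
- by move=> W x; rewrite -(op_comp (addr0 0)) [dcomp _ _ _]ri; exact: op_id.
- by move=> W x; rewrite -(op_comp (addr0 0)) [dcomp _ _ _]ps; exact: op_id.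
- by move=> W x; rewrite -(op_comp (addr0 0)) [dcomp _ _ _]pi; exact: op0l.
- by move=> W x; rewrite -(op_comp (addr0 0)) [dcomp _ _ _]rs; exact: op0l.
- by move=> W x; rewrite -!(op_comp (addr0 0)) -opDl [_ + _]irsp; exact: op_id.
- apply: (is_cocycleE (e := add0r 1)).
  rewrite [LHS](_ : _ = dd (add0r 1) i + dcomp (mdd_deg (add0r 1)) (tw E) i -
    sgn k 0 *: dcomp (add0r 1) i (tw X)) //.
  by rewrite di add0r sgn0 scale1r (eq_irrelevance (mdd_deg _) (addr0 1)) twi subrr.
- apply: (is_cocycleE (e := add0r 1)).
  rewrite [LHS](_ : _ = dd (add0r 1) p + dcomp (mdd_deg (add0r 1)) (tw Y) p -
    sgn k 0 *: dcomp (add0r 1) p (tw E)) //.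
  by rewrite dp add0r sgn0 scale1r (eq_irrelevance (mdd_deg _) (addr0 1)) twp subrr.
Defined.

Lemma twisted_split_class : se_class twisted_split = b.
Proof.
rewrite unlock [LHS](congr1 (fun z => @dcomp k B _ _ _ _ _ _ (add0r 1) r z) bnd_s).
rewrite [LHS](@dcompA k G _ _ _ _ _ _ _ _ _ _ (add0r 1) (add0r 1) (addr0 0) (add0r 1)).
by rewrite ri dcomp1f.
Qed.

End Split.

(** This is the corner of the Maurer-Cartan equation for [[[q_Y, b], [0, q_X]]], in the form that
    [utri_mc] expects. *)
Lemma twisted_cocycle X Y (b : @dhom k B X Y 1) : is_cocycle b ->
  forall (n : int) (e : 1 + 1 = n),
    @dd k G _ _ _ _ e b + dcomp e (tw Y) b + dcomp e b (tw X) = 0.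
Proof.
move=> Zb n e; have := Zb n e.
rewrite [X in X = _ -> _](_ : _ = @dd k G _ _ _ _ e b + dcomp (mdd_deg e) (tw Y) b -
  sgn k 1 *: dcomp e b (tw X)) // sgn1 scaleN1r opprK.
by rewrite (eq_irrelevance (mdd_deg e) e).
Qed.

Lemma twisted_shift t X X' (f : @dhom k G (ob X') (ob X) t)
    (g : @dhom k G (ob X) (ob X') (- t)) :
  is_cocycle f -> is_cocycle g ->
  (forall e, dcomp e f g = did (ob X)) -> (forall e, dcomp e g f = did (ob X')) ->
  (forall n e e', dcomp (p := n) e (tw X') g = sgn k t *: dcomp e' g (tw X)) ->
  @strict_shift k B t X' X f g.
Proof.
move=> Zf Zg fg gf twg.
have nt : sgn k (- t) = sgn k t by rewrite /sgn; congr (_ ^+ _); lia.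
have tt : t - t = 0 by lia.
have tt' : - t + t = 0 by lia.
have twf n e e' : dcomp (p := n) e (tw X) f = sgn k t *: dcomp e' f (tw X').
  apply: op_inj => W x; rewrite opZl !op_comp.
  have e1 : 1 - t = 1 - t by [].
  have e2 : - t + 1 = 1 - t by lia.
  have := congr1 (fun h => op f (op h (op f x))) (twg _ e1 e2).
  rewrite opZl !op_comp opZ -[op g (op f x)](op_comp tt') gf op_id => ->.
  by rewrite scalerA sgnK scale1r -[op f (op g _)](op_comp tt) fg op_id.
split.
- move=> n e.
  rewrite [LHS](_ : _ = dd e f + dcomp (mdd_deg e) (tw X) f -
    sgn k t *: dcomp e f (tw X')) //.
  by rewrite Zf add0r (twf _ _ e) subrr.
- move=> n e.
  rewrite [LHS](_ : _ = dd e g + dcomp (mdd_deg e) (tw X') g -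
    sgn k (- t) *: dcomp e g (tw X)) //.
  by rewrite Zg add0r (twg _ _ e) nt subrr.
- by move=> W x; rewrite -(op_comp tt') [dcomp _ _ _]gf; exact: op_id.
- by move=> W x; rewrite -(op_comp tt) [dcomp _ _ _]fg; exact: op_id.
Qed.

(** The sign is forced: the differential passes [g] with the sign [(-1)^t], whereas
    [(g q f) (g q f) = g q q f] has none. For [t = 1] it is the minus sign in the twist of
    [Sigma X]. *)
Lemma maurer_cartan_shift t (X : mob G) (Y : dob G) (f : dhom Y (mund X) t)
    (g : dhom (mund X) Y (- t)) (e1 : 1 + t = 1 + t) (e2 : - t + (1 + t) = 1) :
  is_cocycle f -> is_cocycle g -> (forall e, dcomp e f g = did (mund X)) ->
  maurer_cartan (sgn k t *: dcomp e2 g (dcomp e1 (mtw X) f)).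
Proof.
move=> Zf Zg fg n e.
have tt : t - t = 0 by lia.
have nt : sgn k (- t) = sgn k t by rewrite /sgn; congr (_ ^+ _); lia.
have {}fg V (x : elts V (mund X)) : op f (op g x) = x.
  by rewrite -(op_comp tt) fg op_id.
have qE V (x : elts V (mund X)) :
    bnd (op (mtw X) x) = - op (mtw X) (bnd x) - op (mtw X) (op (mtw X) x).
  have := congr1 (fun h => op h x) (mtwP X (erefl (1 + 1))).
  rewrite /= opDl op_comp op0l (op_dd erefl) sgn1 scaleN1r opprK => /eqP.
  by rewrite -addrA addr_eq0 opprD => /eqP ->; zmod.
apply: op_inj => W x.
rewrite opDl op_comp op0l op_dd !(opZl, op_comp, opZ) bndZ fg.
rewrite (op_cocycle _ Zg) qE (op_cocycle _ Zf) nt.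
rewrite !(opD, opN, opZ, sgn1, scaleN1r, scalerDr, scalerN) !scalerA sgnK.
by rewrite mul1r !scale1r; zmod.
Qed.

End TwistedObjects.

Section Hull.
Variables (k : comPzRingType) (K : dgcat k).
Notation graded := (sumcat (shiftcat K)).
Notation fm X i := (@ffam k (shiftcat K) X i : sob K).
Notation T := (dob (pretr K)).
Implicit Types X Y Z W E : T.

Notation und_tw X := (mtw (und X)).
Notation und_ob X := (mund (und X)).

Section UpperTriangular.
Variables (X Y : T) (b : @dhom k graded (und_ob Y) (und_ob X) 1).
Hypotheses (mc : maurer_cartan (utri (und_tw X) b (und_tw Y))) (os : one_sided (Mob mc)).
Let E : T := exist (@one_sided k K) (Mob mc) os.

Definition utri_split : @split_ext k (pretr K) X E Y :=
  @twisted_split k graded (@one_sided k K) X E Y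
    (inl_hom (und_ob X) (und_ob Y)) (inl_proj (und_ob X) (und_ob Y))
    (inr_hom (und_ob X) (und_ob Y)) (inr_proj (und_ob X) (und_ob Y))
    (inl_projK _ _) (inr_projK _ _) (inr_proj_inl _ _) (inl_proj_inr _ _)
    (sum_id _ _) (dd_inl _ _ _) (dd_inr _ _ _)
    (utri_inl (und_tw X) b (und_tw Y) (addr0 1) (add0r 1))
    (utri_inr (und_tw X) b (und_tw Y) (addr0 1) (add0r 1)).

Lemma utri_split_class : se_class utri_split = b.
Proof.
apply: (@twisted_split_class k graded (@one_sided k K)).
- exact: dd_inr_hom.
- exact: utri_inr_hom.
Qed.

End UpperTriangular.

Lemma utri_one_sided X Y b (mc : maurer_cartan (utri (und_tw X) b (und_tw Y))) :
  one_sided (Mob mc).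
Proof.
have [rX HX] := undP X; have [rY HY] := undP Y.
(* The entries of [b] lead from Y to X, so every index of Y must rank above all those of X. *)
pose N := (\max_i rX i).+1.
exists (fun i => match i with inl i => rX i | inr i => N + rY i end)%N.
move=> [i|i] [j|j] //=; first exact: HX.
  have H1 : (rX i < N)%N by rewrite ltnS; exact: leq_bigmax.
  by move=> H2; move: (leq_trans (leq_addr _ _) H2); rewrite leqNgt H1.
by rewrite leq_add2l; exact: HY.
Qed.

Lemma pretr_has_ext : has_ext (pretr K).
Proof.
move=> X Y b Zb.
have mc : maurer_cartan (utri (und_tw X) b (und_tw Y)).
  apply: utri_mc; [exact: mtwP | exact: mtwP |].
  exact: (@twisted_cocycle k graded (@one_sided k K) Y X b Zb).
by exists _, (utri_split (utri_one_sided mc)); exact: utri_split_class.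
Qed.

Lemma shift_in_cocycle t (X : fob (shiftcat K)) : @is_cocycle k graded _ _ _ (shift_in t X).
Proof. by move=> n e; exact: dd_shift_in. Qed.

Lemma shift_out_cocycle t (X : fob (shiftcat K)) : @is_cocycle k graded _ _ _ (shift_out t X).
Proof. by move=> n e; exact: dd_shift_out. Qed.

Lemma shift_twist_triangular t (X : fob (shiftcat K)) (q : @dhom k graded X X 1) i j
    (e1 : 1 + t = 1 + t) (e2 : - t + (1 + t) = 1) :
  q i j = 0 ->
  (sgn k t *: @dcomp k graded _ _ _ _ _ _ e2 (shift_in t X)
     (@dcomp k graded _ _ _ _ _ _ e1 q (shift_out t X)) : fhom _ _ _) i j = 0.
Proof.
move=> qij.
rewrite [LHS](_ : _ = sgn k t *: (\sum_l scomp e2 (shift_in t X i l)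
  (\sum_l' scomp e1 (q l l') (shift_out t X l' j)))) //.
rewrite big1 ?scaler0 // => l _.
have [->|il] := eqVneq l i; last first.
  rewrite /shift_in fid_off 1?eq_sym // (lin0 (@hcast_lin _ _ _ _ _ _ _)).
  exact: scomp0l.
rewrite big1; first exact: scomp0r.
move=> l' _; have [->|l'j] := eqVneq l' j; first by rewrite qij //; exact: scomp0l.
rewrite /shift_out fid_off // (lin0 (@hcast_lin _ _ _ _ _ _ _)).
exact: scomp0r.
Qed.

Lemma pretr_has_shift : has_shift (pretr K).
Proof.
move=> X t.
have e1 : 1 + t = 1 + t by [].
have e2 : - t + (1 + t) = 1 by lia.
have Zi := @shift_in_cocycle t (und_ob X).
have Zo := @shift_out_cocycle t (und_ob X).
have fg e := @shift_out_in k K t (und_ob X) e.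
have gf e := @shift_in_out k K t (und_ob X) e.
have mc := @maurer_cartan_shift k graded t (und X) _ _ _ e1 e2 Zo Zi fg.
have os : one_sided (Mob mc).
  have [rk Hrk] := undP X; exists rk => i j ij.
  by apply: shift_twist_triangular; exact: Hrk.
exists (exist (@one_sided k K) (Mob mc) os), (shift_out t (und_ob X)), (shift_in t (und_ob X)).
apply: (@twisted_shift k graded (@one_sided k K)) => //.
move=> n e e'; apply: (@op_inj k graded) => W x.
have tt : t - t = 0 by lia.
have E := congr1 (fun h => @op k graded _ _ _ _ h x) (fg tt).
rewrite [LHS](_ : _ = @op k graded _ _ _ _ (@dcomp k graded _ _ _ _ _ _ e (sgn k t *: @dcomp k graded _ _ _ _ _ _ e2 (shift_in t (und_ob X))
     (@dcomp k graded _ _ _ _ _ _ e1 (und_tw X) (shift_out t (und_ob X)))) (shift_in t (und_ob X))) x) //.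
rewrite !(opZl, op_comp); congr (_ *: op _ (op _ _)).
by move: E; rewrite op_comp => ->; exact: (@op_id k graded).
Qed.

Lemma sus_twist (X : T) n (e : 1 + - 1 = n) (e' : - 1 + 1 = n) :
  @dcomp k graded _ _ _ _ _ n e (sus_hom (und_tw X)) (shift_in 1 (und_ob X)) =
  @dcomp k graded _ _ _ _ _ n e' (shift_in 1 (und_ob X)) (und_tw X).
Proof.
apply: fhomP => i j; rewrite /= /fcomp.
have E1 : \sum_l scomp (addr0 1) (und_tw X i l) (fid (und_ob X) l j) = und_tw X i j.
  exact: (congr1 (fun h : fhom (und_ob X) (und_ob X) 1 => h i j) (fcompf1 (addr0 1) (und_tw X))).
have E2 : \sum_l scomp (add0r 1) (fid (und_ob X) i l) (und_tw X l j) = und_tw X i j.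
  exact: (congr1 (fun h : fhom (und_ob X) (und_ob X) 1 => h i j) (fcomp1f (add0r 1) (und_tw X))).
have E3 : 1 + (fm (und_ob X) i).2 - (fm (und_ob X) j).2 =
  n + ((fm (und_ob X) i).2 + 1) - (fm (und_ob X) j).2 by lia.
transitivity (@hcast k K _ _ _ _ E3 (und_tw X i j)).
  rewrite -[in RHS]E1 (lin_sum (@hcast_lin _ _ _ _ _ _ _)); apply: eq_bigr => l _.
  exact: dcomp_cast.
rewrite -[in LHS]E2 (lin_sum (@hcast_lin _ _ _ _ _ _ _)); apply: eq_bigr => l _.
by symmetry; exact: (dcomp_cast _ erefl).
Qed.

(** [sus_ob] is convertible to [shift_ob 1], so the matrices of the general shift serve for [sus]
    itself. *)
Lemma sus_strict X : @strict_shift k (pretr K) (-1) X (sus X)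
  (shift_in 1 (und_ob X)) (shift_out 1 (und_ob X)).
Proof.
have [] : @strict_shift k (pretr K) 1 (sus X) X (shift_out 1 (und_ob X)) (shift_in 1 (und_ob X)).
  apply: (@twisted_shift k graded (@one_sided k K)).
  - exact: shift_out_cocycle.
  - exact: shift_in_cocycle.
  - exact: shift_out_in.
  - exact: shift_in_out.
  move=> n e e'; rewrite -(sus_twist _ e e') sgn1 scaleN1r.
  exact: (@linN k _ _ _ (@dcomp_linl k graded _ _ _ _ _ _ e (shift_in 1 (und_ob X)))
    (sus_hom (und_tw X))).
move=> Zf Zg gf fg; split.
exact: Zg.
exact: Zf.
exact: fg.
exact: gf.
Qed.

End Hull.

(** * Cones and the operation [star] *)

Section Rotation.
Variables (k : comPzRingType) (A : dgcat k).
Implicit Types W X Y Z E C : dob A.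

Lemma graded_isoI X Y (f : dhom X Y 0) (g : dhom Y X 0) (h1 : dhom X X (-1))
    (h2 : dhom Y Y (-1)) :
  is_cocycle f -> is_cocycle g ->
  (forall W (x : elts W X), op g (op f x) = x - (bnd (op h1 x) + op h1 (bnd x))) ->
  (forall W (x : elts W Y), op f (op g x) = x - (bnd (op h2 x) + op h2 (bnd x))) ->
  graded_iso 0 X Y.
Proof.
move=> Zf Zg gf fg; have e : -1 + 1 = 0 :> int by lia.
exists 0, (coh_class Zf), (coh_class Zg); split=> //.
split=> e0; rewrite hcE; apply/esym/coh_classP; exists (-1), e.
- by exists h1; apply: op_inj => W x; rewrite op_dd sgnN1 scaleN1r !opE gf; zmod.
- by exists h2; apply: op_inj => W x; rewrite op_dd sgnN1 scaleN1r !opE fg; zmod.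
Qed.

Variables (X X1 : dob A) (sh : dhom X X1 (-1)) (us : dhom X1 X 1).
Hypothesis shP : strict_shift sh us.

Let bnd_sh W (x : elts W X) : bnd (op sh x) = - op sh (bnd x).
Proof. by have [Zs _ _ _] := shP; rewrite (op_cocycle _ Zs) sgnN1 scaleN1r. Qed.

Let bnd_us W (x : elts W X1) : bnd (op us x) = - op us (bnd x).
Proof. by have [_ Zu _ _] := shP; rewrite (op_cocycle _ Zu) sgn1 scaleN1r. Qed.

Let ush W (x : elts W X) : op us (op sh x) = x.
Proof. by have [_ _ H _] := shP; exact: H. Qed.

Let shu W (x : elts W X1) : op sh (op us x) = x.
Proof. by have [_ _ _ H] := shP; exact: H. Qed.

(** As a graded object E is X + Y + Sigma X, since C is the cone of [f]. The class [us p] makes X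
    and Sigma X cancel, with [sh] as the contracting homotopy. *)
Lemma cone_rotate Y C (f : dhom X Y 0) (S : split_ext Y C X1) :
  has_ext A -> is_cocycle f ->
  (forall W (x : elts W X), op (se_class S) (op sh x) = op f x) ->
  exists2 E, inhabited (split_ext X E C) & graded_iso 0 E Y.
Proof.
move=> HE Zf Sf.
have bnd_f W (x : elts W X) : bnd (op f x) = op f (bnd x) by exact: op_cocycle0.
have Sp W (x : elts W X1) : op (se_class S) x = op f (op us x) by rewrite -Sf shu.
have e1 : 1 + 0 = 1 :> int by [].
have Zw : is_cocycle (dcomp e1 us (se_p S)).
  by apply: cocycle_op => W x; rewrite !(opE, bnd_us, seE S) sgn1 scaleN1r.
have [E [S' cS']] := HE _ _ _ Zw; exists E; first by exists.
have cE W (x : elts W C) : op (se_class S') x = op us (op (se_p S) x).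
  by rewrite cS' op_comp.
have e2 : -1 + 0 = -1 :> int by [].
have e3 : 0 + -1 = -1 :> int by [].
apply: (@graded_isoI E Y
  (dcomp (addr0 0) (se_r S) (se_p S') - dcomp (addr0 0) f (se_r S'))
  (dcomp (addr0 0) (se_s S') (se_i S))
  (dcomp e3 (se_s S') (dcomp e3 (se_s S) (dcomp e2 sh (se_r S')))) 0).
- apply: cocycle_op0 => W x.
  by rewrite !(opE, bnd_f, seE S, seE S', cE, Sp); zmod.
- apply: cocycle_op0 => W x.
  by rewrite !(opE, seE S, seE S', cE); zmod.
- move=> W x.
  by rewrite !(opE, bnd_sh, bnd_f, seE S, seE S', cE, Sp, ush, shu); zmod.
- by move=> W x; rewrite !(opE, seE S, seE S'); zmod.
Qed.

(** As a graded object C is X + Y + Sigma X, and Sigma X cancels X. The inclusion of Y by [s] is not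
    closed; the term [sh b] corrects it. *)
Lemma cone_of_inclusion E Y C (S : split_ext X E Y) (S' : split_ext E C X1) :
  (forall W (x : elts W X), op (se_class S') (op sh x) = op (se_i S) x) ->
  graded_iso 0 Y C.
Proof.
move=> Si.
have Sp W (x : elts W X1) : op (se_class S') x = op (se_i S) (op us x) by rewrite -Si shu.
have e1 : -1 + 1 = 0 :> int by [].
have e2 : -1 + 0 = -1 :> int by [].
have e3 : 0 + -1 = -1 :> int by [].
apply: (@graded_isoI Y C
  (dcomp (addr0 0) (se_i S') (se_s S) -
     dcomp (addr0 0) (se_s S') (dcomp e1 sh (se_class S)))
  (dcomp (addr0 0) (se_p S) (se_r S')) 0
  (dcomp e3 (se_s S') (dcomp e2 sh (dcomp (addr0 0) (se_r S) (se_r S'))))).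
- apply: cocycle_op0 => W x.
  by rewrite !(opE, bnd_sh, seE S, seE S', Sp, ush); zmod.
- apply: cocycle_op0 => W x.
  by rewrite !(opE, bnd_sh, seE S, seE S', Sp, ush); zmod.
- by move=> W x; rewrite !(opE, seE S, seE S'); zmod.
- by move=> W x; rewrite !(opE, bnd_sh, seE S, seE S', Sp, ush, shu); zmod.
Qed.

End Rotation.

(** * Triangles of the hull as split extensions, and the embedding of K *)

Section StarHull.
Variables (k : comPzRingType) (K : dgcat k).
Notation graded := (sumcat (shiftcat K)).
Notation T := (dob (pretr K)).
Notation H := (tr K).
Implicit Types X Y Z : T.
Implicit Types S U : T -> Prop.

Lemma sus_hom_id (X : fob (shiftcat K)) : sus_hom (fid X) = fid (sus_ob X).
Proof.
apply: fhomP => i j; rewrite [RHS](@fid_shift k K 1 X i j) /sus_hom.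
have irr A B m n (e e' : m = n) (f : @dhom k K A B m) : hcast e f = hcast e' f.
  by rewrite (eq_irrelevance e e').
exact: (irr _ _ _ _ _ _ (fid X i j : @dhom k K _ _ _)).
Qed.

Lemma sus_mor_id X : sus_mor (@lid k H X) = @lid k H (sus X).
Proof.
rewrite [LHS](sus_morE (@cocycle_id k (pretr K) X)).
exact: (@coh_class_eq k (pretr K) (sus X) (sus X) 0 _ _ _ _ (sus_hom_id (mund (und X)))).
Qed.

Lemma desus_shift (X Y : fob (shiftcat K)) (f : @dhom k graded X Y 0) (e : 1 + -1 = 0) :
  @dcomp k graded _ _ _ _ _ 0 e (desus_hom (add0r 1) f) (shift_in 1 X) = f.
Proof.
apply: fhomP => i j; rewrite /= /fcomp.
transitivity (\sum_l scomp (addr0 0) (f i l) (fid X l j)); last first.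
  exact: (congr1 (fun h : fhom X Y 0 => h i j) (fcompf1 (addr0 0) f)).
apply: eq_bigr => l _; exact: (@dcomp_cast k K _ _ _ _ _ _ _ _ _ _ _ erefl).
Qed.

Section ConeSplit.
Variables (X Y : T) (f : @dhom k (pretr K) X Y 0) (Zf : is_cocycle f).

Definition cone_split : split_ext Y (cone Zf) (sus X) :=
  @utri_split k K Y (sus X) (desus_hom (add0r 1) f) (cone_mc (mdd_cocycle Zf))
    (cone_one_sided (mdd_cocycle Zf) (undP X) (undP Y)).

Lemma cone_split_class W (x : elts W X) :
  op (se_class cone_split) (op (shift_in 1 (mund (und X)) : @dhom k (pretr K) X (sus X) (-1)) x)
  = op f x.
Proof.
have e : 1 + -1 = 0 :> int by [].
have cE : se_class cone_split = desus_hom (add0r 1) f by exact: utri_split_class.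
rewrite cE -(op_comp e).
exact: (congr1 (fun g => @op k (pretr K) W X Y 0 g x) (desus_shift f e)).
Qed.

End ConeSplit.

Lemma is_iso_graded X Y (f : @lhom k H X Y) : is_iso f -> @graded_iso k (pretr K) 0 X Y.
Proof. by move=> fI; apply/isomorphicP; exists f. Qed.

(** The third term of a distinguished triangle is a cone up to isomorphism, and by [cone_rotate] the
    middle term is an extension of this cone by the first. *)
Lemma star_estar S U Z : replete S -> replete U -> star S U Z -> estar S U Z.
Proof.
move=> rS rU [X [Y [u [v [w [SX UY]]]]]].
case=> [X' [Y' [f [Zf [a [b [c [[aI bI cI] _]]]]]]]].
have [E SE EY'] := cone_rotate (sus_strict X') (@pretr_has_ext k K) Zf (cone_split_class Zf).
exists X', (cone Zf), E; split.
- exact: rS SX (is_iso_graded aI).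
- exact: rU UY (is_iso_graded cI).
- exact: SE.
- apply: (graded_iso_trans (addr0 0) EY').
  by apply: graded_iso_sym (is_iso_graded bI).
Qed.

(** [distinguished] asks for a cone, so Y is replaced by the cone of the inclusion X -> E. *)
Lemma split_star S U X E Y Z Y' :
  split_ext X E Y -> graded_iso 0 E Z -> graded_iso 0 Y Y' -> S X -> U Y' -> star S U Z.
Proof.
move=> SE EZ YY' SX UY'.
have YC := cone_of_inclusion (sus_strict X) (cone_split_class (se_Zi SE)).
have [b [binv [bK Kb]]] : @isomorphic k H Z E.
  by apply/isomorphicP; exact: graded_iso_sym EZ.
have [c [cinv [cK Kc]]] : @isomorphic k H Y' (cone (se_Zi SE)).
  apply/isomorphicP; apply: (graded_iso_trans (addr0 0) _ YC).
  exact: graded_iso_sym YY'.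
exists X, Y', (binv ∘ H0mor (se_Zi SE)), (cinv ∘ (cone_in (se_Zi SE) ∘ b)),
  (cone_out (se_Zi SE) ∘ c); split=> //.
exists X, E, (se_i SE), (se_Zi SE), (@lid k H X), b, c; split.
  split; [|by exists binv|by exists cinv].
  by exists (@lid k H X); rewrite lcomp1f.
split.
- by rewrite lcompA Kb lcomp1f lcompf1.
- by rewrite lcompA Kc lcomp1f.
- by rewrite sus_mor_id lcomp1f.
Qed.

Lemma sus_graded_iso X : @graded_iso k (pretr K) (-1) X (sus X).
Proof. exact: strict_shift_iso (sus_strict X). Qed.

Lemma iter_sus_graded_iso n X : @graded_iso k (pretr K) (- n%:Z) X (iter n (@sus k K) X).
Proof.
elim: n => [|n IH]; first exact: graded_iso_refl.
apply: graded_iso_trans IH (sus_graded_iso _); lia.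
Qed.

Fact yo_deg (n : int) : n = n + 0 - 0. Proof. lia. Qed.

Definition yo_hom (A B : dob K) n (f : dhom A B n) : @dhom k (pretr K) (yo A) (yo B) n :=
  fun _ _ => @hcast k K A B _ _ (yo_deg n) f.

Lemma yo_homL (A B : dob K) n : linear_fun (@yo_hom A B n).
Proof. move=> a u v; apply: fhomP => i j; exact: (@hcast_lin k K A B _ _ (yo_deg n) a u v). Qed.

Lemma yo_hom_surj (A B : dob K) n (f : @dhom k (pretr K) (yo A) (yo B) n) :
  exists g, yo_hom g = f.
Proof.
exists (@hcast k K A B _ _ (esym (yo_deg n)) (f tt tt)).
apply: fhomP => [[] []]; rewrite /yo_hom.
by rewrite (hcastK _ _ erefl).
Qed.

Lemma yo_hom_inj (A B : dob K) n : injective (@yo_hom A B n).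
Proof.
move=> f g /(congr1 (fun h : fhom (yo_ob A) (yo_ob B) n => h tt tt)) E.
rewrite -[f](hcast_id erefl) -[g](hcast_id erefl).
by rewrite -!(hcastK (yo_deg n) (esym (yo_deg n))); congr (hcast _ _).
Qed.

Lemma yo_hom_dd (A B : dob K) m n (e : m + 1 = n) (f : dhom A B m) :
  dd e (yo_hom f) = yo_hom (dd e f).
Proof.
rewrite pretr_ddE /mdd.
rewrite [X in _ + X - _](lin0 (@dcomp_linl k graded _ _ _ _ _ _ _ _)).
rewrite [X in _ - _ *: X](lin0 (@dcomp_linr k graded _ _ _ _ _ _ _ _)).
rewrite scaler0 subr0 addr0; apply: fhomP => i j.
rewrite /= /fdd /= /sdd /= sgn0 scale1r; exact: dd_cast.
Qed.

Lemma yo_hom_comp (A B C : dob K) m n p (e : m + n = p) (g : dhom B C m) (f : dhom A B n) :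
  dcomp e (yo_hom g) (yo_hom f) = yo_hom (dcomp e g f).
Proof.
apply: fhomP => i j; rewrite /= /fcomp.
rewrite (bigD1 tt) //= big1 ?addr0; last by case.
exact: dcomp_cast.
Qed.

Lemma yo_cocycle (A B : dob K) n (f : dhom A B n) :
  is_cocycle f <-> is_cocycle (yo_hom f).
Proof.
split=> Zf m e; first by rewrite yo_hom_dd Zf (lin0 (@yo_homL _ _ _)).
by apply: yo_hom_inj; rewrite -yo_hom_dd Zf (lin0 (@yo_homL _ _ _)).
Qed.

Lemma yo_coboundary (A B : dob K) n (f : dhom A B n) :
  is_coboundary f <-> is_coboundary (yo_hom f).
Proof.
split=> [[m [e [h <-]]]|[m [e [h Eh]]]]; first by exists m, e, (yo_hom h); exact: yo_hom_dd.
have [h' Eh'] := yo_hom_surj h; exists m, e, h'.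
by apply: yo_hom_inj; rewrite -yo_hom_dd Eh'.
Qed.

Lemma yo_vanishes (A B : dob K) n :
  @coh_vanishes k (pretr K) (yo A) (yo B) n <-> coh_vanishes A B n.
Proof.
split=> V x; have [f [Zf ->]] := coh_class_surj x; apply/coh_class0.
- by apply/yo_coboundary/(coh_class0 ((yo_cocycle f).1 Zf)); exact: V.
- have [g Eg] := yo_hom_surj f; move: Zf; rewrite -Eg => Zf {x f Eg}.
  have Zg := (yo_cocycle g).2 Zf.
  by apply/yo_coboundary/(coh_class0 Zg); exact: V.
Qed.

Definition yo_mor (A B : dob K) (f : @lhom k (H0 K) A B) : @lhom k H (yo A) (yo B) :=
  coh_class ((yo_cocycle _).1 (coh_reprP f)).

Lemma yo_morE (A B : dob K) (f : dhom A B 0) (Zf : is_cocycle f) Zf' :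
  yo_mor (coh_class Zf) = coh_class (f := yo_hom f) Zf'.
Proof.
apply/coh_classP; rewrite -(linB (@yo_homL _ _ _)); apply/yo_coboundary.
by apply/(coh_classP (coh_reprP _) Zf); exact: coh_reprK.
Qed.

Lemma yo_mor_comp (A B C : dob K) (g : @lhom k (H0 K) B C) (f : @lhom k (H0 K) A B) :
  yo_mor (g ∘ f) = yo_mor g ∘ yo_mor f.
Proof.
have [g' [Zg ->]] := coh_class_surj g; have [f' [Zf ->]] := coh_class_surj f.
rewrite [X in yo_mor X]H0compE !yo_morE; try exact: (yo_cocycle _).1.
  by apply/yo_cocycle; exact: cocycle_comp.
move=> Z1 Z2 Z3; rewrite [RHS]H0compE; apply: coh_class_eq.
by rewrite yo_hom_comp.
Qed.

End StarHull.

(** * Resolutions in the graded homotopy category *)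

Section Resolutions.
Variables (k : comPzRingType) (A : dgcat k).
Implicit Types W X Y Z V Q J : dob A.

Notation "g • f" := (hc (addr0 0) g f) (at level 40, left associativity).

Lemma hcA0 W X Y Z (h : cohom Y Z 0) (g : cohom X Y 0) (f : cohom W X 0) :
  h • (g • f) = h • g • f.
Proof. exact: hcA. Qed.

Lemma exact_triangle_rotate X Y Z a b c (u : cohom X Y a) (v : cohom Y Z b)
    (w : cohom Z X c) : exact_triangle u v w -> exact_triangle v w u.
Proof. by case. Qed.

Lemma exact_triangle_replace X X' Y Z a b c t t' a' c'
    (u : cohom X Y a) (v : cohom Y Z b) (w : cohom Z X c)
    (f : cohom X X' t) (g : cohom X' X t') (ea : a + t' = a') (ec : t + c = c') :
  t + t' = 0 -> graded_inverse f g -> exact_triangle u v w ->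
  exact_triangle (hc ea u g) v (hc ec f w).
Proof.
move=> tt fg [uv vw wu]; split.
- exact: exact_pair_left tt fg uv.
- exact: exact_pair_right tt fg vw.
- exact: exact_pair_mid tt fg wu.
Qed.

Lemma exact_vanishes_cov X Y Z a b (u : cohom X Y a) (v : cohom Y Z b) W m n l :
  exact_pair u v -> a + m = n -> b + n = l ->
  coh_vanishes W X m -> coh_vanishes W Z l -> coh_vanishes W Y n.
Proof.
move=> [_ E _] em el VX VZ x.
by have [y <-] := E _ _ _ el x (VZ _) _ em; rewrite (VX y) hc0r.
Qed.

Lemma exact_vanishes_con X Y Z a b (u : cohom X Y a) (v : cohom Y Z b) W m n l :
  exact_pair u v -> n + a = l -> m + b = n ->
  coh_vanishes X W l -> coh_vanishes Z W m -> coh_vanishes Y W n.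
Proof.
move=> [_ _ E] el em VX VZ x.
by have [y <-] := E _ _ _ el x (VX _) _ em; rewrite (VZ y) hc0l.
Qed.

Lemma vanishes_iso_cov t t' m n X X' W : t' + n = m -> graded_iso t X X' -> t + t' = 0 ->
  coh_vanishes W X m -> coh_vanishes W X' n.
Proof.
move=> e [t'' [f [g [tt [_ fg]]]]] tt' V x; have ? : t'' = t' by lia.
subst t''; have e' : t + m = n by lia.
by rewrite -(hc1f (add0r n) x) -(fg tt') -(hcA e e') (V (hc e g x)) hc0r.
Qed.

Lemma vanishes_iso_con t m n X X' W : n + t = m -> graded_iso t X X' ->
  coh_vanishes X W m -> coh_vanishes X' W n.
Proof.
move=> e [t' [f [g [tt [_ fg]]]]] V x.
have e' : m + t' = n by lia.
by rewrite -(hcf1 (addr0 n) x) -(fg tt) (hcA _ _ e e') (V (hc e x f)) hc0l.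
Qed.

(* Z is resolved by X_n -> ... -> X_0 -eps-> Z: there are Z_0 = Z, ..., Z_n and
   triangles Z_{i+1} -> X_i -> Z_i -> Sigma Z_{i+1} with Z_n isomorphic to X_n,
   and D i is the composite X_{i+1} -> Z_{i+1} -> X_i. *)
Fixpoint resolution (n : nat) (X : nat -> dob A) (D : forall i, cohom (X i.+1) (X i) 0)
    (Z : dob A) (eps : cohom (X 0) Z 0) {struct n} : Prop :=
  if n is n'.+1 then
    exists (Y : dob A) (eps' : cohom (X 1) Y 0) (v : cohom Z Y 1) (w : cohom Y (X 0) 0),
      [/\ @resolution n' (fun i => X i.+1) (fun i => D i.+1) Y eps',
          D 0 = w • eps' & exact_triangle eps v w]
  else exists g : cohom Z (X 0) 0, graded_inverse eps g.

Lemma resolution_iso (X : nat -> dob A) D Z eps : @resolution 0 X D Z eps -> graded_iso 0 (X 0) Z.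
Proof. by move=> [g Hg]; exists 0, eps, g. Qed.

(** Z is assembled from the [Sigma^i X_i], and a map of degree m out of [Sigma^i X_i] has degree m -
    i on [X_i], which is still negative. *)
Lemma resolution_neg_con V n (X : nat -> dob A) D Z eps : @resolution n X D Z eps ->
  (forall i m, (i <= n)%N -> m < 0 -> coh_vanishes (X i) V m) ->
  forall m, m < 0 -> coh_vanishes Z V m.
Proof.
elim: n X D Z eps => [|n IH] X D Z eps.
  move=> /resolution_iso XZ VX m m0.
  exact: vanishes_iso_con (addr0 m) XZ (VX 0 m _ m0).
move=> [Y [eps' [v [w [/IH HY _ [uv _ _]]]]]] VX m m0.
apply: (exact_vanishes_con uv (addr0 m) (subrK 1 m)); first exact: VX.
by apply: HY => [i l il|]; [exact: VX | lia].
Qed.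

Lemma resolution_pos_cov Q n (X : nat -> dob A) D Z eps : @resolution n X D Z eps ->
  (forall i m, (i <= n)%N -> 0 < m -> coh_vanishes Q (X i) m) ->
  forall m, 0 < m -> coh_vanishes Q Z m.
Proof.
elim: n X D Z eps => [|n IH] X D Z eps.
  move=> /resolution_iso XZ VX m m0.
  exact: vanishes_iso_cov (add0r m) XZ (addr0 0) (VX 0 m _ m0).
move=> [Y [eps' [v [w [/IH HY _ [uv _ _]]]]]] VX m m0.
apply: (exact_vanishes_cov uv (add0r m) (erefl (1 + m))); first exact: VX.
by apply: HY => [i l il|]; [exact: VX | lia].
Qed.

(** A map of degree m into [Sigma^i X_i] has degree m + i into [X_i]; as i is at most n, this is
    negative when m is below -n. *)
Lemma resolution_neg_cov Q n (X : nat -> dob A) D Z eps : @resolution n X D Z eps ->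
  (forall i m, (i <= n)%N -> m < 0 -> coh_vanishes Q (X i) m) ->
  forall m, m < - n%:Z -> coh_vanishes Q Z m.
Proof.
elim: n X D Z eps => [|n IH] X D Z eps.
  move=> /resolution_iso XZ VX m m0.
  by apply: vanishes_iso_cov (add0r m) XZ (addr0 0) (VX 0 m _ _) => //; lia.
move=> [Y [eps' [v [w [/IH HY _ [uv _ _]]]]]] VX m m0.
apply: (exact_vanishes_cov uv (add0r m) (erefl (1 + m))); first by apply: VX => //; lia.
by apply: HY => [i l il|]; [exact: VX | lia].
Qed.

(** The obstruction to a lift lies in [H^1(Q, Y)], where Y is resolved by the tail. *)
Lemma resolution_lift Q n (X : nat -> dob A) D Z eps : @resolution n X D Z eps ->
  (forall i m, (i <= n)%N -> 0 < m -> coh_vanishes Q (X i) m) ->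
  forall y : cohom Q Z 0, exists x, eps • x = y.
Proof.
case: n => [|n] /=.
  by move=> [g [_ fg]] _ y; exists (g • y); rewrite hcA0 fg hc1f.
move=> [Y [eps' [v [w [resY _ [[_ uv _] _ _]]]]]] VX y; apply: (uv _ _ _ (addr0 1)).
apply: (resolution_pos_cov resY) => // i m il; exact: VX.
Qed.

(** A map killed by [eps] factors through [v], hence comes from [H^-1(Y, V)]. *)
Lemma resolution_inj V n (X : nat -> dob A) D Z eps : @resolution n X D Z eps ->
  (forall i m, (i <= n)%N -> m < 0 -> coh_vanishes (X i) V m) ->
  forall g : cohom Z V 0, g • eps = 0 -> g = 0.
Proof.
case: n => [|n] /=.
  move=> [h [_ fh]] _ g g0.
  by rewrite -(hcf1 (addr0 0) g) -(fh (addr0 0)) hcA0 g0 hc0l.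
move=> [Y [eps' [v [w [resY _ [[_ _ uv] _ _]]]]]] VX g g0.
have e : -1 + 1 = 0 :> int by [].
have [y <-] := uv _ _ _ _ g g0 _ e.
rewrite (_ : y = 0) ?hc0l //.
by apply: (resolution_neg_con resY) => // i m il; exact: VX.
Qed.

Lemma resolution_complex n (X : nat -> dob A) D Z eps : @resolution n.+2 X D Z eps -> D 0 • D 1%N = 0.
Proof.
move=> [Y [eps' [v [w [[Y' [eps'' [v' [w' [_ -> [_ _ [E _ _]]]]]]] -> _]]]]].
by rewrite hcA0 -(hcA0 w) E hc0r hc0l.
Qed.

(** * Exactness into J and the positive Ext groups of Z *)

Section Contravariant.
Variable J : dob A.

(** The vanishing of positive Ext groups passes from Z to Y one degree lower, which feeds the
    induction. That of [Ext^1(Z, J)] extends every map Y -> J along [w], which gives exactness at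
    the first place. *)
Lemma contra_exact_of_vanishes d (X : nat -> dob A) D Z eps : @resolution d.+1 X D Z eps ->
  (forall i m, (i <= d.+1)%N -> m != 0 -> coh_vanishes (X i) J m) ->
  (forall m, 0 < m -> coh_vanishes Z J m) ->
  @contra_exact k (H0 A) d X D J.
Proof.
elim: d X D Z eps => [|d IH] X D Z eps; move=> res; have := res;
  move=> [Y [eps' [v [w [resY D0 [_ vw _]]]]]] VX VZ;
  have VY m : 0 < m -> coh_vanishes Y J m by
    [move=> m0; apply: (exact_vanishes_con vw (erefl (m + 1)) (addr0 m));
     [apply: VZ; lia | apply: VX => //; lia]];
  have surj (g : cohom Y J 0) : exists x : cohom (X 0) J 0, x • w = g by
    [case: vw => _ _ vw; apply: (vw _ _ _ (add0r 1)); exact: VZ].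
  split=> // h; have [g [gf fg]] := resY.
  have [x xw] := surj (h • g); exists x; rewrite [LHS](_ : _ = x • D 0) //.
  by rewrite D0 hcA0 xw -hcA0 gf hcf1.
have VX' i m : (i <= d.+1)%N -> m != 0 -> coh_vanishes (X i.+1) J m by move=> il; exact: VX.
have [IH1 IH2] := IH (fun i => X i.+1) (fun i => D i.+1) _ _ resY VX' VY.
split=> // -[_|i id]; last exact: IH1.
have := resY; move=> [Y' [eps'' [v' [w' [resY' D1 [_ _ [_ _ wu]]]]]]].
move=> h; split=> [h0|[x <-]]; last first.
  by rewrite [LHS](_ : _ = x • D 0 • D 1%N) // -hcA0 (resolution_complex res) hc0r.
have {}h0 : h • w' • eps'' = 0 by rewrite -hcA0 -D1.
have /wu H : h • w' = 0.
  apply: (resolution_inj resY') h0 => i m il m0; apply: VX; first exact: il.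
  lia.
have [g gE] := H _ (addr0 0); have [x xw] := surj g; exists x.
by rewrite [LHS](_ : _ = x • D 0) // D0 hcA0 xw.
Qed.

(** [Ext^1(Z, J)] is the cokernel of (X, J) -> (Y, J), and for larger m every element of
    [Ext^m(Z, J)] comes from [Ext^(m-1)(Y, J)]. *)
Lemma vanishes_con_step (X Y Z : dob A) (eps : cohom X Z 0) (v : cohom Z Y 1)
    (w : cohom Y X 0) : exact_triangle eps v w ->
  (forall m, 0 < m -> coh_vanishes X J m) -> (forall m, 0 < m -> coh_vanishes Y J m) ->
  (forall g : cohom Y J 0, exists x, x • w = g) ->
  forall m, 0 < m -> coh_vanishes Z J m.
Proof.
move=> [[_ _ uv] [vw _ _] _] VX VY surj m m0 z.
have [y <-] := uv _ _ _ (addr0 m) z (VX m m0 _) _ (subrK 1 m).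
have [m1|m1] : m = 1 \/ 0 < m - 1 by lia.
  subst m; have [x <-] := surj (y : cohom Y J (1 - 1)).
  by rewrite -(hcA (add0r 1) (add0r 1)) vw hc0r.
by rewrite (VY _ m1 y) hc0l.
Qed.

Lemma vanishes_of_contra_exact d (X : nat -> dob A) D Z eps :
  @resolution d.+1 X D Z eps ->
  (forall i m, (i <= d.+1)%N -> m != 0 -> coh_vanishes (X i) J m) ->
  @contra_exact k (H0 A) d X D J ->
  forall m, 0 < m -> coh_vanishes Z J m.
Proof.
elim: d X D Z eps => [|d IH] X D Z eps; move=> res; have := res;
  move=> [Y [eps' [v [w [resY D0 tri]]]]] VX [C1 C2];
  have VX0 m : 0 < m -> coh_vanishes (X 0) J m by [move=> m0; apply: VX => //; lia].
  have inj : forall g : cohom Y J 0, g • eps' = 0 -> g = 0.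
    by apply: (@resolution_inj J 0 (fun i => X i.+1) (fun i => D i.+1) Y eps' resY) => i m il m0; apply: VX => //; lia.
  apply: (vanishes_con_step tri VX0) => [m m0|g].
    by apply: vanishes_iso_con (addr0 m) (@resolution_iso (fun i => X i.+1) (fun i => D i.+1) Y eps' resY) (VX 1%N m _ _) => //; lia.
  have [x xD] := C2 (g • eps'); exists x; apply/eqP; rewrite -subr_eq0; apply/eqP.
  by apply: inj; rewrite hcBl -hcA0 -D0 [X in X - _](xD) subrr.
have VX' i m : (i <= d.+1)%N -> m != 0 -> coh_vanishes (X i.+1) J m by move=> il; exact: VX.
have inj : forall g : cohom Y J 0, g • eps' = 0 -> g = 0.
  by apply: (@resolution_inj J d.+1 (fun i => X i.+1) (fun i => D i.+1) Y eps' resY) => i m il m0; apply: VX' => //; lia.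
apply: (vanishes_con_step tri VX0) => [|g].
  by apply: (IH (fun i => X i.+1) (fun i => D i.+1) _ _ resY VX'); split=> [i il|]; [exact: C1 | exact: C2].
have [|x xD] := (C1 0 isT (g • eps')).1 _.
  have := resY; move=> [Y' [eps'' [v' [w' [_ D1 [_ _ [wu _ _]]]]]]].
  by rewrite [LHS](_ : _ = g • eps' • D 1%N) // D1 -hcA0 (hcA0 eps') wu hc0l hc0r.
exists x; apply/eqP; rewrite -subr_eq0; apply/eqP.
by apply: inj; rewrite hcBl -hcA0 -D0 [X in X - _](xD) subrr.
Qed.

End Contravariant.

(** * Exactness from Q and the negative Ext groups of Z *)

Section Covariant.
Variable Q : dob A.

(** Negative classes of Z embed into [H^(m+1)(Q, Y)]. For m = -1 the image is killed by [w], and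
    this is where injectivity enters. *)
Lemma vanishes_cov_step (X Y Z : dob A) (eps : cohom X Z 0) (v : cohom Z Y 1)
    (w : cohom Y X 0) : exact_triangle eps v w ->
  (forall m, m < 0 -> coh_vanishes Q X m) -> (forall m, m < 0 -> coh_vanishes Q Y m) ->
  (forall y : cohom Q Y 0, w • y = 0 -> y = 0) ->
  forall m, m < 0 -> coh_vanishes Q Z m.
Proof.
move=> [[_ uv _] [vw _ _] _] VX VY inj m m0 z.
suff vz : hc (erefl (1 + m)) v z = 0.
  by have [x <-] := uv _ _ _ _ z vz _ (add0r m); rewrite (VX _ m0 x) hc0r.
have [m1|m1] : m = -1 \/ 1 + m < 0 by lia.
  subst m; apply: inj.
  by rewrite (hcA _ _ (add0r 1) (erefl (1 + -1))) vw hc0l.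
exact: VY.
Qed.

Lemma vanishes_of_co_exact d (X : nat -> dob A) D Z eps : @resolution d.+1 X D Z eps ->
  (forall i m, (i <= d.+1)%N -> m != 0 -> coh_vanishes Q (X i) m) ->
  @co_exact k (H0 A) d X D Q ->
  forall m, m < 0 -> coh_vanishes Q Z m.
Proof.
elim: d X D Z eps => [|d IH] X D Z eps; move=> res; have := res;
  move=> [Y [eps' [v [w [resY D0 tri]]]]] VX [C1 C2];
  have VX0 m : m < 0 -> coh_vanishes Q (X 0) m by [move=> m0; apply: VX => //; lia].
  have lift : forall y : cohom Q Y 0, exists x, eps' • x = y.
    by apply: (@resolution_lift Q 0 (fun i => X i.+1) (fun i => D i.+1) Y eps' resY) => i m il m0; apply: VX => //; lia.
  apply: (vanishes_cov_step tri VX0) => [m m0|y wy].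
    by apply: vanishes_iso_cov (add0r m) (@resolution_iso (fun i => X i.+1) (fun i => D i.+1) Y eps' resY) (addr0 0) (VX 1%N m _ _) => //; lia.
  have [x xy] := lift y; rewrite -xy (C1 x) ?hc0r //.
  by rewrite [LHS](_ : _ = D 0 • x) // D0 -hcA0 xy.
have VX' i m : (i <= d.+1)%N -> m != 0 -> coh_vanishes Q (X i.+1) m by move=> il; exact: VX.
have lift : forall y : cohom Q Y 0, exists x, eps' • x = y.
  by apply: (@resolution_lift Q d.+1 (fun i => X i.+1) (fun i => D i.+1) Y eps' resY) => i m il m0; apply: VX' => //; lia.
apply: (vanishes_cov_step tri VX0) => [|y wy].
  by apply: (IH (fun i => X i.+1) (fun i => D i.+1) _ _ resY VX'); split=> [|i il]; [exact: C1 | exact: C2].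
have [x xy] := lift y.
have [|u uE] := (C2 0 isT x).1 _.
  by rewrite [LHS](_ : _ = D 0 • x) // D0 -hcA0 xy.
have := resY; move=> [Y' [eps'' [v' [w' [_ D1 [_ _ [wu _ _]]]]]]].
by rewrite -xy -uE [X in _ • X](_ : _ = D 1%N • u) // D1 -hcA0 (hcA0 eps') wu hc0l.
Qed.

Lemma co_exact_of_vanishes d (X : nat -> dob A) D Z eps : @resolution d.+1 X D Z eps ->
  (forall i m, (i <= d.+1)%N -> m != 0 -> coh_vanishes Q (X i) m) ->
  (forall m, m < 0 -> coh_vanishes Q Z m) ->
  @co_exact k (H0 A) d X D Q.
Proof.
elim: d X D Z eps => [|d IH] X D Z eps; move=> res; have := res;
  move=> [Y [eps' [v [w [resY D0 [_ vw _]]]]]] VX VZ.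
all: have inj : forall y : cohom Q Y 0, w • y = 0 -> y = 0.
1,3: have [_ E _] := vw; move=> y wy; have [z <-] := E _ _ _ _ y wy (-1) (erefl 0);
  by rewrite (VZ (-1) isT z) hc0r.
  split=> // x x0; have [g [gf fg]] := resY.
  rewrite -(hc1f (add0r 0) x) -(gf (addr0 0)) (eq_irrelevance (add0r 0) (addr0 0)).
  rewrite -hcA0 (inj (eps' • x)) ?hc0r // hcA0 -D0; exact: x0.
have VX' i m : (i <= d.+1)%N -> m != 0 -> coh_vanishes Q (X i.+1) m by move=> il; exact: VX.
have VY m : m < 0 -> coh_vanishes Q Y m.
  have e : 1 + (m - 1) = m by lia.
  move=> m0; apply: (exact_vanishes_cov vw e (add0r m)); first by apply: VZ; lia.
  by apply: VX => //; lia.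
have [IH1 IH2] := IH (fun i => X i.+1) (fun i => D i.+1) _ _ resY VX' VY.
split=> // -[_|i id] x; last exact: IH2.
have := resY; move=> [Y' [eps'' [v' [w' [resY' D1 [_ _ [_ wu _]]]]]]].
split=> [x0|[u <-]]; last first.
  by rewrite [LHS](_ : _ = D 0 • (D 1%N • u)) // hcA0 (resolution_complex res) hc0l.
have /wu H : eps' • x = 0 by apply: inj; rewrite hcA0 -D0; exact: x0.
have [y yx] := H _ (addr0 0).
have lift : forall y : cohom Q Y' 0, exists x, eps'' • x = y.
  apply: (@resolution_lift Q d (fun i => X i.+2) (fun i => D i.+2) Y' eps'' resY').
  by move=> i m il m0; apply: VX => //; lia.
have [u uy] := lift y; exists u.
by rewrite [LHS](_ : _ = D 1%N • u) // D1 -hcA0 uy yx.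
Qed.

End Covariant.

End Resolutions.

(** * Exactness along a fully faithful functor *)

Section FullyFaithful.
Variables (k : comPzRingType) (C C' : lincat k) (F : lob C -> lob C').
Variable (Fm : forall X Y, @lhom k C X Y -> @lhom k C' (F X) (F Y)).
Hypothesis Fm_comp : forall X Y Z (g : lhom Y Z) (f : lhom X Y), Fm (g ∘ f) = Fm g ∘ Fm f.
Hypothesis Fm0 : forall X Y, Fm (0 : lhom X Y) = 0.
Hypothesis Fm_inj : forall X Y, injective (@Fm X Y).
Hypothesis Fm_surj : forall X Y (g : lhom (F X) (F Y)), exists f, Fm f = g.

Variables (d : nat) (X : nat -> lob C) (del : forall i, lhom (X i.+1) (X i)).

Lemma contra_exact_ff J : contra_exact d del J <->
  @contra_exact k C' d (fun i => F (X i)) (fun i => Fm (del i)) (F J).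
Proof.
split=> -[E1 E2]; split.
- move=> i id g; have [f <-] := Fm_surj g; rewrite -Fm_comp -(Fm0 (X i.+2)).
  split=> [/Fm_inj/(E1 i id)[u <-]|[u]]; first by exists (Fm u); rewrite Fm_comp.
  have [u' <-] := Fm_surj u; rewrite -Fm_comp => /Fm_inj E.
  by congr Fm; apply/(E1 i id); exists u'.
- move=> g; have [f <-] := Fm_surj g; have [v <-] := E2 f.
  by exists (Fm v); rewrite Fm_comp.
- move=> i id f; split=> [f0|[u <-]].
    have [|u uE] := (E1 i id (Fm f)).1 _; first by rewrite -Fm_comp f0 Fm0.
    have [u' u'E] := Fm_surj u; exists u'; apply: Fm_inj.
    by rewrite Fm_comp u'E.
  apply: Fm_inj; rewrite Fm_comp Fm0; apply/(E1 i id).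
  by exists (Fm u); rewrite Fm_comp.
- move=> w; have [v vE] := E2 (Fm w); have [v' v'E] := Fm_surj v.
  by exists v'; apply: Fm_inj; rewrite Fm_comp v'E.
Qed.

Lemma co_exact_ff Q : co_exact d del Q <->
  @co_exact k C' d (fun i => F (X i)) (fun i => Fm (del i)) (F Q).
Proof.
split=> -[E1 E2]; split.
- move=> g; have [f <-] := Fm_surj g; rewrite -Fm_comp -(Fm0 _ (X d)) => /Fm_inj/E1 ->.
  by rewrite Fm0.
- move=> i id g; have [f <-] := Fm_surj g; rewrite -Fm_comp -(Fm0 Q).
  split=> [/Fm_inj/(E2 i id)[u <-]|[u]]; first by exists (Fm u); rewrite Fm_comp.
  have [u' <-] := Fm_surj u; rewrite -Fm_comp => /Fm_inj E.
  by congr Fm; apply/(E2 i id); exists u'.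
- move=> f f0; apply: Fm_inj; rewrite Fm0; apply: E1.
  by rewrite -Fm_comp f0 Fm0.
- move=> i id f; split=> [f0|[u <-]].
    have [|u uE] := (E2 i id (Fm f)).1 _; first by rewrite -Fm_comp f0 Fm0.
    have [u' u'E] := Fm_surj u; exists u'; apply: Fm_inj.
    by rewrite Fm_comp u'E.
  apply: Fm_inj; rewrite Fm_comp Fm0; apply/(E2 i id).
  by exists (Fm u); rewrite Fm_comp.
Qed.

End FullyFaithful.

(** * Cohomology of the truncation *)

Section Truncated.
Variables (k : comPzRingType) (A : dgcat k).
Implicit Types X Y : dob A.

Lemma trunc_vanishes_pos X Y n : 0 < n -> @coh_vanishes k (tau_le0 A) X Y n.
Proof.
move=> n0 x; have [f [Zf ->]] := coh_class_surj x; apply/coh_class0.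
exists (n - 1), (subrK _ _), 0.
rewrite (lin0 (@dd_lin k (tau_le0 A) _ _ _ _ _)).
by apply: val_inj; have [f0 _] := submodP f; rewrite /= f0.
Qed.

Lemma trunc_vanishes_neg X Y n : n < 0 ->
  @coh_vanishes k (tau_le0 A) X Y n <-> coh_vanishes X Y n.
Proof.
move=> n0; split=> V x; have [f [Zf ->]] := coh_class_surj x; apply/coh_class0.
- have Tf : in_trunc f by split=> n1; lia.
  have Zf' : @is_cocycle k (tau_le0 A) X Y n (mksub (S := truncsub X Y n) Tf).
    by move=> m e; apply: val_inj; exact: Zf.
  have /coh_class0[m [e [h Eh]]] := V (coh_class Zf').
  by exists m, e, (smval h); exact: (congr1 (@smval _ _ _) Eh).
- have Zf' : is_cocycle (smval f).
    by move=> m e; exact: (congr1 (@smval _ _ _) (Zf m e)).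
  have /coh_class0[m [e [h Eh]]] := V (coh_class Zf').
  (* A primitive has degree n - 1 < 0, where the truncation keeps every map. *)
  have Th : in_trunc h by split=> n1; lia.
  exists m, e, (mksub (S := truncsub X Y m) Th).
  by apply: val_inj; exact: Eh.
Qed.

Lemma trunc_concentrated :
  concentrated_in_degree_zero (tau_le0 A) <-> concentrated_in_nonneg_degrees A.
Proof.
split=> V X Y n n0; first by apply/(trunc_vanishes_neg X Y n0); apply: V; lia.
have [n1|n1] : n < 0 \/ 0 < n by lia.
  by apply/(trunc_vanishes_neg X Y n1); exact: V.
exact: trunc_vanishes_pos.
Qed.

End Truncated.

(** * Towers of extensions *)

Section Towers.
Variables (k : comPzRingType) (K : dgcat k).
Notation T := (dob (pretr K)).
Notation H := (tr K).
Notation "g • f" := (hc (addr0 0) g f) (at level 40, left associativity).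
Implicit Types W Y Z : T.

Lemma resolution_is_complex n (X : nat -> T) D Z eps : @resolution k (pretr K) n X D Z eps ->
  forall i, (i.+1 < n)%N -> D i • D i.+1 = 0.
Proof.
elim: n X D Z eps => [//|n IH] X D Z eps res [|i] i_n.
  by case: n IH res i_n => // n _ /resolution_complex.
have := res; move=> [Y [eps' [v [w [resY _ _]]]]].
exact: (IH (fun i => X i.+1) (fun i => D i.+1) Y eps' resY).
Qed.

(* X_0 * (Sigma X_1 * (Sigma^2 X_2 * ...)), with all extensions split as graded
   objects. *)
Fixpoint right_tower (n : nat) (X : nat -> T) Z : Prop :=
  if n is n'.+1 then
    exists2 Y, right_tower n' (fun i => X i.+1) Y & inhabited (split_ext (X 0) Z (sus Y))
  else Z = X 0.

Lemma resolution_of_complex n (X : nat -> T) (D : forall i, cohom (X i.+1) (X i) 0) :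
  (forall i, (i.+1 < n)%N -> D i • D i.+1 = 0) ->
  (forall i j m, m < 0 -> coh_vanishes (X i) (X j) m) ->
  exists Z (eps : cohom (X 0) Z 0), @resolution k (pretr K) n X D Z eps /\ right_tower n X Z.
Proof.
elim: n X D => [|n IH] X D DD VX.
  exists (X 0), (H0id (X 0)); split=> //; exists (H0id (X 0)).
  by split=> e; rewrite hc1f.
have [Y [eps' [resY tY]]] := IH (fun i => X i.+1) (fun i => D i.+1)
  (fun i i_n => DD i.+1 i_n) (fun i j => VX i.+1 j.+1).
(* The composite of [D 0] with [w'] vanishes, since it does so after [eps''] and there are no
   negative maps into [X 0]; hence [D 0] factors through [eps']. *)
have [w wD] : exists w : cohom Y (X 0) 0, w • eps' = D 0.
  case: n IH DD resY tY => [|n] _ DD resY _.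
    by have [g [gf _]] := resY; exists (D 0 • g); rewrite -hcA0 gf hcf1.
  have := resY; move=> [Y' [eps'' [v' [w' [resY' D1 [_ _ [_ _ wu]]]]]]].
  apply: (wu _ _ _ (addr0 0) (D 0)).
  apply: (@resolution_inj k (pretr K) (X 0) n (fun i => X i.+2) (fun i => D i.+2) Y' eps'' resY').
    by move=> i m _; exact: VX.
  by rewrite -hcA0 -D1 DD.
have [w0 [Zw0 w0E]] := coh_class_surj w.
have [Zs Zu us su] := sus_strict Y.
pose s := coh_class Zs; pose u := coh_class Zu.
have su_inv : graded_inverse u s.
  by split=> e; rewrite hcE; apply: coh_class_eq; apply: op_inj => W x; rewrite op_comp ?us ?su op_id.
have e1 : 0 + 1 = 1 :> int by [].
(* Z is the cone of [w]: its class is [w] after the degree 1 isomorphism Sigma Y -> Y. *)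
have [Z [S cS]] := pretr_has_ext (cocycle_comp e1 Zw0 Zu).
have e0 : 1 + 0 = 1 :> int by [].
have e2 : 1 + -1 = 0 :> int by [].
exists Z, (coh_class (se_Zi S)); split; last by exists Y.
exists Y, eps', (hc e0 u (coh_class (se_Zp S))),
  (hc e2 (coh_class (se_class_cocycle S)) s); split=> //.
  rewrite -wD; congr (_ • _).
  have -> : coh_class (se_class_cocycle S) = hc e1 w u.
    by rewrite w0E hcE; exact: coh_class_eq.
  have e3 : 0 + 0 = 0 :> int by [].
  by rewrite -(hcA (e2 : 1 + -1 = 0) e3) (su_inv.2 e2) hcf1.
have tri := exact_triangle_rotate (exact_triangle_rotate (split_triangle S)).
apply: exact_triangle_rotate.
exact: (exact_triangle_replace e2 e0 e2 su_inv tri).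
Qed.
End Towers.

(** Zero class means that E is X + C with its differential, and a contraction [h] of C removes the
    second summand. *)
Lemma split_contractible (k : comPzRingType) (A : dgcat k) (X E C : dob A) (S : split_ext X E C) :
  se_class S = 0 -> coh_vanishes C C 0 -> graded_iso 0 E X.
Proof.
move=> S0 VC; have cE W (x : elts W C) : op (se_class S) x = 0 by rewrite S0 op0l.
have /coh_class0[m [e [h Eh]]] := VC (coh_class (cocycle_id C)).
have ? : m = -1 by lia.
subst m.
have hE W (x : elts W C) : bnd (op h x) = x - op h (bnd x).
  have := congr1 (fun z => op z x) Eh.
  rewrite op_dd op_id sgnN1 scaleN1r opprK => Ex.
  by apply/eqP; rewrite eq_sym subr_eq Ex.
have e1 : 0 + -1 = -1 :> int by [].
have e2 : -1 + 0 = -1 :> int by [].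
apply: (@graded_isoI k A E X (se_r S) (se_i S) (dcomp e1 (se_s S) (dcomp e2 h (se_p S))) 0).
- by apply: cocycle_op0 => W x; rewrite !(seE S, cE); zmod.
- exact: se_Zi.
- by move=> W x; rewrite !(opE, seE S, cE, hE); zmod.
- by move=> W x; rewrite !(opE, seE S); zmod.
Qed.

(** * Towers over K and their resolutions by P *)

Section PreclusterTilting.
Variables (k : comPzRingType) (K : dgcat k).
Notation T := (dob (pretr K)).
Notation H := (tr K).
Notation "g • f" := (hc (addr0 0) g f) (at level 40, left associativity).
Implicit Types W X Y Z : T.
Implicit Types S U : T -> Prop.

(* (...(Sigma^j K * Sigma^{j+1} K) * ...) * Sigma^{j+n} K, with all extensions
   split as graded objects. *)
Fixpoint left_tower (j n : nat) Z : Prop :=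
  if n is n'.+1 then
    exists D (A : dob K), left_tower j n' D /\
      inhabited (split_ext D Z (iter (j + n) (@sus k K) (yo A)))
  else exists A : dob K, Z = iter j (@sus k K) (yo A).

Lemma sus_split X E Y : split_ext X E Y -> inhabited (split_ext (sus X) (sus E) (sus Y)).
Proof.
have sym V := let: And4 Zf Zg gf fg := sus_strict V in
  And4 Zg Zf fg gf : @strict_shift k (pretr K) 1 (sus V) V (shift_out 1 _) (shift_in 1 _).
by move=> S; constructor; exact: split_shift (sym X) (sym E) (sym Y) S.
Qed.

Lemma left_tower_sus j n Z : left_tower j n Z -> left_tower j.+1 n (sus Z).
Proof.
elim: n Z => [|n IH] Z /=; first by move=> [A ->]; exists A.
by move=> [D [A [/IH tD [/sus_split SD]]]]; exists (sus D), A.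
Qed.

(** A complex yields a tower nested to the right, whereas [star_pow] is nested to the left;
    [split_assoc_rev] moves the brackets. *)
Lemma left_tower_cons j n (A : dob K) Z W :
  split_ext (iter j (@sus k K) (yo A)) Z W -> left_tower j.+1 n W -> left_tower j n.+1 Z.
Proof.
elim: n Z W => [|n IH] Z W SZ.
  move=> [B WB]; exists (iter j (@sus k K) (yo A)), B; split; first by exists A.
  by rewrite addn1 -WB.
move=> [D [B [tD [SW]]]].
have [D' [SD'] [SZ']] := split_assoc_rev (@pretr_has_ext k K) SZ SW.
exists D', B; split; first exact: IH SD' tD.
by constructor; rewrite addnS -addSn.
Qed.

Lemma right_tower_left n (X : nat -> dob K) Z :
  right_tower n (fun i => yo (X i)) Z -> left_tower 0 n Z.
Proof.
elim: n X Z => [|n IH] X Z /=; first by move=> ->; exists (X 0).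
move=> [Y /(IH (fun i => X i.+1)) tY [SZ]].
exact: (@left_tower_cons 0 n (X 0) Z (sus Y) SZ (left_tower_sus tY)).
Qed.

Lemma hullK_yo (A : dob K) : hullK (yo A).
Proof. by exists A => //; apply/isomorphicP; exact: graded_iso_refl. Qed.

Lemma left_tower_star_pow n Z : left_tower 0 n Z -> star_pow n Z.
Proof.
elim: n Z => [|n IH] Z /=; first by move=> [A ->]; exact: hullK_yo.
move=> [D [A [/IH tD [SZ]]]].
apply: (split_star SZ (graded_iso_refl _) (graded_iso_refl _) tD).
by exists (yo A) => //; exact: hullK_yo.
Qed.

Lemma replete_hull (P : dob K -> Prop) : replete (hull P).
Proof.
move=> X Y [A PA /isomorphicP AX] XY; exists A => //; apply/isomorphicP.
exact: graded_iso_trans (addr0 0) AX XY.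
Qed.

Lemma Ext_vanishesP i X Y : Ext_vanishes i X Y <-> @coh_vanishes k (pretr K) X Y i%:Z.
Proof.
have ii : - i%:Z + i%:Z = 0 by lia.
split=> V.
- exact: (vanishes_iso_cov ii (graded_iso_sym ii (iter_sus_graded_iso i Y)) (addrN _) V).
- exact: (vanishes_iso_cov (addr0 i%:Z) (iter_sus_graded_iso i Y) ii V).
Qed.

Lemma zero_object_vanishes (O : dob K) n : zero_object (C := H0 K) O ->
  @coh_vanishes k (pretr K) (iter n (@sus k K) (yo O)) (iter n (@sus k K) (yo O)) 0.
Proof.
move=> [O0 _]; have V : @coh_vanishes k (pretr K) (yo O) (yo O) 0.
  by apply/yo_vanishes => x; exact: O0.
have I := iter_sus_graded_iso n (yo O).
have e : - n%:Z + n%:Z = 0 by lia.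
apply: (vanishes_iso_con (add0r (- n%:Z)) I).
by apply: (vanishes_iso_cov _ I e V); rewrite subrr.
Qed.

(** The longer product is reached by adding a suspended zero object of [H0 K], which is contractible
    in the hull. *)
Lemma star_pow_yo n (A : dob K) : additive_category (H0 K) -> star_pow n (yo A).
Proof.
move=> [[O zO] _]; elim: n => [|n IH]; first exact: hullK_yo.
pose C := iter n.+1 (@sus k K) (yo O).
have [E [S cS]] := @pretr_has_ext k K (yo A) C 0 (@cocycle0 _ _ _ _ _).
have EA := split_contractible cS (@zero_object_vanishes O n.+1 zO).
apply: (split_star S EA (graded_iso_refl _) IH).
by exists (yo O) => //; exact: hullK_yo.
Qed.

Section Triple.
Variables (d : nat) (P I : dob K -> Prop).
Hypothesis HT : precluster_tilting_triple d P I.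

Notation Kshift n := (shifted (- n%:Z) (@hullK k K)).

(** The product P * Sigma P * ... * Sigma^n K bracketed from the right, as [resolution] unfolds
    it. *)
Fixpoint Ptower (n : nat) : T -> Prop :=
  if n is n'.+1 then estar (hull P) (shifted (-1) (Ptower n')) else @hullK k K.

Lemma replete_Ptower n : replete (Ptower n).
Proof. by case: n => [|n]; [exact: replete_hull | exact: replete_estar]. Qed.

Lemma hullK_resolution Z : hullK Z -> estar (hull P) (shifted (-1) (@hullK k K)) Z.
Proof.
move=> [A _ /isomorphicP AZ]; apply: (replete_estar _ AZ).
have [A' [Q [u [v [w [PQ]]]]]] := pct_resolution HT A.
move=> [X [Y [f [Zf [a [b [c [[aI bI cI] _]]]]]]]].
exists Y, (sus X), (cone Zf); split.
- by exists Q => //; exists b.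
- exists X; last exact: sus_graded_iso.
  by exists A' => //; exists a.
- by constructor; exact: cone_split.
- exact: graded_iso_sym (addr0 0) (is_iso_graded cI).
Qed.

Lemma hullK_ext Z : estar (@hullK k K) (@hullK k K) Z -> hullK Z.
Proof.
move=> [X [Y [E [KX KY [S] EZ]]]]; apply: (pct_ext_closed HT).
exact: split_star S EZ (graded_iso_refl _) KX KY.
Qed.

Lemma estar_Kshift n S Z : replete S ->
  estar (shifted (-1) S) (Kshift n.+1) Z -> shifted (-1) (estar S (Kshift n)) Z.
Proof.
move=> rS SZ; apply: (estar_shifted (@pretr_has_shift k K) rS); first exact: replete_shifted.
apply: (estar_sub (fun _ SX => SX) _ SZ) => X KX.
have e : - n%:Z + -1 = - n.+1%:Z by lia.
exact: (shiftedD (@pretr_has_shift k K) _ _ e).2 KX.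
Qed.

(** Write T_n for [Ptower n]. For n = 0, K * Sigma K lies in P * Sigma K * Sigma K, and Sigma K *
    Sigma K = Sigma (K * K) lies in Sigma K. Then T_(n+1) * Sigma^(n+2) K lies in P * Sigma (T_n *
    Sigma^(n+1) K), to which induction applies. *)
Lemma Ptower_extend n Z : estar (Ptower n) (Kshift n.+1) Z -> Ptower n.+1 Z.
Proof.
elim: n Z => [|n IH] Z.
  move=> EZ.
  have {}EZ : estar (estar (hull P) (shifted (-1) (@hullK k K))) (Kshift 1) Z.
    exact: (estar_sub hullK_resolution (fun _ KX => KX) EZ).
  have := estar_assoc (@pretr_has_ext k K) EZ; apply: (estar_sub (fun _ PX => PX)) => X EX.
  have rK : replete (@hullK k K) by exact: replete_hull.
  apply: shifted_sub (estar_shifted (@pretr_has_shift k K) rK rK EX) => Y.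
  exact: hullK_ext.
move=> /(estar_assoc (@pretr_has_ext k K)); apply: (estar_sub (fun _ PX => PX)) => X EX.
exact: shifted_sub IH (estar_Kshift (@replete_Ptower n) EX).
Qed.

Lemma star_pow_Ptower n Z : star_pow n Z -> Ptower n Z.
Proof.
elim: n Z => [//|n IH] Z [X [Y [u [v [w [SX UY uvw]]]]]].
apply: Ptower_extend; apply: star_estar.
- exact: replete_Ptower.
- exact: replete_shifted.
exists X, Y, u, v, w; split=> //; first exact: IH.
have [V KV ->] := UY; exists V => //; exact: iter_sus_graded_iso.
Qed.

Lemma yo_mor_surj (A B : dob K) (g : @lhom k H (yo A) (yo B)) : exists f, yo_mor f = g.
Proof.
have [g' [Zg ->]] := coh_class_surj g; have [f Ef] := yo_hom_surj g'.
move: Zg; rewrite -Ef => Zg; exists (coh_class ((yo_cocycle f).2 Zg)).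
exact: yo_morE.
Qed.

Lemma yo_mor0 (A B : dob K) : yo_mor (0 : @lhom k (H0 K) A B) = 0.
Proof.
have B0 : is_coboundary (0 : dhom A B 0) by exists (-1), erefl, 0; exact/lin0/dd_lin.
have E : 0 = coh_class (@cocycle0 k K A B 0) by exact/esym/coh_class0.
rewrite [X in yo_mor X]E (yo_morE _ ((yo_cocycle _).1 (@cocycle0 k K A B 0))).
exact: (coh_class0 _).2 ((yo_coboundary _).1 B0).
Qed.

Lemma yo_mor_inj (A B : dob K) : injective (@yo_mor k K A B).
Proof.
move=> f g; have [f' [Zf ->]] := coh_class_surj f; have [g' [Zg ->]] := coh_class_surj g.
rewrite (yo_morE Zf ((yo_cocycle f').1 Zf)) (yo_morE Zg ((yo_cocycle g').1 Zg)).
move=> /coh_classP; rewrite -(linB (@yo_homL _ _ _ _ _)) => /((yo_coboundary _).2) E.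
exact: (coh_classP _ _).2 E.
Qed.

Lemma Ptower_resolution n Z : Ptower n Z ->
  exists (X : nat -> dob K) (del : forall i, @lhom k (H0 K) (X i.+1) (X i))
      (eps : cohom (yo (X 0)) Z 0),
    (forall i, (i < n)%N -> P (X i)) /\
    @resolution k (pretr K) n (fun i => yo (X i)) (fun i => yo_mor (del i)) Z eps.
Proof.
elim: n Z => [|n IH] Z.
  move=> [A _ /isomorphicP[t' [f [g [t0 fg]]]]]; have ? : t' = 0 by lia.
  (* Only the object at index 0 matters; the differentials are fillers beyond the length. *)
  subst t'; exists (fun=> A), (fun=> 0), f; split=> //; by exists g.
move=> [X0 [W [E [[Q PQ /isomorphicP QX0] [Y /IH[X [del [eps' [PX resY]]]] YW] [S] EZ]]]].
have [a' [a [ai [a0 aP]]]] := QX0; have ? : a' = 0 by lia.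
subst a'; have {}aP := graded_inverse_sym aP.
have [y' [y [yi [y0 yP]]]] := YW; have ? : y' = 1 by lia.
subst y'; have {}yP := graded_inverse_sym yP.
have [z' [z [zi [z0 zP]]]] := EZ; have ? : z' = 0 by lia.
subst z'.
have e00 : 0 + 0 = 0 :> int by [].
have e01 : 0 + 1 = 1 :> int by [].
(* [exact_triangle_replace] changes the first vertex, so rotations bring the three vertices there in
   turn. *)
have t1 := exact_triangle_replace e00 e01 a0 aP (split_triangle S).
have t2 := exact_triangle_replace e00 e00 z0 zP (exact_triangle_rotate t1).
have e1 : 1 + -1 = 0 :> int by [].
have e11 : 1 + 0 = 1 :> int by [].
have t3 := exact_triangle_replace e1 e11 e1 yP (exact_triangle_rotate t2).
have {}t3 := exact_triangle_rotate t3.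
set eps := hc _ z _ in t3; set w := hc e1 _ _ in t3; set v := hc e11 _ _ in t3.
(* Fullness of [yo] lets the new differential come from [H0 K]. *)
have [d0 d0E] := yo_mor_surj (w • eps').
pose X' i := if i is j.+1 then X j else Q.
pose del' i : @lhom k (H0 K) (X' i.+1) (X' i) :=
  match i return @lhom k (H0 K) (X' i.+1) (X' i) with j.+1 => del j | 0 => d0 end.
exists X', del', eps; split; first by case.
by exists Y, eps', v, w; split.
Qed.

End Triple.
End PreclusterTilting.

Lemma fullsub_vanishes (k : comPzRingType) (A : dgcat k) (S : dob A -> Prop)
    (X Y : dob (fullsub S)) n :
  coh_vanishes X Y n <-> @coh_vanishes k A (sval X) (sval Y) n.
Proof.
split=> V x; have [f [Zf ->]] := coh_class_surj x; apply/coh_class0.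
- exact: (coh_class0 (Zf : @is_cocycle k (fullsub S) X Y n f)).1 (V _).
- exact: (coh_class0 (Zf : @is_cocycle k A (sval X) (sval Y) n f)).1 (V _).
Qed.

Lemma fullsub_concentrated (k : comPzRingType) (A : dgcat k) (S : dob A -> Prop) :
  concentrated_in_nonneg_degrees (fullsub S) <->
  forall X Y m, S X -> S Y -> m < 0 -> coh_vanishes X Y m.
Proof.
split=> V => [X Y m SX SY m0|X Y m m0].
  exact: (fullsub_vanishes (exist _ X SX) (exist _ Y SY) m).1 (V _ _ _ m0).
by apply/fullsub_vanishes; apply: V m0; [exact: (svalP X) | exact: (svalP Y)].
Qed.

(** * Negative cohomology: from P to K and from K to B^(d+1) *)

Section MainProof.
Variables (k : comPzRingType) (K : dgcat k) (d : nat) (P I : dob K -> Prop).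
Hypothesis HT : precluster_tilting_triple d P I.
Notation T := (dob (pretr K)).
Notation van := (@coh_vanishes k (pretr K)).

Lemma Ext_P_pos (Q A : dob K) m : P Q -> 0 < m ->
  van (yo Q) (yo A) m /\ van (yo A) (yo Q) m.
Proof.
case: m => [[|m]|m] // PQ _.
by have [V1 V2] := pct_Ext HT A (ltn0Sn m) PQ; split; apply/Ext_vanishesP.
Qed.

Lemma inB_yo n (A : dob K) : inB I n (yo A).
Proof.
split=> [|i J i1 IJ]; first exact/star_pow_yo/(pct_additive HT).
by have [_] := pct_Ext HT A i1 (pct_I_sub_P HT IJ).
Qed.

Section Complexes.
Hypothesis Kneg : concentrated_in_nonneg_degrees K.

Lemma yo_neg (A B : dob K) m : m < 0 -> van (yo A) (yo B) m.
Proof. by move=> m0; apply/yo_vanishes; exact: Kneg. Qed.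

Lemma yo_P_nonzero (Q A : dob K) m : P Q -> m != 0 ->
  van (yo Q) (yo A) m /\ van (yo A) (yo Q) m.
Proof.
move=> PQ m0; have [m1|m1] : m < 0 \/ 0 < m by lia.
  by split; exact: yo_neg.
exact: Ext_P_pos.
Qed.

Variables (X : nat -> dob K) (del : forall i, @lhom k (H0 K) (X i.+1) (X i)).

Let contra_ff J := @contra_exact_ff k (H0 K) (tr K) (@yo k K) (@yo_mor k K)
  (@yo_mor_comp k K) (@yo_mor0 k K) (@yo_mor_inj k K) (@yo_mor_surj k K) d X del J.
Let co_ff Q := @co_exact_ff k (H0 K) (tr K) (@yo k K) (@yo_mor k K)
  (@yo_mor_comp k K) (@yo_mor0 k K) (@yo_mor_inj k K) (@yo_mor_surj k K) d X del Q.

Lemma co_exact_of_concentrated (Q : dob K) :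
  (forall Z, inB I d.+1 Z -> forall m, m < 0 -> van (yo Q) Z m) -> P Q ->
  @is_complex k (H0 K) d X del ->
  (forall J, I J -> @contra_exact k (H0 K) d X del J) ->
  @co_exact k (H0 K) d X del Q.
Proof.
move=> V PQ DD CE; apply/co_ff.
have DD' i : (i.+1 < d.+1)%N -> hc (addr0 0) (yo_mor (del i)) (yo_mor (del i.+1)) = 0.
  by move=> /DD D0; rewrite -hc_H0 -yo_mor_comp D0 yo_mor0.
have [Z [eps [resZ tZ]]] := resolution_of_complex DD' (fun i j => @yo_neg (X i) (X j)).
have BZ : inB I d.+1 Z.
  split; first by apply: left_tower_star_pow; exact: right_tower_left tZ.
  move=> i J i1 IJ; apply/Ext_vanishesP.
  have i0 : 0 < i%:Z by lia.
  apply: (vanishes_of_contra_exact resZ _ ((contra_ff J).1 (CE J IJ))) i0.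
  by move=> j m _ m0; have [] := yo_P_nonzero (X j) (pct_I_sub_P HT IJ) m0.
apply: (co_exact_of_vanishes resZ) => [i m _ m0|m m0]; last exact: V.
by have [] := yo_P_nonzero (X i) PQ m0.
Qed.

Lemma vanishes_P_of_co_exact (Z : T) (eps : cohom (yo (X 0)) Z 0) (Q : dob K) :
  (forall i, (i <= d)%N -> P (X i)) ->
  @resolution k (pretr K) d.+1 (fun i => yo (X i)) (fun i => yo_mor (del i)) Z eps ->
  (forall i J, (1 <= i)%N -> I J -> Ext_vanishes i Z (yo J)) ->
  (@is_complex k (H0 K) d X del ->
   (forall J, I J -> @contra_exact k (H0 K) d X del J) ->
   @co_exact k (H0 K) d X del Q) ->
  P Q -> forall m, m < 0 -> van (yo Q) Z m.
Proof.
move=> PX resZ VZ CC PQ.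
have CE : @co_exact k (H0 K) d X del Q.
  apply: CC => [i id|J IJ].
    apply: (@yo_mor_inj k K); rewrite yo_mor_comp yo_mor0.
    exact: (resolution_is_complex resZ).
  apply/contra_ff; apply: (contra_exact_of_vanishes resZ) => [i m _ m0|[m|m] // m0].
    by have [] := yo_P_nonzero (X i) (pct_I_sub_P HT IJ) m0.
  exact/Ext_vanishesP/VZ.
apply: (vanishes_of_co_exact resZ _ ((co_ff Q).1 CE)) => i m _ m0.
by have [] := yo_P_nonzero (X i) PQ m0.
Qed.

End Complexes.

Lemma vanishes_K_of_P (Z : T) (N : int) :
  (forall A : dob K, forall m, m < N -> van (yo A) Z m) ->
  (forall Q, P Q -> forall m, m < 0 -> van (yo Q) Z m) ->
  forall (A : dob K) m, m < 0 -> van (yo A) Z m.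
Proof.
move=> VN VP.
(* [c] counts the degrees gained above the initial bound [N]; after [|N|] steps all negative degrees
   are reached. *)
have V c : forall (A : dob K) m, m < N + c%:Z -> m < 0 -> van (yo A) Z m.
  elim: c => [|c IH] A m mc m0; first by apply: VN; lia.
  have [X [W [E [[Q PQ /isomorphicP QX] [B [A' _ /isomorphicP AB] BW] [S] EA]]]] :=
    hullK_resolution HT (hullK_yo A).
  apply: (vanishes_iso_con (addr0 m) EA).
  apply: (exact_vanishes_con (exact_pair_ip S) (addr0 m) (addr0 m)).
    exact: vanishes_iso_con (addr0 m) QX (VP Q PQ m m0).
  apply: (vanishes_iso_con (erefl (m + -1)) BW).
  by apply: (vanishes_iso_con (addr0 _) AB); apply: IH; lia.
move=> A m m0; apply: (V `|N|%N) => //; lia.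
Qed.

End MainProof.

Theorem proposition3p2 (k : comPzRingType) (d : nat) (K : dgcat k)
    (P I : dob K -> Prop) (HT : precluster_tilting_triple d P I) :
  concentrated_in_degree_zero (tau_le0 (Bcat I d.+1)) <->
  (concentrated_in_nonneg_degrees K /\
   forall (X : nat -> dob K) (del : forall i, @lhom k (H0 K) (X i.+1) (X i)),
     (forall i, (i <= d)%N -> P (X i)) ->
     @is_complex k (H0 K) d X del ->
     (forall J, I J -> @contra_exact k (H0 K) d X del J) ->
     forall Q, P Q -> @co_exact k (H0 K) d X del Q).
Proof.
split=> [/trunc_concentrated/fullsub_concentrated VB|[Kneg CC]].
  have Kneg : concentrated_in_nonneg_degrees K.
    move=> A B m m0; apply/yo_vanishes.
    exact: (VB _ _ _ (inB_yo HT d.+1 A) (inB_yo HT d.+1 B) m0).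
  split=> // X del PX DD CE Q PQ.
  apply: (co_exact_of_concentrated HT Kneg _ PQ DD CE) => Z BZ m.
  exact: (VB _ _ _ (inB_yo HT d.+1 Q) BZ).
apply/trunc_concentrated/fullsub_concentrated => Z1 Z2 m [Z1star _] [Z2star Z2Ext] m0.
have [X [del [eps [PX resZ]]]] := Ptower_resolution (star_pow_Ptower HT Z2star).
have [X1 [del1 [eps1 [_ resZ1]]]] := Ptower_resolution (star_pow_Ptower HT Z1star).
(* The terms of the resolution of [Z1] lie in K, so only maps from K to [Z2] remain to be
   treated. *)
apply: (resolution_neg_con resZ1) m0 => i l _ l0.
apply: (vanishes_K_of_P (N := - d.+1%:Z) HT _ _ l0) => [A j j0|Q PQ j j0].
  by apply: (resolution_neg_cov resZ) j0 => i' l' _; exact: yo_neg.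
apply: (vanishes_P_of_co_exact HT Kneg PX resZ Z2Ext _ PQ j0) => DD CE.
exact: CC.
Qed.
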